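(* Let $1<p,q<\infty$ with $\frac1p+\frac1q<1$ and let $\mu$ be a finite positive Borel measure on $[0,1)$. The following assertions hold: (i) The operator $\mathcal I_\mu$ is bounded on $AT^q_p$ if and only if $\mu$ is a $1$-CM. (ii) The operator $\mathcal I_\mu$ is compact on $AT^q_p$ if and only if $\mu$ is a $1$-VCM.
   Context: $\mathbb D$ is the open unit disc of $\mathbb C$, $\mathbb T$ the unit circle, $dA$ the normalized area Lebesgue measure on $\mathbb D$, $|d\xi|$ arc length on $\mathbb T$. For $\xi\in\mathbb T$ put $$\Gamma_{1/2}(\xi)=\{z\in\mathbb D:|z|<1/2\}\cup\bigcup_{|z|<1/2}[z,\xi),$$ where $[z,\xi)$ is the half-open line segment from $z$ to $\xi$. For $1<p,q<\infty$, $AT^q_p$ is the Banach space of analytic functions $f$ on $\mathbb D$ such that $$\|f\|_{AT^q_p}=\left\{\int_{\mathbb T}\left(\int_{\Gamma_{1/2}(\xi)}|f(z)|^p\,\frac{dA(z)}{1-|z|^2}\right)^{q/p}|d\xi|\right\}^{1/q}<\infty.$$ The integral operator is $$\mathcal I_\mu(f)(z)=\int_0^1\frac{f(t)}{1-tz}\,d\mu(t),\qquad z\in\mathbb D.$$ Saying that $\mathcal I_\mu$ is bounded (compact) on $AT^q_p$ includes that it is well defined there, i.e. the integral converges absolutely for every $f\in AT^q_p$ and $z\in\mathbb D$, and that it defines a bounded (compact) linear operator from $AT^q_p$ to itself. A finite positive Borel measure $\mu$ on $[0,1)$ is a $1$-Carleson measure ($1$-CM) if $\sup_{t\in[0,1)}\frac{\mu([t,1))}{1-t}<\infty$,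 and a $1$-vanishing Carleson measure ($1$-VCM) if $\lim_{t\to1^-}\frac{\mu([t,1))}{1-t}=0$. *)

(* Defs.v *)
From HB Require Import structures.
From mathcomp Require Import all_boot all_order all_algebra.
From mathcomp Require Import complex.
From mathcomp Require Import all_classical all_reals all_analysis.

Set Implicit Arguments.
Unset Strict Implicit.
Unset Printing Implicit Defensive.

Import Order.TTheory GRing.Theory Num.Theory.
Import numFieldNormedType.Exports.

Local Open Scope classical_set_scope.
Local Open Scope complex_scope.
Local Open Scope ring_scope.

(* The norm `|z| of z : R[i] is itself an element of R[i]; [modc z] is the
   modulus as an element of R. *)
Definition modc (R : realType) (z : R[i]) : R := ComplexField.Normc.normc z.

Definition expi (R : realType) (theta : R) : R[i] := cos theta +i* sin theta.

Definition unit_disc (R : realType) : set R[i] := [set z | modc z < 1].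

(* The topology of the complex plane is attached to R[i]^o, the normed space
   R[i] over the field R[i]. *)
Definition analytic_at (R : realType) (f : R[i] -> R[i]) (a : R[i]) : Prop :=
  exists c : nat -> R[i],
    \forall z \near (a : R[i]^o),
      series (fun n => c n * (z - a) ^+ n : R[i]^o) @ \oo --> (f z : R[i]^o).

(* Functions on the disc are represented by total functions on R[i], of which
   only the values on the disc matter. *)
Definition analytic_on_disc (R : realType) (f : R[i] -> R[i]) : Prop :=
  forall a, unit_disc a -> analytic_at f a.

(* The half-open segment [z, xi). *)
Definition segment_co (R : realType) (z xi : R[i]) : set R[i] :=
  [set (1 - s%:C) * z + s%:C * xi | s in `[0, 1[%classic].

Definition Gamma_half (R : realType) (xi : R[i]) : set R[i] :=
  [set z | unit_disc z /\ modc z < 2^-1] `|`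
  \bigcup_(z in [set z | modc z < 2^-1]) segment_co z xi.

(* \int_E g dA, with dA the area measure normalized so that the unit disc has
   measure 1. *)
Definition area_integral (R : realType) (E : set R[i]) (g : R[i] -> R) :
    \bar R :=
  ((pi^-1)%:E *
   \int[(@lebesgue_measure R \x @lebesgue_measure R)%E]_(
       w in [set w : R * R | E (w.1 +i* w.2)]) (g (w.1 +i* w.2))%:E)%E.

Definition arc_integral (R : realType) (g : R[i] -> \bar R) : \bar R :=
  (\int[@lebesgue_measure R]_(theta in `[0%R, (2 * pi)%R[) g (expi theta))%E.

Definition AT_norm (R : realType) (p q : R) (f : R[i] -> R[i]) : \bar R :=
  poweR
    (arc_integral (fun xi =>
       poweR (area_integral (Gamma_half xi)
                (fun z => modc (f z) `^ p / (1 - modc z ^+ 2)))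
             (q / p)))
    q^-1.

Definition AT (R : realType) (p q : R) : set (R[i] -> R[i]) :=
  [set f | analytic_on_disc f /\ (AT_norm p q f < +oo)%E].

Section IntegralOperator.
Variables (R : realType) (mu : {measure set (measurableTypeR R) -> \bar R}).

Definition I_kernel (f : R[i] -> R[i]) (z : R[i]) (t : R) : R[i] :=
  f t%:C / (1 - t%:C * z).

Definition I_op (f : R[i] -> R[i]) (z : R[i]) : R[i] :=
  (\int[mu]_(t in `[0%R, 1%R[) complex.Re (I_kernel f z t)) +i*
  (\int[mu]_(t in `[0%R, 1%R[) complex.Im (I_kernel f z t)).

Definition I_converges (f : R[i] -> R[i]) (z : R[i]) : Prop :=
  (\int[mu]_(t in `[0%R, 1%R[) (modc (I_kernel f z t))%:E < +oo)%E.

Definition I_well_defined (p q : R) : Prop :=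
  forall f, AT p q f ->
    (forall z, unit_disc z -> I_converges f z) /\ AT p q (I_op f).

Definition I_bounded (p q : R) : Prop :=
  I_well_defined p q /\
  exists C : R, forall f, AT p q f ->
    (AT_norm p q (I_op f) <= C%:E * AT_norm p q f)%E.

(* Every norm-bounded sequence has a subsequence whose images under the
   operator converge in AT. *)
Definition I_compact (p q : R) : Prop :=
  I_well_defined p q /\
  forall f : nat -> R[i] -> R[i],
    (forall n, AT p q (f n)) ->
    (exists M : R, forall n, (AT_norm p q (f n) <= M%:E)%E) ->
    exists (k : nat -> nat) (g : R[i] -> R[i]),
      [/\ {homo k : m n / (m < n)%N},
          AT p q g &
          AT_norm p q (fun z => I_op (f (k n)) z - g z) @[n --> \oo] --> 0%E].

Definition carleson_ratio (t : R) : \bar R :=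
  (mu `[t, 1%R[%classic * ((1 - t)^-1)%:E)%E.

Definition is_1CM : Prop :=
  (ereal_sup [set carleson_ratio t | t in `[0%R, 1%R[%classic] < +oo)%E.

Definition is_1VCM : Prop := carleson_ratio t @[t --> 1^'-] --> 0%E.

End IntegralOperator.

(* Main.v *)
(* Put al = 1/p + 1/q and d_k = 2^-k.  Only the behaviour near the radius
   [0, 1) matters, and there AT is a weighted sequence space.  On one side,
   averaging |f|^p over boxes of size d_k around 1 - d_k, which lie in
   Gamma_{1/2}(xi) for all xi in an arc of length comparable to d_k, gives
   sum_k (d_k^al sup_{box k} |f|)^q <= C |f|_AT^q.  On the other side, a function
   bounded by G_k where d_k < |1 - z| <= 2 d_k satisfies
   |f|_AT^q <= C sum_k (d_k^al G_k)^q.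

   If |f| <= u_j on [1 - d_j, 1 - d_{j+1}) and eps_j = mu([1 - d_j, 1)) / d_j,
   then |I_mu f(z)| <= C sum_j eps_j u_j d_j / max(d_j, d_k) when |1 - z| ~ d_k.
   As 0 < al < 1, after conjugation by d^al this kernel decays geometrically in
   |j - k|, so |I_mu f|_AT^q <= C sum_j (eps_j d_j^al u_j)^q.  Boundedness follows
   when eps is bounded.  When eps -> 0, a bounded sequence in AT has an
   ultralimit along the radius, locally uniform on [0, 1), and the estimate
   applied to differences gives compactness.

   Conversely f_n = d_n^(1-al) / (1 - (1 - d_n) z) is bounded in AT and
   d_n^al |I_mu f_n(1 - d_n)| >= eps_n / 4, whereas d_n^al |g(1 - d_n)| is
   bounded by C |g|_AT and tends to 0 for each g in AT. *)

(* Analyticity is given as local power series only, and the function theory rests on one fact, a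
   mean value inequality on squares. Summing g over the four quarter turns about a point reduces an
   integral around a square to one side, on which the derivative of the mean in the half-width
   integrates to zero. Averaged over half-widths, it gives the area means behind the lower bound;
   applied to a difference quotient, it gives the Cauchy estimate behind equicontinuity on the
   radius. The lower bound turns suprema into a sum by giving box k an arc of length comparable to
   d_k of its own, disjoint from the others. The condition al < 1 acts in the kernel: for j > k,
   (d_j / d_k) d_k^al = (d_j / d_k)^(1 - al) d_j^al. I_mu f depends only on f on [0, 1). The
   operator bound is therefore stated for measurable functions with a dyadic majorant, which covers
   the ultralimit on the radius, and with a constant independent of mu, so that Dirac masses yield
   the norms of the test functions. *)
Require Import Defs.
From HB Require Import structures.
From mathcomp Require Import all_boot all_order all_algebra.
From mathcomp Require Import complex.
From mathcomp Require Import all_classical all_reals all_analysis.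
From mathcomp Require Import measurable_realfun ring lra.
Set Implicit Arguments.
Unset Strict Implicit.
Unset Printing Implicit Defensive.
Import Order.TTheory GRing.Theory Num.Theory.
Import numFieldNormedType.Exports.
Local Open Scope classical_set_scope.
Local Open Scope ring_scope.

(** * The modulus of complex numbers *)

#[global] Arguments modc : simpl never.

Section Modulus.
Context {R : realType}.
Implicit Types (z w a : R[i]) (x : R).

Lemma modcE z : modc z = Num.sqrt (complex.Re z ^+ 2 + complex.Im z ^+ 2).
Proof. by case: z. Qed.

Lemma norm_modc z : `|z| = ((modc z)%:C)%C.
Proof. by rewrite normc_def modcE. Qed.

Lemma modc_ge0 z : 0 <= modc z.
Proof. by rewrite modcE sqrtr_ge0. Qed.

Lemma modcM z w : modc (z * w) = modc z * modc w.
Proof. exact: ComplexField.Normc.normcM. Qed.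

Lemma modc1 : modc (1 : R[i]) = 1.
Proof. exact: ComplexField.Normc.normc1. Qed.

Lemma modc0 : modc (0 : R[i]) = 0.
Proof. exact: ComplexField.Normc.normc0. Qed.

Lemma modcX z n : modc (z ^+ n) = modc z ^+ n.
Proof. by elim: n => [|n IH]; rewrite ?expr0 ?modc1// !exprS modcM IH. Qed.

Lemma modcMn z n : modc (z *+ n) = modc z *+ n.
Proof. exact: normcMn. Qed.

Lemma modcV z : modc z^-1 = (modc z)^-1.
Proof. exact: ComplexField.Normc.normcV. Qed.

Lemma modcN z : modc (- z) = modc z.
Proof. exact: normcN. Qed.

Lemma modcB z w : modc (z - w) = modc (w - z).
Proof. by rewrite -modcN opprB. Qed.

Lemma modcD z w : modc (z + w) <= modc z + modc w.
Proof. exact: le_normcD. Qed.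

Lemma modc_sum (I : Type) (r : seq I) (P : pred I) (F : I -> R[i]) :
  modc (\sum_(i <- r | P i) F i) <= \sum_(i <- r | P i) modc (F i).
Proof.
elim/big_ind2 : _ => //; first by rewrite modc0.
by move=> z x w y zx wy; rewrite (le_trans (modcD _ _)) ?lerD.
Qed.

Lemma modc_eq0 z : (modc z == 0) = (z == 0).
Proof.
by apply/eqP/eqP => [|->]; [exact: ComplexField.Normc.eq0_normc|exact: modc0].
Qed.

Lemma modc_gt0 z : (0 < modc z) = (z != 0).
Proof. by rewrite lt_def modc_ge0 andbT modc_eq0. Qed.

Lemma modc_real x : modc (x%:C)%C = `|x|.
Proof. by rewrite modcE/= expr0n/= addr0 sqrtr_sqr. Qed.

Lemma Re_le_modc z : `|complex.Re z| <= modc z.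
Proof. by rewrite modcE -sqrtr_sqr ler_wsqrtr// lerDl sqr_ge0. Qed.

Lemma Im_le_modc z : `|complex.Im z| <= modc z.
Proof. by rewrite modcE -sqrtr_sqr ler_wsqrtr// lerDr sqr_ge0. Qed.

Lemma modc_le_ReIm z : modc z <= `|complex.Re z| + `|complex.Im z|.
Proof.
rewrite modcE -[leRHS]ger0_norm ?addr_ge0// -sqrtr_sqr ler_wsqrtr//.
by rewrite sqrrD !real_normK ?num_real// -addrA lerD2l lerDr mulrn_wge0 ?mulr_ge0.
Qed.

Lemma modcB_ge z w : modc z - modc w <= modc (z - w).
Proof. by rewrite lerBlDr (le_trans _ (modcD _ _))// subrK. Qed.

Lemma cReD z w : complex.Re (z + w) = complex.Re z + complex.Re w.
Proof. by case: z; case: w. Qed.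
Lemma cImD z w : complex.Im (z + w) = complex.Im z + complex.Im w.
Proof. by case: z; case: w. Qed.
Lemma cReN z : complex.Re (- z) = - complex.Re z.
Proof. by case: z. Qed.
Lemma cImN z : complex.Im (- z) = - complex.Im z.
Proof. by case: z. Qed.
Lemma cReM z w :
  complex.Re (z * w) = complex.Re z * complex.Re w - complex.Im z * complex.Im w.
Proof. by case: z; case: w. Qed.
Lemma cImM z w :
  complex.Im (z * w) = complex.Re z * complex.Im w + complex.Im z * complex.Re w.
Proof. by case: z; case: w. Qed.

Lemma complexP z w : complex.Re z = complex.Re w ->
  complex.Im z = complex.Im w -> z = w.
Proof. by case: z; case: w => /= ? ? ? ? -> ->. Qed.

Lemma gt0_realc z : 0 < z -> z = ((complex.Re z)%:C)%C /\ 0 < complex.Re z.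
Proof. by case: z => x y; rewrite ltcE/= => /andP[/eqP -> ?]. Qed.

Lemma near_modcP (P : set R[i]) a :
  (\forall z \near (a : R[i]^o), P z) <->
  exists2 d : R, 0 < d & forall z, modc (z - a) < d -> P z.
Proof.
split.
  move=> /nbhs_ballP[e /= e0 He].
  have [ee e0'] := gt0_realc e0.
  exists (complex.Re e) => // z zd; apply: He.
  by rewrite /ball/= ee norm_modc ltcR modcB.
move=> [d d0 Hd]; apply/nbhs_ballP; exists (d%:C)%C => /=; first by rewrite ltcR.
by move=> z; rewrite /ball/= norm_modc ltcR modcB => /Hd.
Qed.

Lemma cvg_modcP (u : nat -> R[i]) (l : R[i]) :
  (u @ \oo --> (l : R[i]^o)) <-> (modc (u n - l) @[n --> \oo] --> (0 : R)).
Proof.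
split.
  move=> /(@cvgrPdist_lt R[i] R[i]^o nat \oo _ u l) ul; apply/cvgrPdist_lt => e e0.
  have /ul : 0 < (e%:C)%C :> R[i] by rewrite ltcR.
  apply: filterS => n; rewrite norm_modc ltcR sub0r normrN ger0_norm ?modc_ge0//.
  by rewrite modcB.
move=> /cvgrPdist_lt ul; apply/(@cvgrPdist_lt R[i] R[i]^o nat \oo _ u l) => e e0.
have [ee e0'] := gt0_realc e0.
move: (ul _ e0'); apply: filterS => n; rewrite sub0r normrN ger0_norm ?modc_ge0//.
by rewrite norm_modc ee ltcR modcB.
Qed.

End Modulus.

(** * Complex series and their sums, through moduli *)

Section Eps.
Context {R : realType}.
(** Convergence is expressed by a real limit of moduli, so that the estimates below stay in R;
    [analytic_atP] is the bridge to the topology of [R[i]^o]. *)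
Definition has_csum (u : nat -> R[i]) (l : R[i]) : Prop :=
  modc (\sum_(0 <= k < n) u k - l) @[n --> \oo] --> (0 : R).

Lemma analytic_atP (f : R[i] -> R[i]) (a : R[i]) :
  analytic_at f a <-> exists (c : nat -> R[i]) (d : R), 0 < d /\
    forall z, modc (z - a) < d -> has_csum (fun n => c n * (z - a) ^+ n) (f z).
Proof.
split.
  move=> [c /near_modcP[d d0 H]]; exists c, d; split=> // z zd.
  exact/cvg_modcP/H.
move=> [c [d [d0 H]]]; exists c; apply/near_modcP; exists d => // z zd.
exact/cvg_modcP/H.
Qed.

Lemma cvg_ReIm_modc (u : nat -> R[i]) (l : R[i]) :
  complex.Re (u n) @[n --> \oo] --> complex.Re l ->
  complex.Im (u n) @[n --> \oo] --> complex.Im l ->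
  modc (u n - l) @[n --> \oo] --> (0 : R).
Proof.
move=> /cvgrPdist_le ur /cvgrPdist_le ui; apply/cvgrPdist_le => e e0.
have e2 : 0 < e / 2 by rewrite divr_gt0.
near=> n; rewrite sub0r normrN ger0_norm ?modc_ge0// modcB.
rewrite (le_trans (modc_le_ReIm _))// cReD cImD cReN cImN [leRHS]splitr lerD//.
  by near: n; exact: ur.
by near: n; exact: ui.
Unshelve. all: end_near. Qed.
End Eps.

(** * Power series and complex derivatives *)

Section PowerSeries.
Context {R : realType}.
Implicit Types (f g : R[i] -> R[i]) (u v : nat -> R[i]).

(** The first-order expansion avoids a quotient; the bound is non-strict because w = z is
    allowed. *)
Definition cderiv f (l z : R[i]) : Prop :=
  forall e : R, 0 < e -> exists2 d : R, 0 < d &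
    forall w, modc (w - z) < d -> modc (f w - f z - l * (w - z)) <= e * modc (w - z).

Definition ccont f (z : R[i]) : Prop :=
  forall e : R, 0 < e -> exists2 d : R, 0 < d &
    forall w, modc (w - z) < d -> modc (f w - f z) < e.

Lemma has_csumP u (l : R[i]) : has_csum u l <->
  forall e : R, 0 < e -> exists N, forall n, (N <= n)%N ->
    modc (\sum_(0 <= k < n) u k - l) < e.
Proof.
split=> [/cvgrPdist_lt H e /H[N _ HN]|H].
  exists N => n Nn; have := HN n Nn.
  by rewrite sub0r normrN ger0_norm ?modc_ge0.
apply/cvgrPdist_lt => e /H[N HN]; exists N => // n /= Nn.
by rewrite sub0r normrN ger0_norm ?modc_ge0// HN.
Qed.

Lemma has_csumD u v (l m : R[i]) : has_csum u l -> has_csum v m ->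
  has_csum (fun n => u n + v n) (l + m).
Proof.
move=> /has_csumP Hu /has_csumP Hv; apply/has_csumP => e e0.
have e2 : 0 < e / 2 by rewrite divr_gt0.
have [N HN] := Hu _ e2; have [N' HN'] := Hv _ e2.
exists (maxn N N') => n; rewrite geq_max => /andP[/HN h1 /HN' h2].
rewrite big_split/= opprD addrACA (le_lt_trans (modcD _ _))//.
by rewrite [ltRHS]splitr ltrD.
Qed.

Lemma has_csumZ u (k l : R[i]) : has_csum u l ->
  has_csum (fun n => k * u n) (k * l).
Proof.
move=> /has_csumP Hu; apply/has_csumP => e e0.
have k1 : 0 < modc k + 1 by rewrite ltr_wpDl ?modc_ge0.
have [N HN] := Hu (e / (modc k + 1)) (divr_gt0 e0 k1).
exists N => n /HN h; rewrite -big_distrr/= -mulrBr modcM.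
move: h; rewrite ltr_pdivlMr// => /le_lt_trans; apply.
by rewrite mulrC ler_wpM2l ?modc_ge0// lerDl.
Qed.

Lemma has_csum_term_bounded u (l : R[i]) : has_csum u l ->
  exists M, forall n, modc (u n) <= M.
Proof.
move=> ul; have : cvgn (fun n => modc (\sum_(0 <= k < n) u k - l)).
  by apply/cvg_ex; exists 0.
move=> /cvg_seq_bounded[M [_ HM]].
have {}HM n : modc (\sum_(0 <= k < n) u k - l) <= M + 1.
  have := HM (M + 1); rewrite ltrDl ltr01 => /(_ isT n I) /=.
  by rewrite ger0_norm ?modc_ge0.
exists ((M + 1) + (M + 1)) => n.
have -> : u n = (\sum_(0 <= k < n.+1) u k - l) - (\sum_(0 <= k < n) u k - l).
  by rewrite big_nat_recr//=; ring.
by rewrite (le_trans (modcD _ _))// modcN lerD.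
Qed.

Lemma has_csum_le u (l : R[i]) (B : R) : has_csum u l ->
  (forall n, \sum_(0 <= k < n) modc (u k) <= B) -> modc l <= B.
Proof.
move=> /has_csumP ul HB; apply/ler_addgt0Pr => e /ul[N HN].
have -> : l = \sum_(0 <= k < N) u k - (\sum_(0 <= k < N) u k - l).
  by rewrite opprB addrC subrK.
rewrite (le_trans (modcD _ _))// lerD//.
  by rewrite (le_trans (modc_sum _ _ _)).
by rewrite modcN ltW// HN.
Qed.

Lemma has_csum_abs u (B : R) :
  (forall n, \sum_(0 <= k < n) modc (u k) <= B) -> exists l, has_csum u l.
Proof.
move=> HB.
have H (p : R[i] -> R) : (forall z, `|p z| <= modc z) ->
    cvgn (series (fun n => p (u n))).
  move=> Hp; apply: normed_cvg; apply: nondecreasing_is_cvgn.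
    by apply: nondecreasing_series => *; exact: normr_ge0.
  exists B => _ [n _ <-]; apply: le_trans (HB n).
  by rewrite /series/= ler_sum.
have /cvg_ex[x Hx] := H _ (@Re_le_modc R).
have /cvg_ex[y Hy] := H _ (@Im_le_modc R).
exists (x +i* y)%C; apply: cvg_ReIm_modc => /=.
  rewrite (_ : (fun _ => _) = series (fun n => complex.Re (u n)))//.
  apply/funext => n; rewrite /series/=.
  by elim/big_ind2 : _ => // [w ? z ? <- <-]; rewrite cReD.
rewrite (_ : (fun _ => _) = series (fun n => complex.Im (u n)))//.
apply/funext => n; rewrite /series/=.
by elim/big_ind2 : _ => // [w ? z ? <- <-]; rewrite cImD.
Qed.

(** 6 is the sum of the whole series, and the remainder has a closed form, so induction is exact.
    The factor k^2 is that of the Taylor remainders of z^k. *)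
Lemma sum_sqr_geometric n :
  \sum_(0 <= k < n) (k%:R ^+ 2 / 2 ^+ k) <= 6 :> R.
Proof.
suff -> : \sum_(0 <= k < n) (k%:R ^+ 2 / 2 ^+ k) =
    6 - (2 * n%:R ^+ 2 + 4 * n%:R + 6) / 2 ^+ n :> R.
  rewrite gerBl; apply: divr_ge0; last exact: exprn_ge0.
  by have := ler0n R n; nra.
elim: n => [|n IH].
  by rewrite big_nil expr0; field.
rewrite big_nat_recr//= IH (exprS _ n) -[n.+1%:R]natr1.
have : 2 ^+ n != 0 :> R by rewrite expf_neq0.
by move: (2 ^+ n) => y y0; field.
Qed.

(** Both sides carry an extra factor s, which avoids the exponent n - 1 and lets the induction start
    at n = 0. *)
Lemma subX_le (x y : R[i]) (s : R) n : modc x <= s -> modc y <= s ->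
  s * modc (x ^+ n - y ^+ n) <= n%:R * s ^+ n * modc (x - y).
Proof.
move=> xs ys; have s0 : 0 <= s by rewrite (le_trans (modc_ge0 x)).
elim: n => [|n IH]; first by rewrite !expr0 subrr modc0 mulr0 !mul0r.
have -> : x ^+ n.+1 - y ^+ n.+1 = x * (x ^+ n - y ^+ n) + (x - y) * y ^+ n.
  by rewrite !exprS; ring.
apply: (@le_trans _ _ (s * (s * modc (x ^+ n - y ^+ n)) + s * (modc (x - y) * s ^+ n))).
  rewrite -mulrDr ler_wpM2l// (le_trans (modcD _ _))// lerD// modcM.
    by rewrite ler_wpM2r ?modc_ge0.
  by rewrite ler_wpM2l ?modc_ge0// modcX lerXn2r ?nnegrE ?modc_ge0.
apply: le_trans (lerD (ler_wpM2l s0 IH) (lexx _)) _.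
by rewrite exprS -[n.+1%:R]natr1 le_eqVlt; apply/orP; left; apply/eqP; ring.
Qed.

Lemma taylorX_id (A : comPzRingType) (x y X Y Z : A) :
  x * X - y * (y * Y) - (y * Y + y * Z) * (x - y) =
  x * (X - y * Y - Z * (x - y)) + Z * (x - y) ^+ 2.
Proof. by ring. Qed.

(** The remainder for n + 1 is x times the remainder for n plus n y^(n-1) (x - y)^2; since n^2 + n
    <= (n + 1)^2, the coefficient n^2 propagates. The factor s^2 clears the exponent n - 2. *)
Lemma taylorX_le (x y : R[i]) (s : R) n : modc x <= s -> modc y <= s ->
  s ^+ 2 * modc (x ^+ n - y ^+ n - (y ^+ n.-1 *+ n) * (x - y)) <=
  n%:R ^+ 2 * s ^+ n * modc (x - y) ^+ 2.
Proof.
move=> xs ys; have s0 : 0 <= s by rewrite (le_trans (modc_ge0 x)).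
elim: n => [|n IH].
  by rewrite !expr0 subrr mulr0n mul0r subrr modc0 mulr0 mulr_ge0// sqr_ge0.
have -> : x ^+ n.+1 - y ^+ n.+1 - (y ^+ n.+1.-1 *+ n.+1) * (x - y) =
    x * (x ^+ n - y ^+ n - (y ^+ n.-1 *+ n) * (x - y)) +
    (y ^+ n.-1 *+ n) * (x - y) ^+ 2.
  case: n {IH} => [|n]; first by rewrite !mulr0n expr1 expr0; ring.
  rewrite (_ : n.+2.-1 = n.+1)// (_ : n.+1.-1 = n)// [y ^+ n.+1 *+ _]mulrS.
  rewrite (exprS x n.+1) (exprS y n.+1) (exprS y n) -mulrnAr.
  exact: taylorX_id.
have H : s ^+ 2 * modc ((y ^+ n.-1 *+ n) * (x - y) ^+ 2) <=
    n%:R * s ^+ n.+1 * modc (x - y) ^+ 2.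
  rewrite modcM modcX mulrA ler_wpM2r ?sqr_ge0//.
  case: n {IH} => [|n]; first by rewrite mulr0n modc0 mulr0 mul0r.
  rewrite modcMn modcX (_ : n.+1.-1 = n)// -[_ *+ _]mulr_natl mulrCA.
  rewrite ler_wpM2l// -[n.+2]add2n exprD ler_wpM2l ?sqr_ge0//.
  by rewrite lerXn2r ?nnegrE ?modc_ge0.
apply: (@le_trans _ _ (s * (s ^+ 2 * modc (x ^+ n - y ^+ n - (y ^+ n.-1 *+ n) * (x - y))) +
   n%:R * s ^+ n.+1 * modc (x - y) ^+ 2)).
  apply: le_trans (lerD (lexx _) H); rewrite (mulrCA s) -mulrDr ler_wpM2l ?sqr_ge0//.
  rewrite (le_trans (modcD _ _))// lerD// modcM.
  by rewrite ler_wpM2r ?modc_ge0.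
apply: le_trans (lerD (ler_wpM2l s0 IH) (lexx _)) _.
rewrite mulrA -mulrDl ler_wpM2r ?sqr_ge0//.
rewrite mulrCA -exprS -mulrDl ler_wpM2r ?exprn_ge0//.
by rewrite -[n.+1%:R]natr1; have := ler0n R n; nra.
Qed.

(** The terms of the series at a + d/2 are bounded, so |c_n| s^n <= M / 2^n with s = d/4. On the
    disc of radius s, the differentiated series, its differences and the Taylor remainders are then
    dominated term by term by multiples of k^2 / 2^k. *)
Lemma power_series_C1 f (a : R[i]) (c : nat -> R[i]) (d : R) : 0 < d ->
  (forall z, modc (z - a) < d -> has_csum (fun n => c n * (z - a) ^+ n) (f z)) ->
  exists (f' : R[i] -> R[i]) (s B : R), [/\ 0 < s, 0 <= B &
    forall z w, modc (z - a) < s -> modc (w - a) < s ->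
      modc (f w - f z - f' z * (w - z)) <= B * modc (w - z) ^+ 2 /\
      modc (f' w - f' z) <= B * modc (w - z)].
Proof.
move=> d0 H.
(* With 2 s = d/2 < d the series converges at a + 2 s, which supplies the geometric factor 1 / 2^n
   on the smaller disc. *)
pose s := d / 4; have s0 : 0 < s by rewrite divr_gt0.
have [M HM] : exists M, forall n, modc (c n) * s ^+ n <= M / 2 ^+ n.
  have : modc ((a + ((s * 2)%:C)%C) - a) < d.
    rewrite addrC addKr modc_real gtr0_norm ?mulr_gt0//.
    by rewrite /s; lra.
  move=> /H/has_csum_term_bounded[M HM]; exists M => n.
  rewrite ler_pdivlMr ?exprn_gt0//; have := HM n.
  rewrite addrC addKr modcM modcX modc_real gtr0_norm ?mulr_gt0//.
  by rewrite exprMn mulrA.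
have M0 : 0 <= M.
  by have := HM 0%N; rewrite expr0 divr1; apply: le_trans; rewrite mulr1 modc_ge0.
have bnd (D : nat -> R) n : (forall k, D k <= k%:R ^+ 2 * s ^+ k) ->
    \sum_(0 <= k < n) modc (c k) * D k <= 6 * M.
  move=> HD; apply: (@le_trans _ _ (M * \sum_(0 <= k < n) (k%:R ^+ 2 / 2 ^+ k))); last first.
    by rewrite [leRHS]mulrC ler_wpM2l// sum_sqr_geometric.
  rewrite big_distrr/=; apply: ler_sum => k _.
  apply: le_trans (ler_wpM2l (modc_ge0 _) (HD k)) _.
  by rewrite mulrCA [leRHS]mulrCA ler_wpM2l ?sqr_ge0.
have ex z : exists l, modc (z - a) < s ->
    has_csum (fun n => c n * ((z - a) ^+ n.-1 *+ n)) l.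
  have [zs|zs] := pselect (modc (z - a) < s); last by exists 0.
  suff /has_csum_abs[l Hl] : forall n,
    \sum_(0 <= k < n) modc (c k * ((z - a) ^+ k.-1 *+ k)) <= 6 * M / s by exists l.
  move=> n; rewrite ler_pdivlMr// big_distrl/=.
  under eq_bigr do rewrite modcM -mulrA.
  apply: bnd => k; rewrite modcMn modcX.
  case: k => [|k]; first by rewrite mulr0n mul0r expr0n/= mul0r.
  rewrite -[_ *+ _]mulr_natl (_ : k.+1.-1 = k)//.
  apply: (@le_trans _ _ (k.+1%:R * s ^+ k.+1)).
    rewrite -mulrA ler_wpM2l// exprSr ler_wpM2r ?(ltW s0)//.
    by rewrite lerXn2r ?nnegrE ?modc_ge0 ?ltW.
  by rewrite ler_wpM2r ?exprn_ge0 ?(ltW s0)// ler_eXnr// ler1n.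
have {ex}[f' Hf'] := choice ex.
exists f', s, (6 * M / s ^+ 2); split => //.
  by apply: divr_ge0; [exact: mulr_ge0|exact/exprn_ge0/ltW].
move=> z w zs ws.
have sd : s <= d by rewrite /s; lra.
have Hz := H _ (lt_le_trans zs sd); have Hw := H _ (lt_le_trans ws sd).
have s20 : 0 < s ^+ 2 by rewrite exprn_gt0.
have wz : w - z = (w - a) - (z - a) by ring.
split.
  have [->|nwz] := eqVneq w z.
    by rewrite !subrr mulr0 subr0 modc0 expr0n/= mulr0.
  have h0 : 0 < modc (w - z) by rewrite modc_gt0 subr_eq0.
  have := has_csumD (has_csumD Hw (has_csumZ (-1) Hz))
     (has_csumZ (- (w - z)) (Hf' z zs)).
  rewrite (_ : _ + _ = f w - f z - f' z * (w - z)); last by ring.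
  move=> /has_csum_le; apply => n.
  rewrite -ler_pdivrMr ?exprn_gt0// ler_pdivlMr//.
  rewrite big_distrl/= big_distrl/=.
  under eq_bigr => k _.
    rewrite (_ : _ + _ + _ = c k * ((w - a) ^+ k - (z - a) ^+ k -
       ((z - a) ^+ k.-1 *+ k) * ((w - a) - (z - a)))); last first.
      by rewrite -wz; ring.
    rewrite modcM -!mulrA.
    over.
  apply: bnd => k; rewrite mulrCA ler_pdivrMl ?exprn_gt0// mulrC.
  rewrite [leRHS]mulrC wz; apply: taylorX_le; exact: ltW.
have := has_csumD (Hf' w ws) (has_csumZ (-1) (Hf' z zs)).
rewrite mulN1r => /has_csum_le; apply => n.
have [->|nwz] := eqVneq w z.
  rewrite subrr modc0 mulr0 big1// => k _.
  by rewrite mulN1r subrr modc0.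
have h0 : 0 < modc (w - z) by rewrite modc_gt0 subr_eq0.
rewrite -ler_pdivrMr// ler_pdivlMr//.
rewrite big_distrl/= big_distrl/=.
under eq_bigr => k _.
  rewrite (_ : _ + _ = c k * (((w - a) ^+ k.-1 - (z - a) ^+ k.-1) *+ k)); last first.
    by rewrite mulrnBl mulrBr mulN1r.
  rewrite modcM -!mulrA.
  over.
apply: bnd => k; rewrite mulrCA ler_pdivrMl// mulrC modcMn.
case: k => [|k]; first by rewrite mulr0n expr0n/= !(mul0r, mulr0).
rewrite -mulr_natl /= wz.
have /(ler_wpM2l (ltW s0)) := @subX_le (w - a) (z - a) s k (ltW ws) (ltW zs).
rewrite mulrA -expr2 => h.
rewrite [leLHS](_ : _ = k.+1%:R * (s ^+ 2 * modc ((w - a) ^+ k - (z - a) ^+ k))); last by ring.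
apply: le_trans (ler_wpM2l (ler0n _ _) h) _.
rewrite [leLHS](_ : _ = k.+1%:R * k%:R * (modc (w - a - (z - a)) * s ^+ k.+1)); last first.
  by rewrite exprS; ring.
rewrite [leRHS](_ : _ = k.+1%:R ^+ 2 * (modc (w - a - (z - a)) * s ^+ k.+1)); last by ring.
rewrite ler_wpM2r ?mulr_ge0 ?modc_ge0 ?exprn_ge0 ?(ltW s0)//.
by rewrite expr2 ler_wpM2l// ler_nat.
Qed.

End PowerSeries.

Section ComplexDerivative.
Context {R : realType}.
Implicit Types (f g : R[i] -> R[i]).

Lemma cderiv_uniq f (l m z : R[i]) : cderiv f l z -> cderiv f m z -> l = m.
Proof.
move=> Hl Hm; apply/eqP; rewrite -subr_eq0 -modc_eq0 eq_le modc_ge0 andbT.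
apply/ler_addgt0Pr => e e0; rewrite add0r.
have e2 : 0 < e / 2 by rewrite divr_gt0.
have [d d0 Hd] := Hl _ e2; have [d' d0' Hd'] := Hm _ e2.
pose h := Num.min d d' / 2; have h0 : 0 < h by rewrite divr_gt0// lt_min d0.
have hh : h < Num.min d d' by rewrite /h ltr_pdivrMr// ltr_pMr ?lt_min ?d0// ltr1n.
move: hh; rewrite lt_min => /andP[hd hd'].
have wz : modc ((z + (h%:C)%C) - z) = h.
  by rewrite addrC addKr modc_real gtr0_norm.
have := Hd (z + (h%:C)%C); have := Hd' (z + (h%:C)%C).
rewrite !wz => /(_ hd') A /(_ hd) B.
rewrite -(ler_pM2r h0); have <- : e / 2 * h + e / 2 * h = e * h by field.
apply: le_trans (lerD A B).
rewrite -[X in modc _ * X](gtr0_norm h0) -modc_real -modcM.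
rewrite -[X in _ <= _ + X]modcN; apply: le_trans (modcD _ _).
rewrite le_eqVlt; apply/orP; left; apply/eqP; congr modc.
by ring.
Qed.

Lemma cderiv_ccont f (l z : R[i]) : cderiv f l z -> ccont f z.
Proof.
move=> Hl e e0; have [d d0 Hd] := Hl 1 ltr01.
have l0 : 0 < modc l + 2 by rewrite ltr_wpDl ?modc_ge0.
exists (Num.min d (e / (modc l + 2))); first by rewrite lt_min d0 divr_gt0.
move=> w; rewrite lt_min => /andP[wd].
rewrite ltr_pdivlMr// mulrC => we; apply: le_lt_trans we.
have -> : f w - f z = (f w - f z - l * (w - z)) + l * (w - z) by rewrite subrK.
rewrite (le_trans (modcD _ _))// modcM.
have := Hd _ wd; rewrite mul1r; have := modc_ge0 (w - z).
by set x := modc (f w - _ - _); nra.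
Qed.

Lemma cderivD f g (l m z : R[i]) : cderiv f l z -> cderiv g m z ->
  cderiv (fun w => f w + g w) (l + m) z.
Proof.
move=> Hl Hm e e0; have e2 : 0 < e / 2 by rewrite divr_gt0.
have [d d0 Hd] := Hl _ e2; have [d' d0' Hd'] := Hm _ e2.
exists (Num.min d d'); first by rewrite lt_min d0.
move=> w; rewrite lt_min => /andP[/Hd A /Hd' B].
have -> : f w + g w - (f z + g z) - (l + m) * (w - z) =
  (f w - f z - l * (w - z)) + (g w - g z - m * (w - z)) by ring.
rewrite (le_trans (modcD _ _))//.
have -> : e * modc (w - z) = e / 2 * modc (w - z) + e / 2 * modc (w - z) by field.
exact: lerD.
Qed.

Lemma ccontD f g (z : R[i]) : ccont f z -> ccont g z ->
  ccont (fun w => f w + g w) z.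
Proof.
move=> Hl Hm e e0; have e2 : 0 < e / 2 by rewrite divr_gt0.
have [d d0 Hd] := Hl _ e2; have [d' d0' Hd'] := Hm _ e2.
exists (Num.min d d'); first by rewrite lt_min d0.
move=> w; rewrite lt_min => /andP[/Hd A /Hd' B].
have -> : f w + g w - (f z + g z) = (f w - f z) + (g w - g z) by ring.
by rewrite (le_lt_trans (modcD _ _))// [ltRHS]splitr ltrD.
Qed.

Lemma ccontZ f (k z : R[i]) : ccont f z -> ccont (fun w => k * f w) z.
Proof.
move=> Hf e e0.
have k1 : 0 < modc k + 1 by rewrite ltr_wpDl ?modc_ge0.
have [d d0 Hd] := Hf _ (divr_gt0 e0 k1); exists d => // w /Hd.
rewrite -mulrBr modcM ltr_pdivlMr//; apply: le_lt_trans.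
by rewrite mulrC ler_wpM2l ?modc_ge0// lerDl.
Qed.

Lemma ccont_affine f (a k z : R[i]) : ccont f (a + k * z) ->
  ccont (fun w => f (a + k * w)) z.
Proof.
move=> Hf e e0; have [d d0 Hd] := Hf _ e0.
have k1 : 0 < modc k + 1 by rewrite ltr_wpDl ?modc_ge0.
exists (d / (modc k + 1)); first by rewrite divr_gt0.
move=> w; rewrite ltr_pdivlMr// => wd; apply: Hd.
rewrite opprD addrACA subrr add0r -mulrBr modcM; apply: le_lt_trans wd.
by rewrite mulrC ler_wpM2l ?modc_ge0// lerDl.
Qed.

Lemma cderiv_affine f (a k l z : R[i]) : cderiv f l (a + k * z) ->
  cderiv (fun w => f (a + k * w)) (l * k) z.
Proof.
move=> Hf e e0.
have k1 : 0 < modc k + 1 by rewrite ltr_wpDl ?modc_ge0.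
have [d d0 Hd] := Hf _ (divr_gt0 e0 k1).
exists (d / (modc k + 1)); first by rewrite divr_gt0.
move=> w; rewrite ltr_pdivlMr// => wd.
have E : a + k * w - (a + k * z) = k * (w - z) by ring.
have := Hd (a + k * w); rewrite E mulrA modcM => A.
have /A {}A : modc k * modc (w - z) < d.
  by apply: le_lt_trans wd; rewrite mulrC ler_wpM2l ?modc_ge0// lerDl.
apply: (le_trans A).
rewrite mulrA ler_wpM2r ?modc_ge0// mulrAC ler_pdivrMr// ler_wpM2l ?ltW//.
by rewrite ltrDl.
Qed.

(** The derivative is chosen pointwise; by uniqueness it agrees near each point with the derivative
    of a local power series and inherits its continuity. *)
Lemma analytic_C1 (f : R[i] -> R[i]) : analytic_on_disc f ->
  exists f', forall z, modc z < 1 -> cderiv f (f' z) z /\ ccont f' z.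
Proof.
move=> fD.
have loc a : modc a < 1 -> exists (f' : R[i] -> R[i]) (s : R), 0 < s /\
    forall z, modc (z - a) < s -> cderiv f (f' z) z /\ ccont f' z.
  move=> /fD/analytic_atP[c [d [d0 /(power_series_C1 d0)]]].
  move=> [f' [s [B [s0 B0 H]]]]; exists f', s; split => // z zs.
  have B1 : 0 < B + 1 by rewrite ltr_wpDl.
  pose r := s - modc (z - a); have r0 : 0 < r by rewrite subr_gt0.
  have near w : modc (w - z) < r -> modc (w - a) < s.
    move=> wr; have -> : w - a = (w - z) + (z - a) by ring.
    by rewrite (le_lt_trans (modcD _ _))// -ltrBrDr.
  split=> e e0; exists (Num.min r (e / (B + 1))); rewrite ?lt_min ?r0 ?divr_gt0//;
    move=> w; rewrite lt_min ltr_pdivlMr// => /andP[/near ws we];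
    have [h1 h2] := H z w zs ws; have m0 := modc_ge0 (w - z).
    by apply: (le_trans h1); rewrite expr2 mulrA ler_wpM2r//; nra.
  by apply: (le_lt_trans h2); nra.
have ex z : exists l, modc z < 1 -> cderiv f l z.
  have [/loc[f' [s [s0 H]]]|?] := pselect (modc z < 1); last by exists 0.
  by exists (f' z) => _; apply: (H z _).1; rewrite subrr modc0.
have [f' Hf'] := choice ex; exists f' => z z1; split; first exact: Hf'.
have [g [s [s0 H]]] := loc _ z1.
have zs : modc (z - z) < s by rewrite subrr modc0.
have [_ gc] := H _ zs.
have same w : modc w < 1 -> modc (w - z) < s -> f' w = g w.
  by move=> w1 ws; apply: cderiv_uniq (Hf' _ w1) (H _ ws).1.
move=> e /gc[d d0 Hd].
exists (Num.min d (Num.min s (1 - modc z))); first by rewrite !lt_min d0 s0 subr_gt0.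
move=> w; rewrite !lt_min => /andP[wd /andP[ws w1]].
rewrite (same z) ?subrr ?modc0// (same w) ?Hd//.
have -> : w = (w - z) + z by rewrite subrK.
by rewrite (le_lt_trans (modcD _ _))// -ltrBrDr.
Qed.

(** A 1-Lipschitz F covers the real part, the imaginary part, their rotations and the modulus at
    once. *)
Lemma line_continuous (F : R[i] -> R) f (z v : R[i]) (t : R) :
  (forall x y, `|F x - F y| <= modc (x - y)) ->
  ccont f (z + t%:C%C * v) ->
  {for t, continuous (fun t : R => F (f (z + t%:C%C * v)))}.
Proof.
move=> HF fc; apply/cvgrPdist_lt => e /fc[d d0 Hd].
have v1 : 0 < modc v + 1 by rewrite ltr_wpDl ?modc_ge0.
apply/nbhs_ballP; exists (d / (modc v + 1)) => /=; first by rewrite divr_gt0.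
move=> x; rewrite /ball/= ltr_pdivlMr// => xd.
apply: le_lt_trans (HF _ _) _; rewrite modcB; apply: Hd.
rewrite opprD addrACA subrr add0r -mulrBl -rmorphB modcM modc_real distrC.
by apply: le_lt_trans xd; rewrite ler_wpM2l// lerDl.
Qed.

Lemma ReZ_lip (k x y : R[i]) : modc k = 1 ->
  `|complex.Re (k * x) - complex.Re (k * y)| <= modc (x - y).
Proof.
move=> k1; rewrite -cReN -cReD -mulrBr (le_trans (Re_le_modc _))//.
by rewrite modcM k1 mul1r.
Qed.

Lemma modc_lip (x y : R[i]) : `|modc x - modc y| <= modc (x - y).
Proof.
by rewrite ler_norml modcB_ge andbT lerNl opprB modcB modcB_ge.
Qed.

(** The unimodular k selects a component: k = 1 gives the real part, k = -i the imaginary part. *)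
Lemma line_is_derive f (k l z v : R[i]) (t : R) : modc k = 1 ->
  cderiv f l (z + t%:C%C * v) ->
  is_derive t 1 (fun t : R => complex.Re (k * f (z + t%:C%C * v)))
    (complex.Re (k * (l * v))).
Proof.
move=> k1 fd.
have v1 : 0 < modc v + 1 by rewrite ltr_wpDl ?modc_ge0.
suff H : h^-1 *: (complex.Re (k * f (z + (h *: 1 + t)%:C%C * v)) -
     complex.Re (k * f (z + t%:C%C * v))) @[h --> (0:R)^'] --> complex.Re (k * (l * v)).
  apply: DeriveDef; last by apply/cvg_lim.
  by apply/cvg_ex; exists (complex.Re (k * (l * v))).
apply/cvgrPdist_le => e e0.
have [d d0 Hd] := fd _ (divr_gt0 e0 v1).
rewrite near_withinE; apply/nbhs_ballP; exists (d / (modc v + 1)) => /=; first by rewrite divr_gt0.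
move=> h; rewrite /ball/= sub0r normrN ltr_pdivlMr// => hd h0.
have hn0 : 0 < `|h| by rewrite normr_gt0.
have E : z + (h *: 1 + t)%:C%C * v - (z + t%:C%C * v) = h%:C%C * v.
  by rewrite rmorphD/= /GRing.scale/= mulr1; ring.
have hv : modc (h%:C%C * v) < d.
  rewrite modcM modc_real; apply: le_lt_trans hd.
  by rewrite ler_wpM2l// lerDl.
have := Hd (z + (h *: 1 + t)%:C%C * v); rewrite E => /(_ hv) {}Hd.
rewrite -(ler_pM2l hn0).
apply: (@le_trans _ _ (e / (modc v + 1) * modc (h%:C%C * v))); last first.
  rewrite modcM modc_real mulrCA ler_wpM2l// mulrAC ler_pdivrMr//.
  by rewrite ler_wpM2l ?(ltW e0)// lerDl.
apply: le_trans Hd; rewrite -normrM.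
set A := f _; set B := f _.
rewrite (_ : h * _ = - complex.Re (k * (A - B - l * (h%:C%C * v)))).
  by rewrite normrN (le_trans (Re_le_modc _))// modcM k1 mul1r.
rewrite mulrBr /GRing.scale/= mulVKf//.
have -> : complex.Re (k * (A - B - l * (h%:C%C * v))) =
    complex.Re (k * A) - complex.Re (k * B) - complex.Re (h%:C%C * (k * (l * v))).
  by rewrite -!cReN -!cReD; congr complex.Re; ring.
have -> : complex.Re (h%:C%C * (k * (l * v))) = h * complex.Re (k * (l * v)).
  by case: (k * (l * v)) => x y /=; rewrite mul0r subr0.
by ring.
Qed.

End ComplexDerivative.

(** * Cauchy estimates on squares *)

Section CauchySquare.
Context {R : realType}.
Implicit Types (f g : R[i] -> R[i]).
Local Notation leb := (@lebesgue_measure R).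
Local Notation "''j'" := ('i%C : R[i]).

Definition quarter_sum g (a w : R[i]) : R[i] :=
  g (a + w) + g (a + 'j * w) + g (a - w) + g (a - 'j * w).

Lemma quarter_sumM g a w : quarter_sum g a ('j * w) = quarter_sum g a w.
Proof.
rewrite /quarter_sum mulrA (_ : 'j * 'j = -1); last by rewrite -expr2 sqr_i.
by rewrite !mulN1r opprK; ring.
Qed.

Lemma modci : modc 'j = 1.
Proof. by rewrite modcE/= expr0n/= add0r expr1n sqrtr1. Qed.

Lemma ccont_quarter_sum g a (w : R[i]) :
  ccont g (a + w) -> ccont g (a + 'j * w) -> ccont g (a - w) ->
  ccont g (a - 'j * w) -> ccont (quarter_sum g a) w.
Proof.
move=> h0 h1 h2 h3.
have -> : quarter_sum g a = fun w =>
    g (a + 1 * w) + g (a + 'j * w) + g (a + (- 1) * w) + g (a + (- 'j) * w).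
  by apply/funext => v; rewrite /quarter_sum mul1r mulN1r mulNr.
apply: ccontD; first apply: ccontD; first apply: ccontD.
- by apply: ccont_affine; rewrite mul1r.
- exact: ccont_affine.
- by apply: ccont_affine; rewrite mulN1r.
- by apply: ccont_affine; rewrite mulNr.
Qed.

Definition quarter_deriv g (a w : R[i]) : R[i] :=
  g (a + w) + 'j * g (a + 'j * w) + -1 * g (a - w) + (- 'j) * g (a - 'j * w).

Lemma ccont_quarter_deriv g a (w : R[i]) :
  ccont g (a + w) -> ccont g (a + 'j * w) -> ccont g (a - w) ->
  ccont g (a - 'j * w) -> ccont (quarter_deriv g a) w.
Proof.
move=> h0 h1 h2 h3.
have -> : quarter_deriv g a = fun w =>
    g (a + 1 * w) + 'j * g (a + 'j * w) + -1 * g (a + (- 1) * w) +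
    (- 'j) * g (a + (- 'j) * w).
  by apply/funext => v; rewrite /quarter_deriv mul1r !mulN1r !mulNr.
apply: ccontD; first apply: ccontD; first apply: ccontD.
- by apply: ccont_affine; rewrite mul1r.
- by apply: ccontZ; exact: ccont_affine.
- by apply: ccontZ; apply: ccont_affine; rewrite mulN1r.
- by apply: ccontZ; apply: ccont_affine; rewrite mulNr.
Qed.

Lemma cderiv_quarter_sum g g' a (w : R[i]) :
  cderiv g (g' (a + w)) (a + w) -> cderiv g (g' (a + 'j * w)) (a + 'j * w) ->
  cderiv g (g' (a - w)) (a - w) -> cderiv g (g' (a - 'j * w)) (a - 'j * w) ->
  cderiv (quarter_sum g a) (quarter_deriv g' a w) w.
Proof.
move=> h0 h1 h2 h3.
have -> : quarter_sum g a = fun w =>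
    g (a + 1 * w) + g (a + 'j * w) + g (a + (- 1) * w) + g (a + (- 'j) * w).
  by apply/funext => v; rewrite /quarter_sum mul1r mulN1r mulNr.
have -> : quarter_deriv g' a w = g' (a + w) * 1 + g' (a + 'j * w) * 'j +
    g' (a - w) * -1 + g' (a - 'j * w) * - 'j.
  by rewrite /quarter_deriv; ring.
apply: cderivD; first apply: cderivD; first apply: cderivD.
- by apply: cderiv_affine; rewrite mul1r.
- exact: cderiv_affine.
- by apply: cderiv_affine; rewrite mulN1r.
- by apply: cderiv_affine; rewrite mulNr.
Qed.

Variables (Phi Phi' : R[i] -> R[i]) (S : R) (k : R[i]).
Hypothesis S0 : 0 < S.
Hypothesis k1 : modc k = 1.
Hypothesis PhiM : forall w, Phi ('j * w) = Phi w.
Hypothesis dPhi : forall w, 0 < modc w < S -> cderiv Phi (Phi' w) w.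
Hypothesis cPhi' : forall w, 0 < modc w < S -> ccont Phi' w.
Hypothesis cPhi : ccont Phi 0.

(* [pt s t] runs over the right side of the square of half-width [s] centered
   at 0 when [t] runs over [-1, 1]. *)
Let pt (s t : R) : R[i] := (s +i* (s * t))%C.

Let ptE s t : pt s t = 0 + s%:C%C * (1 +i* t)%C.
Proof. by rewrite add0r; apply: complexP => /=; ring. Qed.
Let ptE' s t : pt s t = s%:C%C + t%:C%C * (s%:C%C * 'j).
Proof. by apply: complexP => /=; ring. Qed.

Let pt_bound s t : 0 < s -> -1 <= t <= 1 -> s <= modc (pt s t) <= s * 2.
Proof.
move=> s0 /andP[t1 t2]; apply/andP; split.
  by have := Re_le_modc (pt s t); rewrite /= gtr0_norm.
apply: (le_trans (modc_le_ReIm _)) => /=.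
rewrite normrM gtr0_norm// -[X in X + _]mulr1 -mulrDr ler_wpM2l ?(ltW s0)//.
by have : `|t| <= 1 by [rewrite ler_norml t1]; lra.
Qed.

Let pt_in s t : 0 < s -> s * 2 < S -> -1 <= t <= 1 -> 0 < modc (pt s t) < S.
Proof.
move=> s0 sS /(pt_bound s0)/andP[h1 h2].
by rewrite (lt_le_trans s0 h1) (le_lt_trans h2 sS).
Qed.

(* H s t is Re (k Phi (s z) / z) with z = 1 + i t.  Its s-derivative K is s^-1
   times the t-derivative of Im (k Phi (s z)), whose values at t = -1 and t = 1
   agree by PhiM; hence the mean F of H does not depend on s. *)
Let A (s t : R) := complex.Re (k * Phi (pt s t)).
Let B (s t : R) := complex.Re ((- 'j * k) * Phi (pt s t)).
Let H (s t : R) := (A s t + t * B s t) / (1 + t ^+ 2).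
Let K (s t : R) := complex.Re (k * Phi' (pt s t)).

Let jk1 : modc (- 'j * k) = 1.
Proof. by rewrite modcM modcN modci k1 mulr1. Qed.

Let t21 (t : R) : 0 < 1 + t ^+ 2.
Proof. by rewrite ltr_wpDr// sqr_ge0. Qed.

Let cont_t (f : R[i] -> R[i]) (F : R[i] -> R) s t :
  (forall x y, `|F x - F y| <= modc (x - y)) ->
  ccont f (pt s t) ->
  {for t, continuous (fun t => F (f (pt s t)))}.
Proof.
move=> HF fc; rewrite (_ : (fun t => _) =
  (fun t => F (f (s%:C%C + t%:C%C * (s%:C%C * 'j))))); last first.
  by apply/funext => x; rewrite ptE'.
by apply: (@line_continuous _ F f) => //; rewrite -ptE'.
Qed.

Let cPhi_pt s t : 0 < s -> s * 2 < S -> -1 <= t <= 1 -> ccont Phi (pt s t).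
Proof.
by move=> s0 sS t1; apply: cderiv_ccont (dPhi _); exact: pt_in.
Qed.

Let cH s : 0 < s -> s * 2 < S -> {within `[(-1), 1], continuous (H s)}.
Proof.
move=> s0 sS; apply: continuous_in_subspaceT => t; rewrite inE/= in_itv/= => t1.
apply: cvgM; last first.
  apply: cvgV; first by rewrite gt_eqF.
  by apply: cvgD; [exact: cvg_cst|apply: cvgM; exact: cvg_id].
apply: cvgD.
  apply: (@cont_t Phi (fun x => complex.Re (k * x))); last exact: cPhi_pt.
  by move=> x y; exact: ReZ_lip.
apply: cvgM; first exact: cvg_id.
apply: (@cont_t Phi (fun x => complex.Re (- 'j * k * x))); last exact: cPhi_pt.
by move=> x y; exact: ReZ_lip.
Qed.

Let cK s : 0 < s -> s * 2 < S -> {within `[(-1), 1], continuous (K s)}.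
Proof.
move=> s0 sS; apply: continuous_in_subspaceT => t; rewrite inE/= in_itv/= => t1.
apply: (@cont_t Phi' (fun x => complex.Re (k * x))); first by move=> x y; exact: ReZ_lip.
by apply: cPhi'; exact: pt_in.
Qed.

Let dH (s t : R) : 0 < s -> s * 2 < S -> -1 <= t <= 1 ->
  is_derive s 1 (fun s => H s t) (K s t).
Proof.
move=> s0 sS t1.
have Dk (c : R[i]) : modc c = 1 -> is_derive s 1 (fun s => complex.Re (c * Phi (pt s t)))
    (complex.Re (c * (Phi' (pt s t) * (1 +i* t)%C))).
  move=> c1; rewrite (_ : (fun s => _) =
    (fun s : R => complex.Re (c * Phi (0 + s%:C%C * (1 +i* t)%C)))).
    by apply: line_is_derive => //; rewrite -ptE; apply: dPhi; exact: pt_in.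
  by apply/funext => x; rewrite ptE.
have hA := Dk _ k1; have hB := Dk _ jk1.
rewrite (_ : (fun s => _) = (fun s => (1 + t ^+ 2)^-1 *: (A s t + t *: B s t))); last first.
  by apply/funext => x; rewrite /H mulrC.
apply: is_derive_eq; rewrite /K.
case: (k) => k2 k3; case: (Phi' _) => p2 p3 /=; rewrite /GRing.scale/=.
by field; rewrite gt_eqF.
Qed.

Let integrable_cont (u : R -> R) : {within `[(-1), 1], continuous u} ->
  leb.-integrable `[(-1), 1] (EFin \o u).
Proof.
by move=> cu; apply: continuous_compact_integrable => //; exact: segment_compact.
Qed.

Let int_K s : 0 < s -> s * 2 < S -> (\int[leb]_(t in `[(-1), 1]) (K s t))%R = 0.
Proof.
move=> s0 sS.
pose G (t : R) : R := s^-1 *: complex.Re ((- 'j * k) * Phi (pt s t)).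
have DG (t : R) : -1 <= t <= 1 -> is_derive t 1 G (K s t).
  move=> t1.
  have h : is_derive t 1 (fun t => complex.Re ((- 'j * k) * Phi (pt s t)))
     (complex.Re ((- 'j * k) * (Phi' (pt s t) * (s%:C%C * 'j)))).
    rewrite (_ : (fun t => _) = (fun t : R => complex.Re ((- 'j * k) *
      Phi (s%:C%C + t%:C%C * (s%:C%C * 'j))))); last first.
      by apply/funext => x; rewrite ptE'.
    by apply: line_is_derive => //; rewrite -ptE'; apply: dPhi; exact: pt_in.
  apply: is_derive_eq; rewrite /K /GRing.scale/=.
  case: (k) => k2 k3; case: (Phi' _) => p2 p3 /=.
  by field; rewrite gt_eqF.
rewrite /Rintegral (@continuous_FTC2 _ _ G)//.
- rewrite /= /G /GRing.scale/= -mulrBr.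
  have -> : pt s 1 = 'j * pt s (-1) by apply: complexP => /=; ring.
  by rewrite PhiM subrr mulr0.
- exact: cK.
- split.
  + move=> t; rewrite in_itv/= => /andP[t1 t2].
    have tt : -1 <= t <= 1 by rewrite !ltW.
    by case: (DG _ tt).
  + apply: cvg_at_right_filter; apply: differentiable_continuous.
    by apply/derivable1_diffP; case: (DG (-1)) => //; lra.
  + apply: cvg_at_left_filter; apply: differentiable_continuous.
    by apply/derivable1_diffP; case: (DG 1) => //; lra.
- move=> t; rewrite in_itv/= => /andP[t1 t2].
  have tt : -1 <= t <= 1 by rewrite !ltW.
  by rewrite derive1E; case: (DG _ tt).
Qed.

(** Joint continuity on a compact rectangle provides the constant that dominates the derivative
    under the integral sign. *)
Let K_bounded (u v : R) : 0 < u -> u <= v -> v * 2 < S ->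
  exists2 M : R, 0 <= M & forall s t, u <= s <= v -> -1 <= t <= 1 -> `|K s t| <= M.
Proof.
move=> u0 uv vS.
pose D : set (R * R) := `[u, v] `*` `[(-1), 1].
have cD : compact D by apply: compact_setX; exact: segment_compact.
have Kc : {within D, continuous (fun x : R * R => K x.1 x.2)}.
  apply: continuous_in_subspaceT => -[s t]; rewrite inE => -[/= + t1].
  rewrite in_itv/= => /andP[us sv]; rewrite in_itv/= in t1.
  have s0 := lt_le_trans u0 us.
  have sS : s * 2 < S by apply: le_lt_trans vS; rewrite ler_pM2r.
  apply/cvgrPdist_lt => e e0.
  have [d d0 Hd] := cPhi' (pt_in s0 sS t1) e0.
  have d2 : 0 < d / 2 by rewrite divr_gt0.
  have c1 : (fun x : R * R => x.1) x @[x --> (s, t)] --> s by exact: cvg_fst.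
  have c2 : (fun x : R * R => x.1 * x.2) x @[x --> (s, t)] --> s * t.
    by apply: cvgM; [exact: cvg_fst|exact: cvg_snd].
  move/cvgrPdist_lt : c1 => /(_ _ d2); move/cvgrPdist_lt : c2 => /(_ _ d2).
  apply: filterS2 => -[s' t']/= h2 h1; rewrite /K.
  apply: le_lt_trans (ReZ_lip _ _ k1) _; rewrite modcB; apply: Hd.
  rewrite modcB; apply: le_lt_trans (modc_le_ReIm _) _.
  by rewrite /= [ltRHS]splitr ltrD.
have := continuous_compact Kc cD => /compact_bounded[M [_ HM]].
exists (`|M| + 1); first by rewrite addr_ge0.
move=> s t us t1; apply: (HM (`|M| + 1)); first by rewrite (le_lt_trans (ler_norm M))// ltrDl.
by exists (s, t) => //; split => /=; rewrite in_itv.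
Qed.

Let F (s : R) : R := (\int[leb]_(t in `[(-1), 1]) (H s t))%R.

Let dF (s : R) : 0 < s -> s * 2 < S -> is_derive s 1 F 0.
Proof.
move=> s0 sS.
(* The window ]u, v[ around s keeps every point of the sides at positive distance from 0 and, as 2 v
   < S, inside the disc. *)
pose u := s / 2; pose v := (s + S / 2) / 2.
have [u0 us sv vS] : [/\ 0 < u, u < s, s < v & v * 2 < S].
  by rewrite /u /v; split; lra.
have [M M0 HM] := K_bounded u0 (ltW (lt_trans us sv)) vS.
have inI (x : R) : `]u, v[%classic x -> 0 < x /\ x * 2 < S.
  by rewrite /= in_itv/= => /andP[ux xv]; split; lra.
have mI : measurable (`[(-1), 1]%classic : set R) by exact: measurable_itv.
have E (x t : R) : `]u, v[%classic x -> `[(-1), 1]%classic t -> partial1of2 H x t = K x t.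
  move=> /inI[x0 xS] t1; rewrite partial1of2E.
  by rewrite /= in_itv/= in t1; case: (dH x0 xS t1).
have Is : `]u, v[%classic s by rewrite /= in_itv/= us.
have intf (x : R) : `]u, v[%classic x -> leb.-integrable `[(-1), 1] (EFin \o H x).
  by move=> /inI[x0 xS]; apply: integrable_cont; exact: cH.
have derf (x t : R) : `]u, v[%classic x -> `[(-1), 1]%classic t -> derivable (H ^~ t) x 1.
  move=> /inI[x0 xS]; rewrite /= in_itv/= => t1.
  by case: (dH x0 xS t1).
have iG : leb.-integrable `[(-1), 1] (EFin \o (fun=> M)).
  by apply: integrable_cont; apply: continuous_subspaceT => ?; exact: cvg_cst.
have Gub (x t : R) : `]u, v[%classic x -> `[(-1), 1]%classic t -> `|partial1of2 H x t| <= M.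
  move=> xI t1; rewrite E//; apply: HM.
    by move: xI; rewrite /= in_itv/= => /andP[? ?]; rewrite !ltW.
  by move: t1; rewrite /= in_itv.
have D1 := @derivable_under_integral _ _ _ leb H _ mI s u v Is intf derf
  (fun=> M) (fun=> M0) iG Gub.
have D2 := @differentiation_under_integral _ _ _ leb H _ mI s u v Is intf derf
  (fun=> M) (fun=> M0) iG Gub.
apply: DeriveDef; first exact: D1.
rewrite -derive1E D2 -[RHS](int_K s0 sS).
by apply: eq_Rintegral => t; rewrite inE => t1; rewrite E.
Qed.

Let F_cst s s' : 0 < s -> s < s' -> s' * 2 < S -> F s' = F s.
Proof.
move=> s0 ss' sS.
have inI (x : R) : s <= x <= s' -> 0 < x /\ x * 2 < S by move=> /andP[? ?]; split; lra.
have [||c _] := @MVT _ F (fun=> 0) s s' ss'.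
- move=> x; rewrite in_itv/= => /andP[h1 h2].
  by have [] := inI x; [lra|move=> *; exact: dF].
- apply: continuous_in_subspaceT => x; rewrite inE/= in_itv/= => /inI[x0 xS].
  apply: differentiable_continuous; apply/derivable1_diffP.
  by case: (dF x0 xS).
- by rewrite mul0r => /eqP; rewrite subr_eq0 => /eqP.
Qed.

(** The mean F does not depend on s. At s it is at most the integral of |Phi|, since |1 - i t| <= 1
    + t^2; for small s it approaches |Phi 0| times the integral of 1 / (1 + t^2) over [-1, 1]. The
    lower bound 1/2 for that integrand is enough, the interval having length 2. *)
Lemma mean_value_square s : 0 < s -> s * 2 < S -> k * Phi 0 = (modc (Phi 0))%:C%C ->
  leb.-integrable `[(-1), 1] (fun t => (modc (Phi (pt s t)))%:E) /\
  modc (Phi 0) <= (\int[leb]_(t in `[(-1), 1]) (modc (Phi (pt s t))))%R.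
Proof.
move=> s0 sS kPhi0.
have intm : leb.-integrable `[(-1), 1] (EFin \o (fun t => modc (Phi (pt s t)))).
  apply: integrable_cont; apply: continuous_in_subspaceT => t.
  by rewrite inE/= in_itv/= => t1; apply: (@cont_t Phi (@modc R)); [exact: modc_lip|exact: cPhi_pt].
split => //.
have mI : measurable (`[(-1), 1]%classic : set R) by exact: measurable_itv.
have len : fine (leb (`[(-1), 1]%classic : set R)) = 2.
  rewrite lebesgue_measure_itv/= lte_fin ifT//=; last by lra.
apply: (@le_trans _ _ (F s)); last first.
  apply: le_Rintegral => //.
  - exact/integrable_cont/cH.
  - move=> t; rewrite /= in_itv/= => t1; rewrite /H ler_pdivrMr//.
    have -> : A s t + t * B s t = complex.Re (k * (Phi (pt s t) * (1 -i* t)%C)).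
      rewrite /A /B; case: (k) => k2 k3; case: (Phi _) => p2 p3 /=.
      by ring.
    apply: (le_trans (ler_norm _)); apply: (le_trans (Re_le_modc _)).
    rewrite modcM k1 mul1r modcM ler_wpM2l ?modc_ge0// modcE/= expr1n sqrrN.
    rewrite -[leRHS](ger0_norm (ltW (t21 t))) -sqrtr_sqr ler_wsqrtr// ler_eXnr// lerDl.
    exact: sqr_ge0.
apply/ler_addgt0Pr => e e0.
have e4 : 0 < e / 4 by rewrite divr_gt0.
have [d d0 Hd] := cPhi e4.
(* The small side stays within 2 s' < d of 0, where Phi differs from Phi 0 by less than e/4. *)
pose s' := Num.min (d / 4) (s / 2).
have s'0 : 0 < s' by rewrite lt_min !divr_gt0.
have s's : s' < s by rewrite gt_min; apply/orP; right; lra.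
have s'd : s' * 2 < d.
  by have : s' <= d / 4 by [rewrite ge_min lexx]; lra.
rewrite (F_cst s'0 s's sS) -lerBlDr.
have -> : modc (Phi 0) - e =
    (\int[leb]_(t in `[(-1), 1]) (modc (Phi 0) / 2 - 2 * (e / 4)))%R.
  by rewrite Rintegral_cst// len; field.
have s'S : s' * 2 < S by apply: lt_trans sS; rewrite ltr_pM2r.
apply: le_Rintegral => //.
- by apply: integrable_cont; apply: continuous_subspaceT => ?; exact: cvg_cst.
- exact/integrable_cont/cH.
- move=> t; rewrite /= in_itv/= => t1; rewrite /H ler_pdivlMr//.
  have near : modc (pt s' t - 0) < d.
    by rewrite subr0; have /andP[_ h] := pt_bound s'0 t1; apply: le_lt_trans h _.
  have hA : `|A s' t - modc (Phi 0)| <= e / 4.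
    have -> : modc (Phi 0) = complex.Re (k * Phi 0) by rewrite kPhi0.
    exact: le_trans (ReZ_lip _ _ k1) (ltW (Hd _ near)).
  have hB : `|B s' t| <= e / 4.
    rewrite -[B s' t]subr0 (_ : 0 = complex.Re (- 'j * k * Phi 0)).
      exact: le_trans (ReZ_lip _ _ jk1) (ltW (Hd _ near)).
    by rewrite -mulrA kPhi0/=; ring.
  move: hA hB; rewrite !ler_norml => /andP[hA _] /andP[hB1 hB2].
  have m0 := modc_ge0 (Phi 0); have /andP[t2 t3] := t1.
  have tb : - (e / 4) <= t * B s' t by nra.
  have tt : t ^+ 2 <= 1 by nra.
  apply: (@le_trans _ _ (modc (Phi 0) - 2 * (e / 4))); last by lra.
  have := sqr_ge0 t; nra.
Qed.

End CauchySquare.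

Section CauchyEstimates.
Context {R : realType}.
Implicit Types (f g : R[i] -> R[i]).
Local Notation leb := (@lebesgue_measure R).
Local Notation "''j'" := ('i%C : R[i]).

(** A unimodular k turns the central value 4 g(a) into its modulus. Differentiability is asked off
    the centre only, with continuity at a: this is the situation of a difference quotient completed
    by the derivative. *)
Lemma quarter_sum_mean g g' (a : R[i]) (S s : R) : 0 < S ->
  (forall z, 0 < modc (z - a) < S -> cderiv g (g' z) z /\ ccont g' z) ->
  ccont g a -> 0 < s -> s * 2 < S ->
  leb.-integrable `[(-1), 1] (fun t => (modc (quarter_sum g a (s +i* (s * t))%C))%:E) /\
  4 * modc (g a) <=
  (\int[leb]_(t in `[(-1), 1]) modc (quarter_sum g a (s +i* (s * t))%C))%R.
Proof.
move=> S0 gD ga s0 sS.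
have E0 : quarter_sum g a 0 = 4 * g a.
  by rewrite /quarter_sum mulr0 subr0 addr0; ring.
have m4 : modc (4 * g a) = 4 * modc (g a).
  rewrite modcM; congr (_ * _).
  by rewrite -[4]/(4%:R) -(rmorph_nat (real_complex R)) modc_real ger0_norm.
have [k k1 kE] : exists2 k, modc k = 1 &
    k * quarter_sum g a 0 = (modc (quarter_sum g a 0))%:C%C.
  have [->|n0] := eqVneq (quarter_sum g a 0) 0.
    by exists 1; rewrite ?modc1// modc0 mulr0.
  exists ((modc (quarter_sum g a 0))%:C%C / quarter_sum g a 0); last by rewrite mulfVK.
  by rewrite modcM modcV modc_real ger0_norm ?modc_ge0// divff// modc_eq0.
have sides (w : R[i]) : 0 < modc w < S -> [/\ 0 < modc (a + w - a) < S,
    0 < modc (a + 'j * w - a) < S, 0 < modc (a - w - a) < S &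
    0 < modc (a - 'j * w - a) < S].
  move=> h; have E (x : R[i]) : a + x - a = x by rewrite addrC addKr.
  by split; rewrite E ?modcN ?modcM ?modci ?mul1r.
rewrite -m4 -E0; apply: (@mean_value_square R (quarter_sum g a) (quarter_deriv g' a) S k) => //.
- exact: quarter_sumM.
- move=> w /sides[/gD[? _] /gD[? _] /gD[? _] /gD[? _]].
  exact: cderiv_quarter_sum.
- move=> w /sides[/gD[_ ?] /gD[_ ?] /gD[_ ?] /gD[_ ?]].
  exact: ccont_quarter_deriv.
- by apply: ccont_quarter_sum; rewrite ?mulr0 ?subr0 ?addr0.
Qed.

Lemma cderiv_near f g (l z : R[i]) (r : R) : 0 < r ->
  (forall w, modc (w - z) < r -> f w = g w) -> cderiv g l z -> cderiv f l z.
Proof.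
move=> r0 E H e /H[d d0 Hd]; exists (Num.min d r); first by rewrite lt_min d0.
move=> w; rewrite lt_min => /andP[wd wr]; rewrite (E w)// (E z) ?Hd//.
by rewrite subrr modc0.
Qed.

Lemma quot_near (b z w : R[i]) (r : R) : r = modc (z - b) / 2 ->
  modc (w - z) < r -> r <= modc (w - b).
Proof.
move=> rE wz; have := modcD (z - w) (w - b); rewrite subrKA.
by rewrite (modcB z w); lra.
Qed.

Lemma ccont_quot f (b z : R[i]) : z != b -> ccont f z ->
  ccont (fun w => f w / (w - b)) z.
Proof.
move=> zb fc e e0; pose r := modc (z - b) / 2.
have zb0 : z - b != 0 by rewrite subr_eq0.
have r0 : 0 < r by rewrite divr_gt0// modc_gt0.
have e1 : 0 < e * r / 2 by rewrite divr_gt0// mulr_gt0.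
have [d d0 Hd] := fc _ e1.
have f1 : 0 < modc (f z) + 1 by rewrite ltr_wpDl ?modc_ge0.
exists (Num.min d (Num.min r (e * r ^+ 2 / (modc (f z) + 1)))).
  by rewrite !lt_min d0 r0 divr_gt0// mulr_gt0// exprn_gt0.
move=> w; rewrite !lt_min => /andP[/Hd wd /andP[wr]].
rewrite ltr_pdivlMr// => we.
have rwb := quot_near erefl wr.
have wb0 : w - b != 0 by rewrite -modc_eq0 gt_eqF// (lt_le_trans r0).
have -> : f w / (w - b) - f z / (z - b) =
  ((f w - f z) - f z * (w - z) / (z - b)) / (w - b).
  by field; rewrite wb0 zb0.
rewrite modcM modcV ltr_pdivrMr ?(lt_le_trans r0)//.
apply: (@lt_le_trans _ _ (e * r)); last by rewrite ler_wpM2l// ltW.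
have zbr : modc (z - b) = r * 2 by rewrite /r; field.
rewrite (le_lt_trans (modcD _ _))// modcN !modcM modcV zbr.
apply: (@lt_le_trans _ _ (e * r / 2 + e * r / 2)); last by lra.
apply: ltr_leD => //.
rewrite ler_pdivrMr ?mulr_gt0//.
have := modc_ge0 (w - z); have := modc_ge0 (f z).
have -> : e * r / 2 * (r * 2) = e * r ^+ 2 by field.
  by nra.
by rewrite modc_gt0.
Qed.

Lemma cderiv_quot g (l b c z : R[i]) : z != b -> cderiv g l z ->
  cderiv (fun w => (g w - c) / (w - b)) ((l - (g z - c) / (z - b)) / (z - b)) z.
Proof.
move=> zb fc e e0; pose r := modc (z - b) / 2.
have zb0 : z - b != 0 by rewrite subr_eq0.
have r0 : 0 < r by rewrite divr_gt0// modc_gt0.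
have e1 : 0 < e * r / 2 by rewrite divr_gt0// mulr_gt0.
have [d d0 Hd] := fc _ e1.
set h := (g z - c) / (z - b).
have f1 : 0 < modc (l - h) + 1 by rewrite ltr_wpDl ?modc_ge0.
exists (Num.min d (Num.min r (e * r ^+ 2 / (modc (l - h) + 1)))).
  by rewrite !lt_min d0 r0 divr_gt0// mulr_gt0// exprn_gt0.
move=> w; rewrite !lt_min => /andP[/Hd wd /andP[wr]].
rewrite ltr_pdivlMr// => we.
have rwb := quot_near erefl wr.
have wb0 : w - b != 0 by rewrite -modc_eq0 gt_eqF// (lt_le_trans r0).
have -> : (g w - c) / (w - b) - h - (l - h) / (z - b) * (w - z) =
  ((g w - g z - l * (w - z)) - (l - h) * (w - z) / (z - b) * (w - z)) / (w - b).
  by rewrite /h; field; rewrite wb0 zb0.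
rewrite modcM modcV ler_pdivrMr ?(lt_le_trans r0)//.
apply: (@le_trans _ _ (e * r * modc (w - z))); last first.
  by rewrite mulrAC ler_wpM2l// mulr_ge0 ?modc_ge0// ltW.
have zbr : modc (z - b) = r * 2 by rewrite /r; field.
rewrite (le_trans (modcD _ _))// modcN !modcM modcV zbr.
have -> : e * r * modc (w - z) = e * r / 2 * modc (w - z) + e * r / 2 * modc (w - z).
  by field.
apply: lerD => //.
rewrite ler_wpM2r ?modc_ge0// ler_pdivrMr ?mulr_gt0//.
have := modc_ge0 (w - z); have := modc_ge0 (l - h).
have -> : e * r / 2 * (r * 2) = e * r ^+ 2 by field.
  by nra.
by rewrite modc_gt0.
Qed.

(** Apply the mean value inequality to the difference quotient of g at b, on the square of
    half-width s = S/4. There |w - b| >= s bounds the quotient by 2 M / s; four terms on a side of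
    parameter length 2 give 4 |g'(b)| <= 16 M / s. *)
Lemma cauchy_derivative_bound g g' (b : R[i]) (S M : R) : 0 < S ->
  (forall z, modc (z - b) < S -> cderiv g (g' z) z /\ ccont g' z) ->
  (forall z, modc (z - b) < S -> modc (g z) <= M) ->
  modc (g' b) <= 16 * M / S.
Proof.
move=> S0 gD gM.
have bS : modc (b - b) < S by rewrite subrr modc0.
have M0 : 0 <= M by rewrite (le_trans (modc_ge0 _) (gM b bS)).
(* At w = b the quotient is 0 / 0 = 0, and the second summand supplies the value g'(b). *)
pose h w := (g w - g b) / (w - b) + (if w == b then g' b else 0).
pose h' w := (g' w - h w) / (w - b).
have hE w : w != b -> h w = (g w - g b) / (w - b).
  by rewrite /h => /negPf ->; rewrite addr0.
have hb : h b = g' b by rewrite /h subrr mul0r add0r eqxx.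
have hD z : 0 < modc (z - b) < S -> cderiv h (h' z) z /\ ccont h' z.
  move=> /andP[z0 zS]; have [gz g'z] := gD z zS.
  have zb : z != b by rewrite -subr_eq0 -modc_gt0.
  have nb w : modc (w - z) < modc (z - b) -> w != b.
    by move=> wz; apply: contraTneq wz => ->; rewrite modcB ltxx.
  have dh : cderiv h (h' z) z.
    apply: (cderiv_near z0 (fun w wz => hE w (nb w wz))).
    by rewrite /h' hE//; exact: cderiv_quot.
  split => //; apply: ccont_quot => //.
  have -> : (fun w => g' w - h w) = (fun w => g' w + -1 * h w).
    by apply/funext => w; rewrite mulN1r.
  by apply: ccontD => //; apply: ccontZ; exact: cderiv_ccont dh.
have hc : ccont h b.
  have [gb _] := gD b bS; move=> e e0.
  have e2 : 0 < e / 2 by rewrite divr_gt0.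
  have [d d0 Hd] := gb _ e2; exists d => // w /Hd.
  have [->|wb] := eqVneq w b; first by rewrite !subrr modc0.
  have wb0 : w - b != 0 by rewrite subr_eq0.
  rewrite hb hE// => H.
  have -> : (g w - g b) / (w - b) - g' b = (g w - g b - g' b * (w - b)) / (w - b).
    by field.
  rewrite modcM modcV ltr_pdivrMr ?modc_gt0//; apply: le_lt_trans H _.
  by rewrite ltr_pM2r ?modc_gt0// ltr_pdivrMr// ltr_pMr// ltr1n.
pose s := S / 4; have s0 : 0 < s by rewrite divr_gt0.
have s2 : s * 2 < S by rewrite /s; lra.
have := quarter_sum_mean S0 hD hc s0 s2; rewrite hb => -[intH H].
have hbnd (w : R[i]) : s <= modc w <= s * 2 -> modc (h (b + w)) <= 2 * M / s.
  move=> /andP[sw w2].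
  have wS : modc ((b + w) - b) < S by rewrite addrC addKr (le_lt_trans w2).
  rewrite hE; last by rewrite -subr_eq0 addrC addKr -modc_gt0 (lt_le_trans s0).
  rewrite [b + w - b]addrC addKr modcM modcV.
  rewrite ler_pdivrMr ?(lt_le_trans s0)//.
  apply: (@le_trans _ _ (2 * M)).
    rewrite (le_trans (modcD _ _))// modcN mulr_natl mulr2n lerD//; exact: gM.
  by rewrite mulrAC ler_pdivlMr// ler_wpM2l ?mulr_ge0.
suff H2 : (\int[leb]_(t in `[(-1), 1]) modc (quarter_sum h b (s +i* (s * t))%C))%R
    <= 2 * (8 * M / s).
  have := le_trans H H2; rewrite (_ : 16 * M / S = 4 * M / s).
    move=> K; have -> : modc (g' b) = (4 * modc (g' b)) / 4 by field.
    by rewrite ler_pdivrMr//; lra.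
  by rewrite /s; field; rewrite gt_eqF.
have mI : measurable (`[(-1), 1]%classic : set R) by exact: measurable_itv.
have len : fine (leb (`[(-1), 1]%classic : set R)) = 2.
  by rewrite lebesgue_measure_itv/= lte_fin ifT//=; lra.
have -> : 2 * (8 * M / s) = (\int[leb]_(t in `[(-1), 1]) (8 * M / s))%R.
  by rewrite Rintegral_cst// len mulrC.
have c0 : 0 <= 8 * M / s by rewrite divr_ge0 ?mulr_ge0// ltW.
have Hle (t : R) : -1 <= t <= 1 -> modc (quarter_sum h b (s +i* (s * t))%C) <= 8 * M / s.
  move=> /andP[t1 t2].
  have b1 : s <= modc (s +i* (s * t))%C <= s * 2.
    apply/andP; split.
      by have := Re_le_modc (s +i* (s * t))%C; rewrite /= gtr0_norm.
    apply: (le_trans (modc_le_ReIm _)) => /=.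
    rewrite (normrM s t) (gtr0_norm s0); have tt : `|t| <= 1 by rewrite ler_norml t1.
    by rewrite -[X in X + _]mulr1 -mulrDr ler_wpM2l ?(ltW s0)//; move: tt; lra.
  rewrite /quarter_sum.
  have -> : 8 * M / s = 2 * M / s + 2 * M / s + 2 * M / s + 2 * M / s by lra.
  apply: (le_trans (modcD _ _)); apply: lerD.
    apply: (le_trans (modcD _ _)); apply: lerD.
      apply: (le_trans (modcD _ _)); apply: lerD; apply: hbnd => //.
      by rewrite modcM modci mul1r.
    by apply: hbnd; rewrite modcN.
  by apply: hbnd; rewrite modcN modcM modci mul1r.
apply: le_Rintegral => //.
by apply: continuous_compact_integrable; [exact: segment_compact|
  apply: continuous_subspaceT => ?; exact: cvg_cst].
Qed.

(** The real mean value theorem is used for the real and the imaginary part separately, whence the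
    factor 2. *)
Lemma real_segment_lipschitz g g' (x y L : R) : x <= y ->
  (forall t : R, x <= t <= y -> cderiv g (g' t%:C%C) t%:C%C /\ modc (g' t%:C%C) <= L) ->
  modc (g y%:C%C - g x%:C%C) <= 2 * L * (y - x).
Proof.
rewrite le_eqVlt => /predU1P[-> _|xy H]; first by rewrite !subrr modc0 mulr0.
have part (k : R[i]) : modc k = 1 ->
    `|complex.Re (k * (g y%:C%C - g x%:C%C))| <= L * (y - x).
  move=> k1.
  have D (t : R) : x <= t <= y ->
      is_derive t 1 (fun t : R => complex.Re (k * g (0 + t%:C%C * 1)))
        (complex.Re (k * (g' t%:C%C * 1))).
    by move=> /H[d _]; apply: line_is_derive => //; rewrite add0r mulr1.
  have [||c cxy] := @MVT _ (fun t : R => complex.Re (k * g (0 + t%:C%C * 1)))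
     (fun t : R => complex.Re (k * (g' t%:C%C * 1))) x y xy.
  - by move=> t; rewrite in_itv/= => /andP[? ?]; apply: D; rewrite !ltW.
  - apply: continuous_in_subspaceT => t; rewrite inE/= in_itv/= => txy.
    apply: differentiable_continuous; apply/derivable1_diffP.
    by case: (D _ txy).
  - rewrite /= !add0r !mulr1 => E.
    have -> : complex.Re (k * (g y%:C%C - g x%:C%C)) =
        complex.Re (k * g y%:C%C) - complex.Re (k * g x%:C%C).
      by rewrite -cReN -cReD mulrBr.
    rewrite E normrM (gtr0_norm (x := y - x)) ?subr_gt0// ler_wpM2r ?subr_ge0 ?(ltW xy)//.
    rewrite (le_trans (Re_le_modc _))// modcM k1 mul1r.
    move: cxy; rewrite in_itv/= => /andP[h1 h2].
    by have /H[] : x <= c <= y by rewrite !ltW.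
apply: (le_trans (modc_le_ReIm _)).
have -> : complex.Im (g y%:C%C - g x%:C%C) = complex.Re (- 'j * (g y%:C%C - g x%:C%C)).
  by case: (_ - _) => u v /=; ring.
have -> : complex.Re (g y%:C%C - g x%:C%C) = complex.Re (1 * (g y%:C%C - g x%:C%C)).
  by rewrite mul1r.
rewrite -mulrA mulr_natl mulr2n lerD// part ?modc1//.
by rewrite modcN modci.
Qed.

End CauchyEstimates.

(** * Area means of holomorphic functions *)

Section MeasureLemmas.
Context {R : realType}.
Local Notation leb := (@lebesgue_measure R).
Local Open Scope ereal_scope.

(* No measurability is assumed: the integral of a nonnegative function is a
   supremum over the simple functions below it. *)
Lemma ge0_le_integral_any d (T : measurableType d)
    (m : {measure set T -> \bar R}) (D E : set T) (f g : T -> \bar R) :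
  D `<=` E -> (forall x, D x -> 0 <= f x) -> (forall x, E x -> 0 <= g x) ->
  (forall x, D x -> f x <= g x) ->
  \int[m]_(x in D) f x <= \int[m]_(x in E) g x.
Proof.
move=> DE f0 g0 fg; rewrite !ge0_integralE//.
apply: le_ereal_sup => _ /= [h hf <-]; exists h => // x.
apply: le_trans (hf x) _; rewrite !patchE.
case: ifPn => [/set_mem Dx|_]; first by rewrite (mem_set (DE _ Dx)) fg.
by case: ifPn => // /set_mem /g0.
Qed.

(** An open set is the union of the boxes with rational centre and radius 1 / (m + 1) that it
    contains; these are enumerated by [unpickle]. *)
Lemma open_measurable_prod (A : set (R * R)) : open A -> measurable A.
Proof.
move=> oA.
pose box (q : rat * rat * nat) : set (R * R) :=
  ball (ratr q.1.1 : R) (q.2.+1%:R^-1) `*` ball (ratr q.1.2 : R) (q.2.+1%:R^-1).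
pose F (n : nat) : set (R * R) :=
  if unpickle n is Some q then (if `[< box q `<=` A >] then box q else set0) else set0.
suff -> : A = \bigcup_n F n.
  apply: bigcupT_measurable => n; rewrite /F.
  case: unpickle => [q|//]; case: ifP => // _.
  by apply: measurableX; exact: measurable_ball.
apply/seteqP; split=> [[x y] Axy|w [n _]]; last first.
  rewrite /F; case: unpickle => [q|//].
  by case: ifP => // /asboolP qA /qA.
have /nbhs_ballP[e /= e0 He] := open_nbhs_nbhs (conj oA Axy).
have [m m0 me] : exists2 m, (0 < m)%N & (m.+1%:R^-1 < e / 2)%R.
  have e2 : (0 < (e / 2))%R by rewrite divr_gt0.
  exists (Num.truncn (e / 2)^-1).+1 => //.
  rewrite invf_plt ?posrE//; apply: lt_trans (truncnS_gt _) _.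
  by rewrite ltr_nat.
have m1 : (0 < m.+1%:R^-1 :> R)%R by rewrite invr_gt0.
have [u uE] : exists u : R, u = (m.+1%:R^-1)%R by exists (m.+1%:R^-1)%R.
rewrite -uE in me m1.
have [q1 q1P] : exists q : rat, ball (ratr q : R) u x.
  have [|q] := @rat_in_itvoo R (x - u)%R (x + u)%R; first by lra.
  rewrite in_itv/= => /andP[h1 h2]; exists q; rewrite /ball/= ltr_norml.
  by apply/andP; split; lra.
have [q2 q2P] : exists q : rat, ball (ratr q : R) u y.
  have [|q] := @rat_in_itvoo R (y - u)%R (y + u)%R; first by lra.
  rewrite in_itv/= => /andP[h1 h2]; exists q; rewrite /ball/= ltr_norml.
  by apply/andP; split; lra.
have bxy : box (q1, q2, m) (x, y) by rewrite /box/= -uE; split.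
suff bA : box (q1, q2, m) `<=` A.
  move: (q1, q2, m) bxy bA => q bxy bA; exists (pickle q); first exact: I.
  by rewrite /F pickleK ifT//; exact/asboolP.
rewrite /box /= -uE => -[u' v] [/= h1 h2]; apply: He; split => /=.
  move: q1P h1; rewrite /ball/= => h1 h1'.
  have -> : (x - u' = - (ratr q1 - x) + (ratr q1 - u'))%R by ring.
  by rewrite (le_lt_trans (ler_normD _ _))// normrN; lra.
move: q2P h2; rewrite /ball/= => h1' h2'.
have -> : (y - v = - (ratr q2 - y) + (ratr q2 - v))%R by ring.
by rewrite (le_lt_trans (ler_normD _ _))// normrN; lra.
Qed.

Lemma measurable_affine (c s : R) :
  measurable_fun setT ((fun x => c + s * x)%R : measurableTypeR R -> measurableTypeR R).
Proof.
apply: measurable_funD; first exact: measurable_cst.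
by apply: measurable_funM; [exact: measurable_cst|exact: measurable_id].
Qed.

(** By uniqueness of Lebesgue measure it suffices to compare lengths of half-open intervals. A
    negative s exchanges the closed and the open end, which forces the case split. *)
Lemma lebesgue_measure_affine (c s : R) (A : set R) : s != 0%R -> measurable A ->
  leb A = `|s|%:E * leb ((fun x => c + s * x)%R @^-1` A).
Proof.
move=> s0 mA.
pose phi : measurableTypeR R -> measurableTypeR R := (fun x => c + s * x)%R.
pose mphi := isMeasurableFun.Build _ _ _ _ phi (measurable_affine c s).
pose phi' : {mfun measurableTypeR R >-> measurableTypeR R} := HB.pack phi mphi.
pose r : {nonneg R} := NngNum (normr_ge0 s).
rewrite (@lebesgue_measure_unique R (mscale r (pushforward leb phi')))//.
move=> _ [[a b] _ <-] /=.
rewrite /mscale/= /pushforward lebesgue_measure_itv/=.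
have [sp|sn|se] := ltgtP s 0%R; last by rewrite se eqxx in s0.
  have -> : phi @^-1` `]a, b] = `[((b - c) / s)%R, ((a - c) / s)%R[%classic.
    apply/seteqP; split => x; rewrite /phi /= !in_itv/=.
      by rewrite ler_ndivrMr// ltr_ndivlMr// => /andP[h1 h2]; apply/andP; split; lra.
    by rewrite ler_ndivrMr// ltr_ndivlMr// => /andP[h1 h2]; apply/andP; split; lra.
  rewrite lebesgue_measure_itv/= !lte_fin ltr_nM2r ?invr_lt0// ltrD2r.
  case: ifP => _; rewrite ?mule0// -!EFinB -EFinM ltr0_norm//.
  by congr EFin; field.
have -> : phi @^-1` `]a, b] = `]((a - c) / s)%R, ((b - c) / s)%R]%classic.
  apply/seteqP; split => x; rewrite /phi /= !in_itv/=.
    by rewrite ltr_pdivrMr// ler_pdivlMr// => /andP[h1 h2]; apply/andP; split; lra.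
  by rewrite ltr_pdivrMr// ler_pdivlMr// => /andP[h1 h2]; apply/andP; split; lra.
rewrite lebesgue_measure_itv/= !lte_fin ltr_pM2r ?invr_gt0// ltrD2r.
case: ifP => _; rewrite ?mule0// -!EFinB -EFinM gtr0_norm//.
by congr EFin; field; rewrite gt_eqF.
Qed.

Lemma integral_affine (c s : R) (f : R -> \bar R) : s != 0%R ->
  measurable_fun setT f -> (forall x, 0 <= f x) ->
  \int[leb]_x f x = `|s|%:E * \int[leb]_x f (c + s * x)%R.
Proof.
move=> s0 mf f0.
pose phi : measurableTypeR R -> measurableTypeR R := (fun x => c + s * x)%R.
pose mphi := isMeasurableFun.Build _ _ _ _ phi (measurable_affine c s).
pose phi' : {mfun measurableTypeR R >-> measurableTypeR R} := HB.pack phi mphi.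
pose r : {nonneg R} := NngNum (normr_ge0 s).
rewrite (@eq_measure_integral _ _ R setT (mscale r (pushforward leb phi')) leb f); last first.
  by move=> A mA _; exact: (lebesgue_measure_affine c s0 mA).
rewrite ge0_integral_mscale//=; congr (_ * _).
by rewrite (ge0_integral_pushforward (measurable_affine c s)).
Qed.

End MeasureLemmas.

(** * Area means over squares *)

Section AreaMean.
Context {R : realType}.
Local Notation leb := (@lebesgue_measure R).
Local Notation leb2 := (@lebesgue_measure R \x @lebesgue_measure R)%E.
Local Notation "''j'" := ('i%C : R[i]).
Local Notation toC w := (w.1 +i* w.2)%C.
Implicit Types (g : R[i] -> R[i]) (E : set (R * R)).

Lemma measurable_modc g E : (forall z, modc z < 1 -> ccont g z) ->
  measurable E -> (forall w, E w -> modc (toC w) < 1) ->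
  measurable_fun E (fun w => modc (g (toC w))).
Proof.
move=> gc mE ED; apply: (measurability _ (RGenOInfty.measurableE R)).
move=> _ [_ [x ->] <-].
have -> : E `&` (fun w => modc (g (toC w))) @^-1` `]x, +oo[ =
    E `&` [set w | modc (toC w) < 1 /\ x < modc (g (toC w))].
  apply/seteqP; split=> w /= [Ew].
    by rewrite in_itv/= andbT => ?; split => //; split => //; exact: ED.
  by move=> [_ ?]; split => //; rewrite in_itv/= andbT.
apply: measurableI => //; apply: open_measurable_prod.
rewrite openE => w /= [w1 xw].
have xw' : 0 < modc (g (toC w)) - x by rewrite subr_gt0.
have [d d0 Hd] := gc _ w1 _ xw'.
pose e := Num.min d (1 - modc (toC w)) / 2.
have e0 : 0 < e by rewrite divr_gt0// lt_min d0 subr_gt0.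
apply/nbhs_ballP; exists e => // v [/= h1 h2].
have : modc (toC v - toC w) < Num.min d (1 - modc (toC w)).
  rewrite modcB (le_lt_trans (modc_le_ReIm _))//=.
  have -> : Num.min d (1 - modc (toC w)) = e + e by rewrite /e; field.
  by rewrite ltrD.
rewrite lt_min => /andP[/Hd A B]; split.
  have -> : toC v = (toC v - toC w) + toC w by rewrite subrK.
  by rewrite (le_lt_trans (modcD _ _))// -ltrBrDr.
have := modc_lip (g (toC v)) (g (toC w)); rewrite ler_norml => /andP[C _].
by lra.
Qed.

Lemma ge0_integralD4 (f1 f2 f3 f4 : R -> \bar R) :
  measurable_fun setT f1 -> measurable_fun setT f2 ->
  measurable_fun setT f3 -> measurable_fun setT f4 ->
  (forall x, 0 <= f1 x)%E -> (forall x, 0 <= f2 x)%E ->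
  (forall x, 0 <= f3 x)%E -> (forall x, 0 <= f4 x)%E ->
  (\int[leb]_x (f1 x + f2 x + f3 x + f4 x) =
  \int[leb]_x f1 x + \int[leb]_x f2 x + \int[leb]_x f3 x + \int[leb]_x f4 x)%E.
Proof.
move=> m1 m2 m3 m4 p1 p2 p3 p4.
have m12 := emeasurable_funD m1 m2; have m123 := emeasurable_funD m12 m3.
have p12 x : (0 <= f1 x + f2 x)%E by rewrite adde_ge0.
have p123 x : (0 <= f1 x + f2 x + f3 x)%E by rewrite adde_ge0.
by rewrite ge0_integralD// ge0_integralD// ge0_integralD.
Qed.

Variables (g g' : R[i] -> R[i]) (a : R[i]) (r S : R) (E : set (R * R)).
Hypothesis gD : forall z, modc z < 1 -> cderiv g (g' z) z /\ ccont g' z.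
Hypothesis r0 : 0 < r.
Hypothesis rS : 4 * r < S.
Hypothesis aS : forall z, modc (z - a) < S -> modc z < 1.
Hypothesis mE : measurable E.
Hypothesis ED : forall w, E w -> modc (toC w) < 1.
Hypothesis aE : forall x y : R, `|x - complex.Re a| <= 2 * r ->
  `|y - complex.Im a| <= 2 * r -> E (x, y).

Let G : R * R -> \bar R := (fun w => (modc (g (toC w)))%:E) \_ E.

Let G_ge0 w : (0 <= G w)%E.
Proof. by rewrite /G patchE; case: ifP => // _; rewrite lee_fin modc_ge0. Qed.

Let GE w : E w -> G w = (modc (g (toC w)))%:E.
Proof. by move=> Ew; rewrite /G patchE mem_set. Qed.

Let mG : measurable_fun setT G.
Proof.
rewrite /G -(measurable_restrictT (fun w => (modc (g (toC w)))%:E) mE).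
apply/measurable_EFinP; apply: measurable_modc => //.
by move=> z /gD[dg _]; exact: cderiv_ccont dg.
Qed.

Let mG1 (x : R) : measurable_fun setT (fun y => G (x, y)).
Proof. by apply: measurableT_comp => //; exact: measurable_fun_pair. Qed.
Let mG2 (y : R) : measurable_fun setT (fun x => G (x, y)).
Proof. by apply: measurableT_comp => //; exact: measurable_fun_pair. Qed.

Let G1 (x : R) := (\int[leb]_y G (x, y))%E.
Let G2 (y : R) := (\int[leb]_x G (x, y))%E.

Let mGG1 : measurable_fun setT G1.
Proof. exact: (measurable_fun_fubini_tonelli_F (m2 := leb) G mG G_ge0). Qed.
Let mGG2 : measurable_fun setT G2.
Proof. exact: (measurable_fun_fubini_tonelli_G (m1 := leb) G mG G_ge0). Qed.
Let G1_ge0 x : (0 <= G1 x)%E.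
Proof. by apply: integral_ge0. Qed.
Let G2_ge0 x : (0 <= G2 x)%E.
Proof. by apply: integral_ge0. Qed.

(** The four terms of the quarter sum run over the four sides of the square of half-width s. The
    substitution of s t for t produces the factor s, and each side is extended to the full line,
    [G1] being the vertical and [G2] the horizontal line integrals. *)
Let line_bound (s : R) : r <= s <= 2 * r ->
  ((s * (4 * modc (g a)))%:E <=
  G1 (complex.Re a + s) + G2 (complex.Im a + s) + G1 (complex.Re a - s) +
  G2 (complex.Im a - s))%E.
Proof.
move=> /andP[rs s2].
have s0 : 0 < s by rewrite (lt_le_trans r0).
have sn0 : s != 0 by rewrite gt_eqF.
have nsn0 : - s != 0 by rewrite oppr_eq0.
have S0 : 0 < S by apply: lt_trans rS; rewrite mulr_gt0.
have gS z : 0 < modc (z - a) < S -> cderiv g (g' z) z /\ ccont g' z.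
  by move=> /andP[_ /aS/gD].
have ga : ccont g a.
  by have /gD[dg _] : modc a < 1 by [apply: aS; rewrite subrr modc0]; exact: cderiv_ccont dg.
have sS : s * 2 < S by move: s2 rS; lra.
have [iq q4] := quarter_sum_mean S0 gS ga s0 sS.
have st (t : R) : -1 <= t <= 1 -> `|s * t| <= 2 * r.
  move=> t1; have tt : `|t| <= 1 by rewrite ler_norml.
  rewrite (normrM s t) (gtr0_norm s0); apply: le_trans s2.
  by rewrite ler_piMr// ltW.
have ss : `|s| <= 2 * r by rewrite (gtr0_norm s0).
pose a1 := complex.Re a; pose a2 := complex.Im a.
rewrite EFinM.
have H : ((4 * modc (g a))%:E <= \int[leb]_t G (a1 + s, a2 + s * t)%R +
   \int[leb]_t G (a1 + - s * t, a2 + s)%R + \int[leb]_t G (a1 - s, a2 + - s * t)%R +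
   \int[leb]_t G (a1 + s * t, a2 - s)%R)%E.
  have m1 (x c k : R) : measurable_fun setT (fun t => G (x, c + k * t)).
    by apply: (measurableT_comp (mG1 x)); exact: measurable_affine.
  have m2 (x c k : R) : measurable_fun setT (fun t => G (c + k * t, x)).
    by apply: (measurableT_comp (mG2 x)); exact: measurable_affine.
  rewrite -ge0_integralD4//.
  apply: (@le_trans _ _ (\int[leb]_(t in `[(-1)%R, 1%R])
     (modc (quarter_sum g a (s +i* (s * t))%C))%:E)%E).
    rewrite -[leRHS]fineK ?lee_fin//.
    by apply: integrable_fin_num.
  apply: ge0_le_integral_any => //.
  - by move=> t _; rewrite lee_fin modc_ge0.
  - by move=> t _; rewrite !adde_ge0.
  move=> t; rewrite /= in_itv/= => t1; have stt := st t t1.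
  rewrite !GE; last 4 first.
  - by apply: aE; rewrite addrC addKr ?mulNr ?normrN.
  - by apply: aE; rewrite addrC addKr ?mulNr ?normrN.
  - by apply: aE; rewrite addrC addKr ?mulNr ?normrN.
  - by apply: aE; rewrite addrC addKr ?mulNr ?normrN.
  rewrite -!EFinD lee_fin /quarter_sum /=.
  have -> : ((a1 + s) +i* (a2 + s * t) = a + (s +i* (s * t)))%C.
    by rewrite /a1 /a2; case: (a).
  have -> : ((a1 + - s * t) +i* (a2 + s) = a + 'j * (s +i* (s * t)))%C.
    by rewrite /a1 /a2; case: (a) => u v; apply: complexP => /=; ring.
  have -> : ((a1 - s) +i* (a2 + - s * t) = a - (s +i* (s * t)))%C.
    by rewrite /a1 /a2; case: (a) => u v; apply: complexP => /=; ring.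
  have -> : ((a1 + s * t) +i* (a2 - s) = a - 'j * (s +i* (s * t)))%C.
    by rewrite /a1 /a2; case: (a) => u v; apply: complexP => /=; ring.
  by do 2 (apply: (le_trans (modcD _ _)); apply: lerD => //); exact: modcD.
apply: le_trans (lee_wpmul2l _ H) _; first by rewrite lee_fin ltW.
have sE : `|s|%:E = s%:E by rewrite gtr0_norm.
have nsE : `|- s|%:E = s%:E by rewrite normrN gtr0_norm.
have D (x y z t : \bar R) : (0 <= x)%E -> (0 <= y)%E -> (0 <= z)%E -> (0 <= t)%E ->
    (s%:E * (x + y + z + t) = s%:E * x + s%:E * y + s%:E * z + s%:E * t)%E.
  by move=> x0 y0 z0 t0; rewrite !ge0_muleDr// !adde_ge0.
rewrite D; try by apply: integral_ge0.
have e1 (x c : R) : (s%:E * \int[leb]_t G (x, c + s * t)%R = G1 x)%E.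
  by rewrite /G1 (integral_affine c sn0 (mG1 x))// sE.
have e2 (x c : R) : (s%:E * \int[leb]_t G (x, c + - s * t)%R = G1 x)%E.
  by rewrite /G1 (integral_affine c nsn0 (mG1 x))// nsE.
have e3 (x c : R) : (s%:E * \int[leb]_t G (c + s * t, x)%R = G2 x)%E.
  by rewrite /G2 (integral_affine c sn0 (mG2 x))// sE.
have e4 (x c : R) : (s%:E * \int[leb]_t G (c + - s * t, x)%R = G2 x)%E.
  by rewrite /G2 (integral_affine c nsn0 (mG2 x))// nsE.
by rewrite e1 e2 e3 e4.
Qed.

(** Integrate the bound on the sides over half-widths s in [r, 2 r]. Each of the four moving lines
    sweeps a part of E, so by Tonelli it contributes at most the full integral I; the other side
    integrates to at least 4 r^2 |g(a)|, and a factor 4 cancels. *)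
Lemma area_mean : ((r ^+ 2 * modc (g a))%:E <=
  \int[leb2]_(w in E) (modc (g (toC w)))%:E)%E.
Proof.
pose I := (\int[leb2]_(w in E) (modc (g (toC w)))%:E)%E.
have IE : I = (\int[leb2]_w G w)%E by rewrite /I integral_mkcond.
have I1 : I = (\int[leb]_x G1 x)%E.
  by rewrite IE (fubini_tonelli1 (m1 := leb) (m2 := leb) G mG G_ge0).
have I2 : I = (\int[leb]_y G2 y)%E.
  by rewrite IE (fubini_tonelli2 (m1 := leb) (m2 := leb) G mG G_ge0).
have I0 : (0 <= I)%E by apply: integral_ge0 => w _; rewrite lee_fin modc_ge0.
have shift (c k : R) (f : R -> \bar R) : `|k| = 1 -> measurable_fun setT f ->
    (forall x, 0 <= f x)%E -> (\int[leb]_s f (c + k * s)%R = \int[leb]_x f x)%E.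
  move=> k1 mf f0; rewrite [RHS](integral_affine c (s := k))//.
    by rewrite k1 mul1e.
  by rewrite -normr_gt0 k1.
have m1 (f : R -> \bar R) (c k : R) : measurable_fun setT f ->
    measurable_fun setT (fun t => f (c + k * t)).
  by move=> mf; apply: (measurableT_comp mf); exact: measurable_affine.
have H : ((4 * (r ^+ 2 * modc (g a)))%:E <= I + I + I + I)%E.
  rewrite {1}I1 -(shift (complex.Re a) 1 G1) ?normr1//.
  rewrite {1}I2 -(shift (complex.Im a) 1 G2) ?normr1//.
  rewrite {1}I1 -(shift (complex.Re a) (-1) G1) ?normrN1//.
  rewrite {1}I2 -(shift (complex.Im a) (-1) G2) ?normrN1//.
  rewrite -ge0_integralD4//; [|exact: m1..].
  apply: (@le_trans _ _ (\int[leb]_(s in `[r, (2 * r)%R]) (4 * r * modc (g a))%:E)%E).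
    rewrite integral_cst//= lebesgue_measure_itv/= lte_fin ifT; last first.
      by rewrite ltr_pMl// ltr1n.
    by rewrite -EFinB -EFinM lee_fin le_eqVlt; apply/orP; left; apply/eqP; ring.
  apply: ge0_le_integral_any => //.
  - by move=> s _; rewrite lee_fin !mulr_ge0 ?modc_ge0// ltW.
  - by move=> s _; do 3 (apply: adde_ge0; last by []); exact: G1_ge0.
  move=> s; rewrite /= in_itv/= => rs; rewrite !mul1r !mulN1r.
  apply: le_trans (line_bound rs); rewrite lee_fin.
  have m0 := modc_ge0 (g a); case/andP: rs => rs _.
  rewrite mulrA (mulrC s) ler_wpM2r// ler_wpM2l//.
rewrite -/I; case: I H I0 {IE I1 I2} => [i H _|_ _|_ //].
  by move: H; rewrite -!EFinD !lee_fin; lra.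
by rewrite leey.
Qed.

End AreaMean.

(** * Dyadic regions in the disc *)

Section Dyadic.
Context {R : realType}.

Definition dyad (k : nat) : R := 2^-1 ^+ k.

Lemma dyadE k : dyad k = 2^-1 ^+ k. Proof. by []. Qed.
Lemma dyad_gt0 k : 0 < dyad k. Proof. by rewrite exprn_gt0. Qed.
Lemma dyadS k : dyad k.+1 = dyad k / 2. Proof. by rewrite /dyad exprSr. Qed.
Lemma dyad0 : dyad 0 = 1. Proof. by rewrite /dyad expr0. Qed.
Lemma dyad_le m n : (m <= n)%N -> dyad n <= dyad m.
Proof. by move=> mn; rewrite /dyad ler_wiXn2l// invf_le1// ler1n. Qed.
Lemma dyad_le1 k : dyad k <= 1.
Proof. by rewrite -dyad0 dyad_le. Qed.

End Dyadic.

Section EReal.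
Context {R : realType}.
Local Open Scope ereal_scope.

Lemma nneseries_le_ub (u : nat -> \bar R) (B : \bar R) : (forall n, 0 <= u n) ->
  (forall n, \sum_(0 <= k < n) u k <= B) -> \sum_(k <oo) u k <= B.
Proof.
move=> u0 uB; apply: lime_le; first exact: is_cvg_nneseries.
exact: nearW.
Qed.

(** The sum is the integral of the step function equal to A_k on J_k, and F enters through a
    pointwise comparison only. This suits the circle integrand, which is itself a power of an area
    integral. *)
Lemma sum_disjoint_le_integral (J : nat -> set R) (D : set R)
    (A : nat -> \bar R) (F : R -> \bar R) :
  trivIset setT J -> (forall k, measurable (J k)) -> (forall k, J k `<=` D) ->
  (forall k, 0 <= A k) -> (forall x, D x -> 0 <= F x) ->
  (forall k x, J k x -> A k <= F x) ->
  \sum_(k <oo) A k * lebesgue_measure (J k) <= \int[lebesgue_measure]_(x in D) F x.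
Proof.
move=> tJ mJ JD A0 F0 AF.
have H0 k x : 0 <= A k * (\1_(J k) x)%:E by rewrite mule_ge0// lee_fin.
have mH k : measurable_fun setT (fun x : R => A k * (\1_(J k) x)%:E).
  apply: emeasurable_funM; first exact: measurable_cst.
  by apply/measurable_EFinP; exact: measurable_indic.
apply: (@le_trans _ _ (\int[lebesgue_measure]_x \sum_(k <oo) A k * (\1_(J k) x)%:E)).
  rewrite integral_nneseries//; apply: lee_nneseries => [k _|k _].
    by rewrite mule_ge0.
  have mi : measurable_fun setT (fun x : R => ((\1_(J k) x : R)%R)%:E).
    by apply/measurable_EFinP; exact: measurable_indic.
  rewrite ge0_integralZl//.
  by rewrite integral_indic ?setIT//; exact: mJ.
rewrite [leRHS]integral_mkcond; apply: ge0_le_integral_any => //.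
- by move=> x _; apply: nneseries_ge0.
- by move=> x _; rewrite patchE; case: ifPn => // /set_mem/F0.
move=> x _; apply: nneseries_le_ub => // n.
have [[k kn Jx]|nJ] := pselect (exists2 k, (k < n)%N & J k x).
  have xD : x \in D by apply/mem_set; exact: (JD _ _ Jx).
  rewrite patchE xD big_mkord (bigD1 (Ordinal kn))//= big1 ?adde0.
    by rewrite indicE mem_set// mule1; exact: AF.
  move=> i ik; rewrite indicE memNset ?mule0// => Jix.
  have := tJ i k I I; move/(_ (ex_intro _ x (conj Jix Jx))) => ik'.
  by move/negP : ik; apply; apply/eqP/val_inj.
rewrite big_nat big1 ?patchE.
  by case: ifPn => // /set_mem/F0.
move=> k /andP[_ kn]; rewrite indicE memNset ?mule0// => Jx.
by apply: nJ; exists k.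
Qed.

End EReal.

(** * Dyadic boxes inside the approach regions *)

Section Geometry.
Context {R : realType}.
Local Notation toC w := (w.1 +i* w.2)%C.

Lemma modc_expi_sub1 (t : R) : 0 <= t -> modc (1 - expi t) <= 2 * t.
Proof.
rewrite le_eqVlt => /predU1P[<-|t0].
  rewrite /expi cos0 sin0 (_ : (1 +i* 0)%C = 1 :> R[i])//.
  by rewrite subrr modc0 mulr0.
apply: (le_trans (modc_le_ReIm _)) => /=; rewrite sub0r normrN distrC.
have [|c _] := @MVT R cos (fun x => - sin x) 0 t t0.
  by apply: continuous_subspaceT => x; exact: continuous_cos.
have [|c' _] := @MVT R sin cos 0 t t0.
  by apply: continuous_subspaceT => x; exact: continuous_sin.
rewrite sin0 cos0 !subr0 => -> ->; rewrite !normrM normrN !(gtr0_norm t0).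
have := cos_max c'; have := sin_max c; nra.
Qed.

Lemma modc_expi (t : R) : modc (expi t) = 1.
Proof. by rewrite modcE/= cos2Dsin2 sqrtr1. Qed.

(** Solving z = (1 - s) w + s xi for w gives a point of modulus less than 1/2. *)
Lemma Gamma_halfP (xi z : R[i]) (s : R) : modc xi = 1 -> 0 <= s < 1 ->
  modc (z - s%:C%C * xi) < (1 - s) / 2 -> Gamma_half xi z.
Proof.
move=> xi1 /andP[s0 s1] h; right.
have s1' : 0 < 1 - s by rewrite subr_gt0.
have s1c : (1 - s%:C%C : R[i]) != 0.
  by rewrite -modc_gt0 -(rmorph1 (real_complex R)) -rmorphB modc_real normr_gt0 gt_eqF.
exists ((z - s%:C%C * xi) / (1 - s%:C%C)).
  rewrite /= modcM modcV -(rmorph1 (real_complex R)) -rmorphB modc_real gtr0_norm//.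
  by rewrite ltr_pdivrMr// [ltRHS]mulrC.
exists s; first by rewrite /= in_itv/= s0.
by field.
Qed.

(** The margin d_k/16 around the cell [1 - d_k, 1 - d_k/2] contains the squares of half-width d_k/32
    about points within d_k/64 of the cell in each coordinate, as the area means require. *)
Definition dyadic_box (k : nat) : set (R * R) :=
  `[1 - dyad k - dyad k / 16, 1 - dyad k / 2 + dyad k / 16] `*`
  `[- (dyad k / 16), dyad k / 16].

Lemma dyadic_boxP k w : dyadic_box k w -> exists d : R, [/\ dyad k = d, 0 < d <= 1,
  1 - d - d / 16 <= w.1 <= 1 - d / 2 + d / 16 & `|w.2| <= d / 16].
Proof.
move=> []; rewrite /= !in_itv/= => h1 h2; exists (dyad k).
by rewrite dyad_gt0 dyad_le1 ler_norml.
Qed.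

Lemma dyadic_box_disc k w : dyadic_box k w -> modc (toC w) < 1.
Proof.
move=> /dyadic_boxP[d [_ /andP[d0 d1] /andP[h1 h2] h3]].
apply: (le_lt_trans (modc_le_ReIm _)) => /=.
have [x0|x0] := leP 0 w.1; [rewrite ger0_norm//|rewrite ltr0_norm//]; lra.
Qed.

Lemma dyadic_box_weight k w : dyadic_box k w ->
  0 < 1 - modc (toC w) ^+ 2 <= 3 * dyad k.
Proof.
move=> B; have h := dyadic_box_disc B; have m0 := modc_ge0 (toC w).
apply/andP; split; first by nra.
have [d [-> /andP[d0 d1] /andP[h1 h2] h3]] := dyadic_boxP B.
have := Re_le_modc (toC w) => /=.
have [x0|x0] := leP 0 w.1; [rewrite ger0_norm//|rewrite ltr0_norm//]; nra.
Qed.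

(** Take s = Re z in [Gamma_halfP]. The distance from z to s xi is at most |Im z| + 2 t <= 3 d_k/16,
    while (1 - s)/2 >= 7 d_k/32. *)
Lemma dyadic_box_Gamma k w (t : R) : dyadic_box k w -> 0 <= t <= dyad k / 16 ->
  Gamma_half (expi t) (toC w).
Proof.
move=> B /andP[t0 tk]; have hd := dyadic_box_disc B.
have [d [kd /andP[d0 d1] /andP[h1 h2] h3]] := dyadic_boxP B.
have ht := modc_expi_sub1 t0; rewrite kd in tk.
have [x0|x0] := leP 0 w.1.
  apply: (@Gamma_halfP _ _ w.1); first exact: modc_expi.
    by rewrite x0 /=; lra.
  have -> : toC w - w.1%:C%C * expi t = (0 +i* w.2)%C + w.1%:C%C * (1 - expi t).
    by apply: complexP => /=; ring.
  apply: (le_lt_trans (modcD _ _)); rewrite modcM modc_real (ger0_norm x0).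
  have h4 := modc_le_ReIm (0 +i* w.2)%C; rewrite /= normr0 add0r in h4.
  have h5 := modc_ge0 (1 - expi t).
  have h6 : w.1 * modc (1 - expi t) <= 2 * t by nra.
  lra.
(* A negative real part occurs in box 0 only, where |z| <= 1/8 puts z in the central disc. *)
left; split => //=.
apply: (le_lt_trans (modc_le_ReIm _)) => /=; rewrite ltr0_norm//; lra.
Qed.

Lemma measurable_dyadic_box k : measurable (dyadic_box k).
Proof. by apply: measurableX; exact: measurable_itv. Qed.

Lemma dyadic_box_measure k : ((@lebesgue_measure R \x @lebesgue_measure R) (dyadic_box k) =
  (5 / 64 * dyad k ^+ 2)%:E)%E.
Proof.
have d0 := @dyad_gt0 R k.
rewrite product_measure1E; [|exact: measurable_itv..].
rewrite /= !lebesgue_measure_itv/= !lte_fin !ifT; [|lra..].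
by rewrite -!EFinB -EFinM; congr EFin; field.
Qed.

End Geometry.

(** * The lower bound on the dyadic core *)

Section LowerBound.
Context {R : realType}.
Local Notation leb := (@lebesgue_measure R).
Local Notation leb2 := (@lebesgue_measure R \x @lebesgue_measure R)%E.
Local Notation toC w := (w.1 +i* w.2)%C.
Local Notation dyad := (@dyad R).
Implicit Types (g : R[i] -> R[i]).

Definition dyadic_core (k : nat) (z : R[i]) : Prop :=
  `|complex.Im z| <= dyad k / 64 /\
  1 - dyad k - dyad k / 64 <= complex.Re z <= 1 - dyad k / 2 + dyad k / 64.

(** If u > v then u = u^(1-p) u^p <= v^(1-p) u^p. With a free threshold v this replaces Jensen's
    inequality in passing from means of |g| to means of |g|^p. *)
Lemma powR_young_le (p u v : R) : 1 < p -> 0 <= u -> 0 < v ->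
  u <= v + v `^ (1 - p) * u `^ p.
Proof.
move=> p1 u0 v0; have [uv|vu] := leP u v.
  by rewrite (le_trans uv)// lerDl mulr_ge0 ?powR_ge0.
have u1 : 0 < u by rewrite (lt_trans v0).
apply: (@le_trans _ _ (v `^ (1 - p) * u `^ p)); last by rewrite lerDr ltW.
have {1}-> : u = u `^ (1 - p) * u `^ p.
  by rewrite -powRD ?subrK ?powRr1 ?(ltW u1)//; apply/implyP => _; rewrite gt_eqF.
rewrite ler_wpM2r ?powR_ge0//.
rewrite -(opprB p 1) !powRN lef_pV2 ?posrE ?powR_gt0//.
by rewrite ge0_ler_powR ?nnegrE ?subr_ge0 ?ltW.
Qed.

Definition box_cst (p : R) : R := (2 * 64 ^+ 2 * (10 * 64) `^ (p - 1))^-1.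

Let k0 : 0 < 10 * 64 :> R. Proof. exact: mulr_gt0. Qed.

Lemma box_cst_gt0 p : 0 < box_cst p.
Proof.
rewrite /box_cst invr_gt0; apply: mulr_gt0; last exact: powR_gt0.
by apply: mulr_gt0 => //; exact: exprn_gt0.
Qed.

Lemma box_power_mean (p : R) g g' k z : 1 < p ->
  (forall z, modc z < 1 -> cderiv g (g' z) z /\ ccont g' z) -> dyadic_core k z ->
  ((box_cst p * dyad k ^+ 2 * modc (g z) `^ p)%:E <=
   \int[leb2]_(w in dyadic_box k) (modc (g (toC w)) `^ p)%:E)%E.
Proof.
move=> p1 gD [iz rz].
have p0 : 0 < p by rewrite (lt_trans ltr01).
set N := (\int[leb2]_(w in _) _)%E.
have N0 : (0 <= N)%E by apply: integral_ge0 => w _; rewrite lee_fin powR_ge0.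
have d0 := @dyad_gt0 R k; have d1 := @dyad_le1 R k.
have [->|gz0] := eqVneq (g z) 0.
  by rewrite modc0 powR0 ?gt_eqF// mulr0.
set m := modc (g z); have m0 : 0 < m by rewrite modc_gt0.
pose r := dyad k / 64 : R; have r0 : 0 < r by rewrite divr_gt0.
(* The box has area 5 d_k^2 / 64, so this threshold makes v times the area equal to r^2 m / 2:
   exactly half of the area mean is absorbed. *)
pose v := m / (10 * 64); have v0 : 0 < v by exact: divr_gt0.
have mB := @measurable_dyadic_box R k.
have mg : measurable_fun (dyadic_box k) (fun w => modc (g (toC w))).
  apply: measurable_modc => //; last exact: dyadic_box_disc.
  by move=> x /gD[dg _]; exact: cderiv_ccont dg.
have mgp : measurable_fun (dyadic_box k) (fun w => (modc (g (toC w)) `^ p)%:E).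
  apply/measurable_EFinP.
  by apply: (measurableT_comp (measurable_powR p)).
have A : ((r ^+ 2 * m)%:E <= \int[leb2]_(w in dyadic_box k) (modc (g (toC w)))%:E)%E.
  apply: (@area_mean R g g' z r (dyad k / 8)) => //.
  - by rewrite /r; lra.
  - move=> x xz; have -> : x = (x - z) + z by rewrite subrK.
    apply: (le_lt_trans (modcD _ _)).
    have := modc_le_ReIm z; move: rz => /andP[h1 h2].
    by have [x0|x0] := leP 0 (complex.Re z); [rewrite (ger0_norm x0)|rewrite (ltr0_norm x0)]; lra.
  - exact: dyadic_box_disc.
  - move=> x y; rewrite !ler_norml => /andP[x1 x2] /andP[y1 y2].
    move: iz rz; rewrite ler_norml /r in x1 x2 y1 y2 * => /andP[i1 i2] /andP[h1 h2].
    by split; rewrite /= in_itv/=; apply/andP; split; lra.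
have B : ((r ^+ 2 * m)%:E <= (r ^+ 2 * m / 2)%:E + (v `^ (1 - p))%:E * N)%E.
  apply: (le_trans A); apply: (@le_trans _ _ (\int[leb2]_(w in dyadic_box k)
     (v%:E + (v `^ (1 - p))%:E * (modc (g (toC w)) `^ p)%:E))%E).
    apply: ge0_le_integral_any => // w _.
    - by rewrite lee_fin modc_ge0.
    - by rewrite -EFinM -EFinD lee_fin addr_ge0 ?mulr_ge0 ?powR_ge0// ltW.
    - by rewrite -EFinM -EFinD lee_fin powR_young_le// modc_ge0.
  have v1 : (0 <= (v `^ (1 - p))%:E)%E by rewrite lee_fin powR_ge0.
  have g1 w : dyadic_box k w -> (0 <= (modc (g (toC w)) `^ p)%:E)%E.
    by move=> _; rewrite lee_fin powR_ge0.
  have vg1 w : dyadic_box k w ->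
      (0 <= (v `^ (1 - p))%:E * (modc (g (toC w)) `^ p)%:E)%E.
    by move=> wk; rewrite mule_ge0 ?g1.
  have mvg : measurable_fun (dyadic_box k) (fun w =>
      ((v `^ (1 - p))%:E * (modc (g (toC w)) `^ p)%:E)%E).
    by apply: emeasurable_funM => //; exact: measurable_cst.
  have vv w : dyadic_box k w -> (0 <= v%:E)%E by rewrite lee_fin ltW.
  rewrite ge0_integralD//.
  rewrite integral_cst//= dyadic_box_measure ge0_integralZl//.
  rewrite leeD2r// -EFinM lee_fin /v /r le_eqVlt; apply/orP; left; apply/eqP.
    by field.
  by move=> x _; rewrite lee_fin ltW.
have [NE|NE] := eqVneq N +oo%E; first by rewrite NE leey.
have Nf : N \is a fin_num by rewrite ge0_fin_numE// ltey.
move: B; rewrite -(fineK Nf); move: (fine N) => n.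
rewrite -EFinM -EFinD !lee_fin => B.
have vE : v `^ (1 - p) = (10 * 64) `^ (p - 1) * (m * (m `^ p)^-1).
  rewrite /v powRM ?invr_ge0 ?(ltW m0) ?(ltW k0)// -powR_inv1// -powRrM mulN1r opprB mulrC.
  congr (_ * _); rewrite powRB ?powRr1 ?ltW//.
  by apply/implyP => _; rewrite gt_eqF.
have mp0 : 0 < m `^ p by rewrite powR_gt0.
have c0 : 0 < (10 * 64) `^ (p - 1) :> R by exact: powR_gt0.
move: B; rewrite vE /box_cst /r => B.
have {B} B : dyad k ^+ 2 * m * m `^ p / 64 ^+ 2 <= 2 * ((10 * 64) `^ (p - 1) * m * n).
  have := ler_wpM2r (ltW mp0) B.
  have -> : ((dyad k / 64) ^+ 2 * m / 2 + (10 * 64) `^ (p - 1) * (m * (m `^ p)^-1) * n) * m `^ p =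
     (dyad k / 64) ^+ 2 * m / 2 * m `^ p + (10 * 64) `^ (p - 1) * m * n by field; rewrite gt_eqF.
  rewrite expr_div_n.
  by move: ((10 * 64) `^ (p - 1)) (m `^ p) => x y; lra.
have -> : (2 * 64 ^+ 2 * (10 * 64) `^ (p - 1))^-1 * dyad k ^+ 2 * m `^ p =
    dyad k ^+ 2 * m * m `^ p / 64 ^+ 2 / (2 * (10 * 64) `^ (p - 1) * m).
  by field; rewrite !gt_eqF.
rewrite ler_pdivrMr ?mulr_gt0//; apply: (le_trans B).
by rewrite le_eqVlt; apply/orP; left; apply/eqP; ring.
Qed.

(** The q-th power of [AT_norm]; the estimates compare sums of q-th powers, and the root is taken at
    the end. *)
Definition AT_pow (p q : R) (f : R[i] -> R[i]) : \bar R :=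
  arc_integral (fun xi =>
    poweR (area_integral (Gamma_half xi)
             (fun z => modc (f z) `^ p / (1 - modc z ^+ 2))) (q / p)).

Lemma AT_pow_ge0 p q f : (0 <= AT_pow p q f)%E.
Proof. by apply: integral_ge0 => t _; exact: poweR_ge0. Qed.

Lemma Gamma_half_disc (xi z : R[i]) : modc xi = 1 -> Gamma_half xi z -> modc z < 1.
Proof.
move=> xi1 [[]//|[w /= w1 [s]]]; rewrite /= in_itv/= => /andP[s0 s1] <-.
apply: (le_lt_trans (modcD _ _)); rewrite !modcM xi1 mulr1 modc_real ger0_norm//.
rewrite -(rmorph1 (real_complex R)) -rmorphB modc_real ger0_norm ?subr_ge0 ?ltW//.
by have := modc_ge0 w; nra.
Qed.

Lemma le_poweR (x y : \bar R) (r : R) : 0 < r -> (0 <= x)%E -> (x <= y)%E ->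
  (poweR x r <= poweR y r)%E.
Proof.
move=> r0 x0 xy; apply: gt0_ler_poweR => //; first exact: ltW.
  by rewrite in_itv/= x0 leey.
by rewrite in_itv/= leey (le_trans x0).
Qed.

(** The sequence b does not depend on the point of the core, so it stands for a supremum; it is
    extended real because the norm of g may be infinite. The exponent al arises from (d_k
    |g|^p)^(q/p) d_k = (d_k^al |g|)^q, the last d_k being the length of an arc. *)
Lemma AT_lower (p q : R) : 1 < p -> 1 < q ->
  exists2 C : R, 0 < C & forall g, analytic_on_disc g ->
    exists b : nat -> \bar R, [/\ forall k, (0 <= b k)%E,
      forall k z, dyadic_core k z ->
        (((dyad k `^ (p^-1 + q^-1) * modc (g z)) `^ q)%:E <= b k)%E &
      (\sum_(k <oo) b k <= C%:E * AT_pow p q g)%E].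
Proof.
move=> p1 q1.
have p0 : 0 < p by rewrite (lt_trans ltr01).
have q0 : 0 < q by rewrite (lt_trans ltr01).
have qp0 : 0 < q / p by rewrite divr_gt0.
(* 3 comes from 1 - |z|^2 <= 3 d_k on the box, pi from the normalization of the area. *)
pose c : R := box_cst p / (3 * pi).
have c0 : 0 < c by rewrite divr_gt0 ?box_cst_gt0// mulr_gt0// pi_gt0.
pose C : R := 32 / c `^ (q / p).
have C0 : 0 < C by rewrite divr_gt0// powR_gt0.
exists C => // g ga.
have [g' gD] := analytic_C1 ga.
pose N k : \bar R := (\int[leb2]_(w in dyadic_box k) (modc (g (toC w)) `^ p)%:E)%E.
have N0 k : (0 <= N k)%E by apply: integral_ge0 => w _; rewrite lee_fin powR_ge0.
pose A k : \bar R := poweR ((3 * pi * dyad k)^-1%:E * N k)%E (q / p).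
have A0 k : (0 <= A k)%E by exact: poweR_ge0.
(* Every angle up to d_k/16 sees box k; keeping only those above d_{k+1}/16 makes the arcs disjoint
   and still of length d_k/32. *)
pose J k : set R := `[dyad k.+1 / 16, dyad k / 16[%classic.
have d0 := @dyad_gt0 R; have d1 := @dyad_le1 R.
have mJ k : leb (J k) = (dyad k / 32)%:E.
  rewrite lebesgue_measure_itv/= lte_fin dyadS ifT; last by have := d0 k; lra.
  by rewrite -EFinB; congr EFin; lra.
exists (fun k => C%:E * (A k * leb (J k)))%E; split.
- by move=> k; rewrite mule_ge0 ?mule_ge0// lee_fin ltW.
- move=> k z zk; rewrite mJ.
  have h := box_power_mean p1 gD zk; rewrite -/(N k) in h.
  have dk := d0 k; have d3 : 0 < 3 * pi * dyad k by rewrite !mulr_gt0// pi_gt0.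
  have {h} h : ((c * dyad k * modc (g z) `^ p)%:E <= (3 * pi * dyad k)^-1%:E * N k)%E.
    have : ((3 * pi * dyad k)^-1%:E * (box_cst p * dyad k ^+ 2 * modc (g z) `^ p)%:E <=
       (3 * pi * dyad k)^-1%:E * N k)%E.
      by apply: lee_wpmul2l => //; rewrite lee_fin invr_ge0 ltW.
    apply: le_trans; rewrite -EFinM lee_fin le_eqVlt; apply/orP; left; apply/eqP.
    rewrite /c; have := @pi_gt0 R; move: (pi : R) => P P0; field.
    by rewrite !gt_eqF.
  have cm : 0 <= c * dyad k * modc (g z) `^ p.
    by apply: mulr_ge0; [apply: mulr_ge0; exact: ltW|exact: powR_ge0].
  have : (((c * dyad k * modc (g z) `^ p) `^ (q / p))%:E <= A k)%E.
    rewrite -poweR_EFin; apply: le_poweR => //; rewrite lee_fin.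
  have -> : (c * dyad k * modc (g z) `^ p) `^ (q / p) =
      c `^ (q / p) * dyad k `^ (q / p) * modc (g z) `^ q.
    have E : (modc (g z) `^ p) `^ (q / p) = modc (g z) `^ q.
      by rewrite -powRrM mulrCA mulfV ?mulr1// gt_eqF.
    rewrite powRM; [|by apply: mulr_ge0; exact: ltW|exact: powR_ge0].
    by rewrite powRM ?E// ltW.
  move=> hA.
  have -> : (dyad k `^ (p^-1 + q^-1) * modc (g z)) `^ q =
      C * (c `^ (q / p) * dyad k `^ (q / p) * modc (g z) `^ q * (dyad k / 32)).
    rewrite powRM ?powR_ge0 ?modc_ge0// -powRrM mulrDl mulVf ?gt_eqF//.
    rewrite powRD; last by apply/implyP => _; rewrite gt_eqF.
    rewrite powRr1 ?ltW// (mulrC p^-1) /C; field.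
    by rewrite gt_eqF// powR_gt0.
  rewrite EFinM; apply: lee_wpmul2l; first by rewrite lee_fin ltW.
  by rewrite EFinM; apply: lee_wpmul2r; first by rewrite lee_fin divr_ge0// ltW.
- rewrite nneseriesZl; last by move=> k _; rewrite mule_ge0.
  apply: lee_wpmul2l; first by rewrite lee_fin ltW.
  apply: sum_disjoint_le_integral => //.
  + apply/trivIsetP => i j _ _ ij; apply/seteqP; split => // x [].
    rewrite /J /= !in_itv/= => /andP[a1 a2] /andP[b1 b2].
    have [lij|lji|eij] := ltngtP i j; last by rewrite eij eqxx in ij.
      by have := dyad_le (R := R) lij; lra.
    by have := dyad_le (R := R) lji; lra.
  + by move=> k; exact: measurable_itv.
  + move=> k x; rewrite /J /= !in_itv/= => /andP[x1 x2]; apply/andP; split.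
      by apply: le_trans x1; rewrite divr_ge0// ltW.
    by have := d1 k; have := @pi_ge2 R; lra.
  + by move=> x _; exact: poweR_ge0.
  + move=> k x; rewrite /J /= !in_itv/= => /andP[x1 x2].
    have xk : 0 <= x <= dyad k / 16.
      by rewrite (ltW x2) andbT; apply: le_trans x1; rewrite divr_ge0// ltW.
    apply: le_poweR => //.
      rewrite mule_ge0// lee_fin invr_ge0 ltW//; apply: mulr_gt0 => //.
      by apply: mulr_gt0; rewrite ?pi_gt0.
    have -> : ((3 * pi * dyad k)^-1)%:E = ((pi^-1)%:E * ((3 * dyad k)^-1)%:E :> \bar R)%E.
      by rewrite -EFinM -invfM; congr (_^-1)%:E; ring.
    rewrite -muleA; apply: lee_wpmul2l; first by rewrite lee_fin invr_ge0 pi_ge0.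
    have mgp : measurable_fun (dyadic_box k) (fun w => (modc (g (toC w)) `^ p)%:E).
      apply/measurable_EFinP.
      apply: (measurableT_comp (measurable_powR p)).
      apply: measurable_modc; last exact: dyadic_box_disc.
        by move=> y /gD[dg _]; exact: cderiv_ccont dg.
      exact: measurable_dyadic_box.
    have g1 w : dyadic_box k w -> (0 <= (modc (g (toC w)) `^ p)%:E)%E.
      by move=> _; rewrite lee_fin powR_ge0.
    have d31 : (0 <= (3 * dyad k)^-1%:E :> \bar R)%E.
      by rewrite lee_fin invr_ge0 mulr_ge0// ltW.
    have mB := @measurable_dyadic_box R k.
    rewrite -ge0_integralZl//.
    apply: ge0_le_integral_any.
    + by move=> w wk; exact: dyadic_box_Gamma wk xk.
    + by move=> w _; rewrite -EFinM lee_fin mulr_ge0 ?powR_ge0// invr_ge0 mulr_ge0// ltW.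
    + move=> w /= /Gamma_half_disc; rewrite modc_expi => /(_ erefl) w1.
      by rewrite lee_fin divr_ge0 ?powR_ge0// subr_ge0 expr_le1// ?modc_ge0// ltW.
    + move=> w wk; rewrite -EFinM lee_fin mulrC ler_wpM2l ?powR_ge0//.
      by have /andP[w1 w2] := dyadic_box_weight wk; rewrite lef_pV2 ?posrE ?mulr_gt0.
Qed.

End LowerBound.

(** * The upper bound *)

Section Peel.
Context {R : realType}.
Local Notation dyad := (@dyad R).

(* Crude substitute for Hoelder, valid for every exponent r > 0; it is enough
   because all the weights used are geometric. *)
Lemma powR_sum_le (I : Type) (s : seq I) (w x : I -> R) (r : R) : 0 < r ->
  (forall i, 0 <= w i) -> (forall i, 0 <= x i) ->
  (\sum_(i <- s) w i * x i) `^ r <=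
  (\sum_(i <- s) w i) `^ r * \sum_(i <- s) x i `^ r.
Proof.
move=> r0 w0 x0.
pose M := (\sum_(i <- s) x i `^ r) `^ r^-1.
have S0 : 0 <= \sum_(i <- s) x i `^ r by apply: sumr_ge0 => i _; exact: powR_ge0.
have -> : \sum_(i <- s) x i `^ r = M `^ r.
  by rewrite -powRrM mulVf ?gt_eqF// powRr1.
have W0 : 0 <= \sum_(i <- s) w i by exact: sumr_ge0.
rewrite -powRM ?powR_ge0//.
apply: ge0_ler_powR; rewrite ?nnegrE; first exact: ltW.
- by apply: sumr_ge0 => i _; exact: mulr_ge0.
- by apply: mulr_ge0 => //; exact: powR_ge0.
suff : \sum_(i <- s) w i * x i <= \sum_(i <- s) w i * M by rewrite -mulr_suml.
have xM (t : seq I) : \sum_(i <- t) w i * x i <=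
    \sum_(i <- t) w i * (\sum_(i <- t) x i `^ r) `^ r^-1.
  elim: t => [|j t IH]; first by rewrite !big_nil.
  have T0 : 0 <= \sum_(i <- t) x i `^ r by apply: sumr_ge0 => i _; exact: powR_ge0.
  have xj : 0 <= x j `^ r := powR_ge0 _ _.
  rewrite !big_cons lerD//.
    rewrite ler_wpM2l// -[leLHS]powRr1// -[1](mulfV (lt0r_neq0 r0)) powRrM.
    by apply: ge0_ler_powR; rewrite ?nnegrE ?invr_ge0 ?(ltW r0)// ?addr_ge0// lerDl.
  apply: (le_trans IH); apply: ler_sum => i _; rewrite ler_wpM2l//.
  by apply: ge0_ler_powR; rewrite ?nnegrE ?invr_ge0 ?(ltW r0)// ?addr_ge0// lerDr.
exact: xM.
Qed.

Lemma sum_geometric_le (k : R) n : 0 <= k -> k < 1 ->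
  \sum_(0 <= i < n) k ^+ i <= (1 - k)^-1.
Proof.
move=> k0 k1; have k2 : 0 < 1 - k by rewrite subr_gt0.
suff -> : \sum_(0 <= i < n) k ^+ i = (1 - k ^+ n) / (1 - k).
  by rewrite ler_piMl ?invr_ge0 ?(ltW k2)// gerBl exprn_ge0.
elim: n => [|n IH]; first by rewrite big_nil expr0 subrr mul0r.
by rewrite big_nat_recr//= IH exprS; field; rewrite gt_eqF.
Qed.

Lemma sum_geometric_rev_le (k : R) n : 0 <= k -> k < 1 ->
  \sum_(0 <= i < n.+1) k ^+ (n - i) <= (1 - k)^-1.
Proof.
move=> k0 k1; rewrite big_nat_rev/= add0n.
rewrite (eq_big_nat _ _ (F2 := fun i => k ^+ i)); last first.
  by move=> i /andP[_ ni]; rewrite subSS subKn.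
exact: sum_geometric_le.
Qed.

Lemma dyad_cvg0 (e : R) : 0 < e -> exists k, dyad k < e.
Proof.
move=> e0; have : dyad n @[n --> \oo] --> (0 : R).
  by apply: cvg_expr; rewrite ger0_norm// invf_lt1// ltr1n.
move=> /cvgrPdist_lt/(_ _ e0)[N _ /(_ N (leqnn N))].
rewrite /= sub0r normrN ger0_norm ?ltW ?dyad_gt0// => ?.
by exists N.
Qed.

(** m is the least index satisfying the first inequality; its minimality, or x <= h when m = 0, is
    the second one. *)
Lemma dyadic_scale (x h : R) : 0 < x -> x <= h ->
  exists m, h * dyad m.+1 < x <= h * dyad m.
Proof.
move=> x0 xh; have h0 : 0 < h by rewrite (lt_le_trans x0).
have ex : exists m, h * dyad m.+1 < x.
  have [m hm] := dyad_cvg0 (divr_gt0 x0 h0); exists m.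
  rewrite mulrC -ltr_pdivlMr//; apply: le_lt_trans hm.
  exact: dyad_le.
have [m hm mmin] := ex_minnP ex; exists m; rewrite hm/=.
case: m hm mmin => [_ _|m hm mmin]; first by rewrite dyad0 mulr1.
by rewrite leNgt; apply/negP => /mmin; rewrite ltnn.
Qed.

Lemma dyadB k n : (k <= n)%N -> dyad k = dyad n * 2 ^+ (n - k).
Proof.
move=> kn; have -> : dyad n = dyad k * dyad (n - k).
  by rewrite !dyadE -exprD subnKC.
by rewrite -mulrA dyadE -exprMn mulVf// expr1n mulr1.
Qed.

Section Weighted.
Variable r : R.
Hypothesis r0 : 0 < r.
(** kap^2 = 2^(-1/r) is the decay of d_k^(-1/r) as k moves down from n. One factor kap makes the
    weights summable; the other, raised to the power r, is 2^(-1/2) for every r, which is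
    [peel_ratio]. *)
Let kap : R := 2 `^ (- (2 * r)^-1).
Definition peel_ratio : R := 2 `^ (- 2^-1).
Definition peel_cst : R := (1 - kap)^-1 `^ r.

Let kap01 : 0 < kap < 1.
Proof.
rewrite /kap powR_gt0//= powRN invf_lt1 ?powR_gt0//.
have : (1 : R) `^ (2 * r)^-1 < 2 `^ (2 * r)^-1.
  by apply: gt0_ltr_powR; rewrite ?nnegrE ?ltr1n// invr_gt0 mulr_gt0.
by rewrite powR1.
Qed.

Lemma peel_ratio01 : 0 < peel_ratio < 1.
Proof.
rewrite /peel_ratio powR_gt0//= powRN invf_lt1 ?powR_gt0//.
have : (1 : R) `^ 2^-1 < 2 `^ 2^-1.
  by apply: gt0_ltr_powR; rewrite ?nnegrE ?ltr1n.
by rewrite powR1.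
Qed.

Lemma peel_cst_gt0 : 0 < peel_cst.
Proof. by have /andP[? ?] := kap01; rewrite powR_gt0// invr_gt0 subr_gt0. Qed.

(** The weights d_k^(-1/r) grow geometrically, so the sum is governed by its last scale n, with
    geometrically damped contributions of the earlier ones. *)
Lemma dyadic_partial_sum (y : nat -> R) n : (forall k, 0 <= y k) ->
  (\sum_(0 <= k < n.+1) dyad k `^ (- r^-1) * y k `^ r^-1) `^ r <=
  peel_cst * (dyad n)^-1 * \sum_(0 <= k < n.+1) peel_ratio ^+ (n - k) * y k.
Proof.
move=> y0; have /andP[k0 k1] := kap01.
have dn := @dyad_gt0 R n.
pose x k := kap ^+ (n - k) * (dyad n `^ (- r^-1) * y k `^ r^-1).
have x0 k : 0 <= x k by rewrite !mulr_ge0 ?powR_ge0// exprn_ge0// ltW.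
have w0 k : 0 <= kap ^+ (n - k) by rewrite exprn_ge0// ltW.
rewrite (eq_big_nat _ _ (F2 := fun k => kap ^+ (n - k) * x k)); last first.
  move=> k /andP[_ kn]; rewrite ltnS in kn.
  rewrite (dyadB kn) powRM ?exprn_ge0 ?(ltW dn)//.
  have -> : (2 ^+ (n - k)) `^ (- r^-1) = kap ^+ (n - k) * kap ^+ (n - k).
    rewrite -!powR_mulrn ?powR_ge0// -!powRrM -powRD; last by rewrite pnatr_eq0 implybT.
    by congr (_ `^ _); field; rewrite gt_eqF.
  by rewrite /x; ring.
apply: (le_trans (powR_sum_le _ r0 w0 x0)).
apply: (@le_trans _ _ (peel_cst * \sum_(0 <= k < n.+1) x k `^ r)).
  rewrite ler_wpM2r//; first by apply: sumr_ge0 => *; exact: powR_ge0.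
  apply: ge0_ler_powR; rewrite ?nnegrE ?(ltW r0)//; first exact: sumr_ge0.
    by rewrite invr_ge0 subr_ge0 ltW.
  by apply: sum_geometric_rev_le; rewrite // ltW.
rewrite -mulrA ler_wpM2l ?(ltW peel_cst_gt0)// mulr_sumr ler_sum// => k _.
rewrite le_eqVlt; apply/orP; left; apply/eqP.
rewrite /x powRM ?mulr_ge0 ?powR_ge0// powRM ?powR_ge0//.
rewrite -!powRrM mulVf ?gt_eqF// mulNr mulVf ?gt_eqF// powRr1// powR_inv1 ?(ltW dn)//.
have -> : (kap ^+ (n - k)) `^ r = peel_ratio ^+ (n - k).
  have e (a : R) m : (2 `^ a) ^+ m = 2 `^ (a * m%:R).
    by rewrite powRrM powR_mulrn// powR_ge0.
  rewrite /kap /peel_ratio !e -powRrM; congr (_ `^ _).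
  by move: ((n - k)%:R : R) => m; field; rewrite gt_eqF.
by ring.
Qed.

(** chi is the indicator of an initial segment of indices, and the term of its last index below N
    already dominates the left side. Keeping all n makes the right side linear in chi, hence easy to
    integrate when chi depends on a point of the circle. *)
Lemma initial_segment_sum (chi : nat -> bool) (y : nat -> R) N :
  (forall k, 0 <= y k) -> (forall k n, (k <= n)%N -> chi n -> chi k) ->
  (\sum_(0 <= k < N) (chi k)%:R * (dyad k `^ (- r^-1) * y k `^ r^-1)) `^ r <=
  \sum_(0 <= n < N) (chi n)%:R * (peel_cst * (dyad n)^-1 *
      \sum_(0 <= k < n.+1) peel_ratio ^+ (n - k) * y k).
Proof.
move=> y0 chiS; have /andP[p0 p1] := peel_ratio01.
have T0 n : 0 <= peel_cst * (dyad n)^-1 *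
      \sum_(0 <= k < n.+1) peel_ratio ^+ (n - k) * y k.
  apply: mulr_ge0.
    by apply: mulr_ge0; [exact/ltW/peel_cst_gt0|rewrite invr_ge0; exact/ltW/dyad_gt0].
  by apply: sumr_ge0 => k _; rewrite mulr_ge0// exprn_ge0// ltW.
elim: N => [|N IH]; first by rewrite !big_nil powR0// gt_eqF.
rewrite [leRHS]big_nat_recr//=.
have [cN|cN] := boolP (chi N); last first.
  by rewrite big_nat_recr//= (negPf cN) !mul0r !addr0.
rewrite mul1r; apply: (@le_trans _ _ (0 + peel_cst * (dyad N)^-1 *
      \sum_(0 <= k < N.+1) peel_ratio ^+ (N - k) * y k)); last first.
  by rewrite lerD2r; apply: sumr_ge0 => k _; rewrite mulr_ge0.
rewrite add0r (eq_big_nat _ _ (F2 := fun k => dyad k `^ (- r^-1) * y k `^ r^-1)).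
  exact: dyadic_partial_sum.
by move=> k /andP[_ kN]; rewrite (chiS _ _ _ cN)// mul1r.
Qed.

End Weighted.

End Peel.

(** * Chords of the unit circle *)

Section Trig.
Context {R : realType}.

Definition arc_cst : R := cos 1 / 2.
Lemma arc_cst_gt0 : 0 < arc_cst.
Proof. by rewrite divr_gt0// cos1_gt0. Qed.

(** On [0, 1] the derivative cos is at least cos 1. Beyond 1, sin x >= sin 1 >= cos 1, and x < 2
    accounts for the half in [arc_cst]. *)
Lemma sin_lower (x : R) : 0 <= x <= pi / 2 -> arc_cst * x <= sin x.
Proof.
move=> /andP[x0 x2]; have c0 := @cos1_gt0 R; rewrite /arc_cst.
have p2 := @pihalf_ge1 R; have p22 := @pihalf_lt2 R; have pp := @pi_ge2 R.
have small (t : R) : 0 <= t <= 1 -> cos 1 * t <= sin t.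
  move=> /andP[]; rewrite le_eqVlt => /predU1P[<- _|t0 t1]; first by rewrite sin0 mulr0.
  have [|c] := @MVT R sin cos 0 t t0.
    by apply: continuous_subspaceT => y; exact: continuous_sin.
  rewrite in_itv/= => /andP[c1 c2]; rewrite sin0 !subr0 => ->.
  rewrite ler_wpM2r ?(ltW t0)// ltW// ltr_cos ?in_itv/=; [lra|apply/andP; split; lra..].
have [x1|x1] := leP x 1.
  have := small x; rewrite x0 x1 => /(_ isT); have : 0 <= cos 1 * x by rewrite mulr_ge0// ltW.
  by lra.
have := small 1; rewrite ler01 lexx => /(_ isT) s1.
have : sin 1 <= sin x by apply/ltW; rewrite ltr_sin ?in_itv/=; [lra|apply/andP; split; lra..].
by nra.
Qed.

(** The chord has length 2 sin(t/2). Both ends of the parameter interval correspond to the point 1,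
    hence the minimum. *)
Lemma modc_expi_lower (t : R) : 0 <= t <= 2 * pi ->
  arc_cst * Num.min t (2 * pi - t) <= modc (1 - expi t).
Proof.
move=> /andP[t0 t2]; pose x := t / 2.
have tx : t = x *+ 2 by rewrite mulr2n /x; lra.
have sx : 0 <= sin x by apply: sin_ge0_pi; rewrite /x; apply/andP; split; lra.
have -> : modc (1 - expi t) = 2 * sin x.
  rewrite modcE /= sub0r tx cos_mulr2n sin_mulr2n.
  rewrite -[RHS](ger0_norm (mulr_ge0 _ sx))// -sqrtr_sqr; congr Num.sqrt.
  have -> : 1 - (cos x ^+ 2 *+ 2 - 1) = 2 * sin x ^+ 2.
    by rewrite cos2sin2 mulr2n; ring.
  rewrite sqrrN; have -> : ((cos x * sin x) *+ 2) ^+ 2 = 4 * (cos x ^+ 2 * sin x ^+ 2).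
    by rewrite mulr2n; ring.
  by rewrite cos2sin2; ring.
have c0 := arc_cst_gt0.
have [h|h] := leP x (pi / 2).
  have := @sin_lower x; rewrite h andbT divr_ge0// => /(_ isT).
  have : Num.min t (2 * pi - t) <= t by rewrite ge_min lexx.
  by rewrite /x; nra.
have := @sin_lower (pi - x); rewrite sinB sinpi cospi mul0r sub0r mulN1r opprK.
rewrite subr_ge0 => /(_ _) H.
have : Num.min t (2 * pi - t) <= 2 * pi - t by rewrite ge_min lexx orbT.
have /H : (x <= pi) && (pi - x <= pi / 2) by apply/andP; split; rewrite /x in h *; lra.
by rewrite /x; nra.
Qed.

End Trig.

(** * Area integrals over an approach region *)

Section UpperBound.
Context {R : realType}.
Local Notation dyad := (@dyad R).
Local Notation leb := (@lebesgue_measure R).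
Local Notation leb2 := (@lebesgue_measure R \x @lebesgue_measure R)%E.
Local Notation toC w := (w.1 +i* w.2)%C.

(** The inner sums satisfy a_{n+1} = c a_n + y_{n+1}; adding these up gives an identity whose extra
    term c a_N is nonnegative. *)
Lemma triangular_sum_le (c : R) (y : nat -> R) N : 0 <= c -> c < 1 ->
  (forall k, 0 <= y k) ->
  \sum_(0 <= n < N) \sum_(0 <= k < n.+1) c ^+ (n - k) * y k <=
  (1 - c)^-1 * \sum_(0 <= k < N) y k.
Proof.
move=> c0 c1 y0; have c2 : 0 < 1 - c by rewrite subr_gt0.
pose a n := \sum_(0 <= k < n.+1) c ^+ (n - k) * y k.
have a0 n : 0 <= a n by apply: sumr_ge0 => k _; rewrite mulr_ge0// exprn_ge0.
have aS n : a n.+1 = c * a n + y n.+1.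
  rewrite /a big_nat_recr//= subnn expr0 mul1r mulr_sumr; congr (_ + _).
  by apply: eq_big_nat => k /andP[_ kn]; rewrite subSn// exprS mulrA.
rewrite ler_pdivlMl//; case: N => [|N]; first by rewrite !big_nil mulr0.
suff <- : (1 - c) * (\sum_(0 <= n < N.+1) a n) + c * a N = \sum_(0 <= k < N.+1) y k.
  by rewrite lerDl mulr_ge0.
elim: N => [|N IH]; first by rewrite !big_nat1 /a big_nat1 subnn expr0; ring.
by rewrite big_nat_recr//= [RHS]big_nat_recr//= -IH aS; ring.
Qed.

Lemma nneseries_ge_term (u : nat -> \bar R) k : (forall n, (0 <= u n)%E) ->
  (u k <= \sum_(n <oo) u n)%E.
Proof.
move=> u0; apply: le_trans (nneseries_lim_ge (m := 0) k.+1 (fun n _ _ => u0 n)).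
rewrite big_nat_recr//=; rewrite -[X in (X <= _)%E]add0e.
by rewrite leeD2r//; apply: sume_ge0.
Qed.

Lemma sum_dyad_le (c : R) : 0 <= c -> (\sum_(m <oo) (c * dyad m)%:E <= (2 * c)%:E)%E.
Proof.
move=> c0; apply: nneseries_le_ub.
  by move=> n; rewrite lee_fin mulr_ge0// ltW// dyad_gt0.
move=> n; rewrite sumEFin lee_fin -mulr_sumr mulrC ler_wpM2r//.
have h : 0 <= 2^-1 :> R by rewrite invr_ge0.
have h1 : 2^-1 < 1 :> R by rewrite invf_lt1// ltr1n.
apply: (le_trans (sum_geometric_le n h h1)).
by have -> : (1 - 2^-1)^-1 = 2 :> R by [field].
Qed.

(** For z = (1 - s) w + s xi with |w| < 1/2, one has |z - xi| <= 3 (1 - s)/2 and 1 - |z| >= (1 -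
    s)/2: the approach is nontangential. *)
Lemma Gamma_half_dist (xi z : R[i]) : modc xi = 1 -> Gamma_half xi z ->
  modc (z - xi) <= 3 * (1 - modc z).
Proof.
move=> xi1 [[_ z2]|[w /= w2 [s]]].
  by have := modcD z (- xi); rewrite modcN xi1; lra.
rewrite /= in_itv/= => /andP[s0 s1] <-.
have s1' : 0 <= 1 - s by rewrite subr_ge0 ltW.
have sE : (1 - s%:C%C : R[i]) = (1 - s)%:C%C by rewrite rmorphB rmorph1.
have -> : (1 - s%:C%C) * w + s%:C%C * xi - xi = (1 - s%:C%C) * (w - xi) by ring.
have h1 : modc ((1 - s%:C%C) * (w - xi)) <= (1 - s) * (modc w + 1).
  rewrite modcM sE modc_real ger0_norm// ler_wpM2l//.
  by have := modcD w (- xi); rewrite modcN xi1.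
have h2 : modc ((1 - s%:C%C) * w + s%:C%C * xi) <= (1 - s) * modc w + s.
  apply: (le_trans (modcD _ _)).
  by rewrite !modcM sE !modc_real (ger0_norm s1') (ger0_norm s0) xi1 mulr1.
have := modc_ge0 w; nra.
Qed.

Definition box_at (xi : R[i]) (h : R) : set (R * R) :=
  `[complex.Re xi - h, complex.Re xi + h] `*` `[complex.Im xi - h, complex.Im xi + h].

Lemma measurable_box_at xi h : measurable (box_at xi h).
Proof. by apply: measurableX; exact: measurable_itv. Qed.

Lemma box_at_measure xi h : 0 < h -> (leb2 (box_at xi h) = (4 * h ^+ 2)%:E)%E.
Proof.
move=> h0; rewrite product_measure1E; [|exact: measurable_itv..].
rewrite /= !lebesgue_measure_itv/= !lte_fin !ifT; [|lra..].
by rewrite -!EFinB -EFinM; congr EFin; ring.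
Qed.

Lemma box_atP (xi : R[i]) h w : modc (toC w - xi) <= h -> box_at xi h w.
Proof.
move=> H; have := le_trans (Re_le_modc _) H; have := le_trans (Im_le_modc _) H.
rewrite !cReD !cImD !cReN !cImN/= !ler_norml => /andP[i1 i2] /andP[r1 r2].
by split; rewrite /= in_itv/=; apply/andP; split; lra.
Qed.

(** 1/pi normalizes the area, 4 * 6^2 is the area of a box of half-width 6, and 2 is the sum of all
    d_m. *)
Definition inner_cst : R := pi^-1 * (4 * 6 ^+ 2 * 2).

Lemma inner_cst_gt0 : 0 < inner_cst.
Proof.
apply: mulr_gt0; first by rewrite invr_gt0 pi_gt0.
by apply: mulr_gt0 => //; apply: mulr_gt0 => //; exact: exprn_gt0.
Qed.

(** A necessary condition for Gamma_{1/2}(xi) to reach scale k: |1 - z| <= 2 d_k there, and |z - xi|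
    <= 3 (1 - |z|) <= 6 d_k. *)
Definition near1 (xi : R[i]) (k : nat) : bool := modc (1 - xi) <= 8 * dyad k.

(** A second dyadic index m records that |z - xi| is of size 6 d_k d_m. There 1 - |z| > d_k d_m,
    while the box about xi has area 144 (d_k d_m)^2, so piece m contributes a multiple of d_k d_m
    u_k^p, and these sum geometrically over m. *)
Lemma inner_upper (p : R) (G : R[i] -> R[i]) (u : nat -> R) (xi : R[i]) :
  1 < p -> (forall k, 0 <= u k) -> modc xi = 1 ->
  (forall k z, modc z < 1 -> dyad k < modc (1 - z) <= 2 * dyad k -> modc (G z) <= u k) ->
  (area_integral (Gamma_half xi) (fun z => (modc (G z) `^ p / (1 - modc z ^+ 2))%R) <=
   \sum_(k <oo) ((near1 xi k)%:R * (inner_cst * (dyad k * u k `^ p)))%:E)%E.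
Proof.
move=> p1 u0 xi1 GU; have p0 : 0 < p by rewrite (lt_trans ltr01).
have d0 := @dyad_gt0 R.
pose c k m : R := (near1 xi k)%:R * (u k `^ p / (dyad m * dyad k)).
pose H k m (w : R * R) : \bar R :=
  ((c k m)%:E * (\1_(box_at xi (6 * dyad k * dyad m)) w : R)%:E)%E.
have c0 k m : 0 <= c k m.
  by rewrite /c mulr_ge0// divr_ge0 ?powR_ge0// mulr_ge0// ltW.
have H0 k m w : (0 <= H k m w)%E by rewrite mule_ge0// lee_fin.
have mi k m : measurable_fun setT (fun w : R * R =>
    (\1_(box_at xi (6 * dyad k * dyad m)) w : R)%:E).
  by apply/measurable_EFinP; apply: measurable_indic; exact: measurable_box_at.
have mH k m : measurable_fun setT (H k m).
  by apply: emeasurable_funM => //; exact: measurable_cst.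
pose HH k w := (\sum_(m <oo) H k m w)%E.
have HH0 k w : (0 <= HH k w)%E by apply: nneseries_ge0.
have mHH k : measurable_fun setT (HH k).
  by apply: ge0_emeasurable_sum => // m w _ _; exact: H0.
rewrite /area_integral.
have main : (\int[leb2]_(w in [set w : R * R | Gamma_half xi (toC w)])
    (modc (G (toC w)) `^ p / (1 - modc (toC w) ^+ 2))%:E <=
   \sum_(k <oo) ((near1 xi k)%:R * ((4 * 6 ^+ 2 * 2) * (dyad k * u k `^ p)))%:E)%E.
  apply: (@le_trans _ _ (\int[leb2]_w \sum_(k <oo) HH k w)%E).
    apply: ge0_le_integral_any => //.
    - move=> w /= /(Gamma_half_disc xi1) w1.
      by rewrite lee_fin divr_ge0 ?powR_ge0// subr_ge0 expr_le1 ?modc_ge0// ltW.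
    - by move=> w _; apply: nneseries_ge0.
    move=> w /= Gw; have w1 := Gamma_half_disc xi1 Gw.
    have dist := Gamma_half_dist xi1 Gw.
    set z := toC w in Gw w1 dist *.
    have z1 : 0 < modc (1 - z).
      rewrite modc_gt0 subr_eq0; apply: contraTneq w1 => <-.
      by rewrite modc1 ltxx.
    have z2 : modc (1 - z) <= 2.
      by have := modcD 1 (- z); rewrite modcN modc1; lra.
    (* The top scale is 2, the diameter of the disc, so the lower end 2 d_{k+1} is d_k. *)
    have [k /andP[k1 k2]] := dyadic_scale z1 z2.
    rewrite dyadS mulrCA mulfV ?mulr1// in k1.
    have zx : 0 < modc (z - xi).
      rewrite modc_gt0 subr_eq0; apply: contraTneq w1 => ->.
      by rewrite xi1 ltxx.
    have h1 : 1 - modc z <= modc (1 - z).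
      by have := modcB_ge 1 z; rewrite modc1.
    have zx6 : modc (z - xi) <= 6 * dyad k by lra.
    have [m /andP[m1 m2]] := dyadic_scale zx zx6.
    have nk : near1 xi k.
      rewrite /near1; have -> : 1 - xi = (1 - z) + (z - xi) by ring.
      by apply: (le_trans (modcD _ _)); lra.
    apply: le_trans (nneseries_ge_term k _) => //.
    apply: le_trans (nneseries_ge_term m _) => //.
    rewrite /H /c nk mul1r indicE (mem_set (box_atP m2)) mule1 lee_fin.
    have dk := d0 k; have dm := d0 m; have m0 := modc_ge0 z.
    apply: ler_pM.
    - exact: powR_ge0.
    - by rewrite invr_ge0 subr_ge0 expr_le1// ltW.
    - apply: ge0_ler_powR; rewrite ?nnegrE ?modc_ge0 ?(ltW p0)//.
      by apply: GU => //; rewrite k1.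
    rewrite lef_pV2 ?posrE; first last.
    - by rewrite mulr_gt0.
    - by rewrite subr_gt0 expr_lt1.
    rewrite dyadS in m1; nra.
  rewrite integral_nneseries//; apply: lee_nneseries => [k _ _|k _].
    by apply: integral_ge0.
  rewrite /HH integral_nneseries//; last exact: mH.
  have int1 m : (\int[leb2]_w H k m w =
      ((near1 xi k)%:R * (4 * 6 ^+ 2 * dyad k * u k `^ p) * dyad m)%:E)%E.
    have c0E : (0 <= (c k m)%:E)%E by rewrite lee_fin.
    rewrite /H ge0_integralZl//.
    rewrite integral_indic//; last exact: measurable_box_at.
    rewrite setIT /= box_at_measure ?mulr_gt0// -EFinM; congr EFin; rewrite /c.
      by field; rewrite !gt_eqF.
    exact: mi.
  rewrite (eq_eseriesr (fun m _ => int1 m)).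
  apply: le_trans (sum_dyad_le _) _.
    by rewrite !mulr_ge0// ?powR_ge0 ?(ltW (d0 k))// exprn_ge0.
  by rewrite lee_fin le_eqVlt; apply/orP; left; apply/eqP; ring.
apply: (@le_trans _ _ ((pi^-1)%:E * \sum_(k <oo) ((near1 xi k)%:R *
   ((4 * 6 ^+ 2 * 2) * (dyad k * u k `^ p)))%:E)%E).
  by apply: lee_wpmul2l => //; rewrite lee_fin invr_ge0 pi_ge0.
have e0 k : (0 <= ((near1 xi k)%:R * (4 * 6 ^+ 2 * 2 * (dyad k * u k `^ p)))%:E)%E.
  rewrite lee_fin; apply: mulr_ge0 => //; apply: mulr_ge0; last first.
    by apply: mulr_ge0; [exact: ltW|exact: powR_ge0].
  by apply: mulr_ge0 => //; apply: mulr_ge0 => //; exact: exprn_ge0.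
rewrite -nneseriesZl//; apply: lee_nneseries => [k _ _|k _].
  by apply: mule_ge0 => //; rewrite lee_fin invr_ge0 pi_ge0.
rewrite -EFinM lee_fin /inner_cst le_eqVlt; apply/orP; left; apply/eqP.
by move: (pi^-1 : R) => P; ring.
Qed.

End UpperBound.

(** * Integration over the circle *)

Section OuterBound.
Context {R : realType}.
Local Notation dyad := (@dyad R).
Local Notation near1 := (@near1 R).
Local Notation leb := (@lebesgue_measure R).

Lemma lee_poweR_inv (x y : \bar R) (r : R) : 0 < r -> (0 <= x)%E -> (0 <= y)%E ->
  (x <= poweR y r^-1)%E -> (poweR x r <= y)%E.
Proof.
move=> r0 x0 y0 xy.
have -> : y = poweR (poweR y r^-1) r by rewrite -poweRrM mulVf ?gt_eqF// poweRe1.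
exact: le_poweR.
Qed.

(** The scales allowed by [near1 xi] form an initial segment, so [initial_segment_sum] replaces the
    power q/p by an expression linear in the indicators. The n-th indicator lives on angles of total
    length at most 2 L d_n, which cancels the factor 1 / d_n, and a geometric convolution
    remains. *)
Lemma AT_upper (p q : R) : 1 < p -> 1 < q -> exists2 C : R, 0 < C &
  forall (G : R[i] -> R[i]) (u : nat -> R), (forall k, 0 <= u k) ->
    (forall k z, modc z < 1 -> dyad k < modc (1 - z) <= 2 * dyad k -> modc (G z) <= u k) ->
    (AT_pow p q G <=
     C%:E * \sum_(k <oo) ((dyad k `^ (p^-1 + q^-1) * u k) `^ q)%:E)%E.
Proof.
move=> p1 q1.
have p0 : 0 < p by rewrite (lt_trans ltr01).
have q0 : 0 < q by rewrite (lt_trans ltr01).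
pose r := q / p; have r0 : 0 < r by exact: divr_gt0.
pose rho := @peel_ratio R; have /andP[rho0 rho1] := @peel_ratio01 R.
(* |1 - xi| <= 8 d_n forces the angle to lie within L d_n of 0 or of 2 pi. *)
pose L : R := 8 / arc_cst; have L0 : 0 < L by rewrite divr_gt0// arc_cst_gt0.
pose K : R := inner_cst `^ r; have K0 : 0 < K by rewrite powR_gt0// inner_cst_gt0.
pose P : R := peel_cst r; have P0 : 0 < P by exact: peel_cst_gt0.
have KPL0 : 0 < K * P * (2 * L).
  by apply: mulr_gt0; [exact: mulr_gt0|exact: mulr_gt0].
exists (K * P * (2 * L) * (1 - rho)^-1).
  by apply: mulr_gt0 => //; rewrite invr_gt0 subr_gt0.
move=> G u u0 GU.
have d0 := @dyad_gt0 R.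
(* Since al p = 1 + p/q and 1/r = p/q, y_k^(1/r) = d_k^(1 + 1/r) u_k^p, which is the form required
   by [initial_segment_sum]. *)
pose y k := (dyad k `^ (p^-1 + q^-1) * u k) `^ q.
have y0 k : 0 <= y k by exact: powR_ge0.
have yE k : dyad k * u k `^ p = dyad k `^ (- r^-1) * y k `^ r^-1.
  rewrite /y -powRrM /r invf_div mulrCA divff ?gt_eqF// mulr1.
  rewrite powRM ?powR_ge0// -powRrM mulrA -powRD; last by apply/implyP => _; rewrite gt_eqF.
  congr (_ * _); rewrite -[LHS]powRr1 ?ltW//; congr (_ `^ _).
  by field; rewrite !gt_eqF.
pose B n := P * (dyad n)^-1 * \sum_(0 <= k < n.+1) rho ^+ (n - k) * y k.
have S0 n : 0 <= \sum_(0 <= k < n.+1) rho ^+ (n - k) * y k.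
  by apply: sumr_ge0 => k _; rewrite mulr_ge0// exprn_ge0// ltW.
have B0 n : 0 <= B n.
  apply: mulr_ge0 (S0 n); apply: mulr_ge0; first exact: ltW.
  by rewrite invr_ge0; exact: ltW.
have KBr n : 0 <= K * B n by exact: mulr_ge0 (ltW K0) (B0 n).
have cKB xi n : (0 <= ((near1 xi n)%:R * (K * B n))%:E)%E.
  by rewrite lee_fin; apply: mulr_ge0.
have nearS xi k n : (k <= n)%N -> near1 xi n -> near1 xi k.
  by move=> kn h; apply: (le_trans (h : _ <= 8 * dyad n)); rewrite ler_wpM2l// dyad_le.
pose T xi : \bar R := (\sum_(n <oo) ((near1 xi n)%:R * (K * B n))%:E)%E.
have T0 xi : (0 <= T xi)%E.
  exact: nneseries_ge0.
have inner xi : modc xi = 1 ->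
    (poweR (area_integral (Gamma_half xi)
      (fun z => (modc (G z) `^ p / (1 - modc z ^+ 2))%R)) r <= T xi)%E.
  move=> xi1; apply: lee_poweR_inv => //.
    rewrite mule_ge0 ?lee_fin ?invr_ge0 ?pi_ge0//.
    apply: integral_ge0 => w /= /(Gamma_half_disc xi1) w1.
    by rewrite lee_fin divr_ge0 ?powR_ge0// subr_ge0 expr_le1 ?modc_ge0// ltW.
  apply: (le_trans (inner_upper p1 u0 xi1 GU)).
  apply: nneseries_le_ub => [n|N].
    rewrite lee_fin; apply: mulr_ge0 => //; apply: mulr_ge0; first exact/ltW/inner_cst_gt0.
    by apply: mulr_ge0; [exact: ltW|exact: powR_ge0].
  rewrite sumEFin.
  pose s := \sum_(0 <= k < N) (near1 xi k)%:R * (dyad k `^ (- r^-1) * y k `^ r^-1).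
  have s0 : 0 <= s by apply: sumr_ge0 => k _; rewrite mulr_ge0// mulr_ge0 ?powR_ge0.
  have -> : \sum_(0 <= i < N) (near1 xi i)%:R * (inner_cst * (dyad i * u i `^ p)) =
      inner_cst * s.
    by rewrite /s mulr_sumr; apply: eq_bigr => k _; rewrite yE mulrCA.
  have is0 : 0 <= inner_cst * s by apply: mulr_ge0 => //; exact/ltW/inner_cst_gt0.
  have -> : (inner_cst * s)%:E = poweR ((inner_cst * s) `^ r)%:E r^-1.
    by rewrite poweR_EFin -powRrM mulfV ?gt_eqF// powRr1.
  apply: le_poweR; rewrite ?invr_gt0//; first by rewrite lee_fin powR_ge0.
  apply: (@le_trans _ _ (\sum_(0 <= n < N) ((near1 xi n)%:R * (K * B n))%:E)%E); last first.
    exact: nneseries_lim_ge.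
  rewrite sumEFin lee_fin powRM//; last exact/ltW/inner_cst_gt0.
  have := initial_segment_sum r0 N y0 (nearS xi).
  move=> /(ler_wpM2l (ltW K0)) h; apply: (le_trans h).
  rewrite mulr_sumr le_eqVlt; apply/orP; left; apply/eqP.
  by apply: eq_bigr => k _; rewrite mulrCA.
pose I1 n : set R := `[0, L * dyad n]%classic.
pose I2 n : set R := `[2 * pi - L * dyad n, 2 * pi]%classic.
have mI n : measurable (I1 n `|` I2 n).
  by apply: measurableU; exact: measurable_itv.
have muI n : (leb (I1 n `|` I2 n) <= (2 * L * dyad n)%:E)%E.
  have Ld : 0 < L * dyad n by exact: mulr_gt0.
  apply: le_trans (measureU2 _ _ _) _; [exact: measurable_itv..|].
  rewrite /= /I1 /I2 !lebesgue_measure_itv/= !lte_fin Ld ifT; last by lra.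
  by rewrite -!EFinB -EFinD lee_fin; lra.
rewrite /AT_pow /arc_integral.
have mind n : measurable_fun setT (fun t : R => (\1_(I1 n `|` I2 n) t : R)%:E).
  by apply/measurable_EFinP; exact: measurable_indic.
have KB0 n : (0 <= (K * B n)%:E)%E by rewrite lee_fin.
apply: (@le_trans _ _ (\int[leb]_t \sum_(n <oo) (K * B n)%:E * (\1_(I1 n `|` I2 n) t : R)%:E)%E).
  apply: ge0_le_integral_any => //.
  - by move=> t _; exact: poweR_ge0.
  - by move=> t _; apply: nneseries_ge0 => n _ _; rewrite mule_ge0// lee_fin.
  move=> t; rewrite /= in_itv/= => /andP[t0 t2].
  apply: (le_trans (inner _ (modc_expi t))).
  apply: lee_nneseries => [n _ _|n _]; first exact: cKB.
  rewrite -EFinM lee_fin mulrC ler_wpM2l//.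
  have [nr|_] := boolP (near1 _ _); last by [].
  rewrite indicE mem_set//.
  have h := modc_expi_lower (t := t); rewrite t0 (ltW t2) in h.
  have {h} h := le_trans (h isT) nr.
  have {h} : Num.min t (2 * pi - t) <= L * dyad n.
    by rewrite /L mulrAC ler_pdivlMr ?arc_cst_gt0// mulrC.
  rewrite ge_min => /orP[h|h]; [left|right]; rewrite /I1 /I2 /= in_itv/=.
    by rewrite t0.
  by rewrite (ltW t2) andbT; lra.
have KB1 n t : (0 <= (K * B n)%:E * (\1_(I1 n `|` I2 n) t : R)%:E)%E.
  by rewrite mule_ge0// lee_fin.
have mKB n : measurable_fun setT (fun t : R =>
    ((K * B n)%:E * (\1_(I1 n `|` I2 n) t : R)%:E)%E).
  by apply: emeasurable_funM => //; exact: measurable_cst.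
have /= -> := integral_nneseries leb measurableT mKB (fun n t _ => KB1 n t).
have term n : (\int[leb]_t ((K * B n)%:E * (\1_(I1 n `|` I2 n) t : R)%:E) <=
   (K * P * (2 * L) * \sum_(0 <= k < n.+1) rho ^+ (n - k) * y k)%:E)%E.
  rewrite ge0_integralZl//; last exact: mind.
  rewrite integral_indic ?setIT//; last exact: mI.
  apply: le_trans (lee_wpmul2l (KB0 n) (muI n)) _.
  rewrite -EFinM lee_fin /B le_eqVlt; apply/orP; left; apply/eqP.
  by field; rewrite gt_eqF.
apply: (@le_trans _ _ (\sum_(n <oo) (K * P * (2 * L) *
    \sum_(0 <= k < n.+1) rho ^+ (n - k) * y k)%:E)%E).
  apply: lee_nneseries => [n _ _|n _]; last exact: term.
  by apply: integral_ge0 => t _; exact: KB1.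
have KPL : 0 <= K * P * (2 * L) by exact: ltW.
apply: nneseries_le_ub => [n|N]; first by rewrite lee_fin mulr_ge0.
rewrite sumEFin -mulr_sumr.
have h := triangular_sum_le N (ltW rho0) rho1 y0.
apply: (@le_trans _ _ ((K * P * (2 * L) * (1 - rho)^-1)%:E * (\sum_(0 <= k < N) y k)%:E)%E).
  by rewrite -EFinM lee_fin -[leRHS]mulrA; exact: ler_wpM2l.
apply: lee_wpmul2l; first by rewrite lee_fin mulr_ge0// invr_ge0 subr_ge0 ltW.
rewrite -sumEFin; apply: nneseries_lim_ge => k _ _.
by rewrite lee_fin.
Qed.

End OuterBound.

(** * The integral operator *)

Section ComplexIntegral.
Context {R : realType}.
Variable mu : {measure set (measurableTypeR R) -> \bar R}.
Local Notation D := (`[0%R, 1%R[%classic : set (measurableTypeR R)).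
Implicit Types (F G : R -> R[i]).

Definition cmeas F : Prop :=
  measurable_fun D (fun t => complex.Re (F t)) /\
  measurable_fun D (fun t => complex.Im (F t)).

Definition cintegrable F : Prop :=
  cmeas F /\ (\int[mu]_(t in D) (modc (F t))%:E < +oo)%E.

Definition cint F : R[i] :=
  ((\int[mu]_(t in D) complex.Re (F t)) +i* (\int[mu]_(t in D) complex.Im (F t)))%C.

Lemma mD : measurable D. Proof. exact: measurable_itv. Qed.
Hint Resolve mD : core.

Lemma cmeasM F G : cmeas F -> cmeas G -> cmeas (fun t => F t * G t).
Proof.
move=> [fr fi] [gr gi]; split.
  apply: (eq_measurable_fun (fun t => complex.Re (F t) * complex.Re (G t) -
    complex.Im (F t) * complex.Im (G t))); first by move=> t _; rewrite cReM.
  by apply: measurable_funB; apply: measurable_funM.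
apply: (eq_measurable_fun (fun t => complex.Re (F t) * complex.Im (G t) +
    complex.Im (F t) * complex.Re (G t))); first by move=> t _; rewrite cImM.
by apply: measurable_funD; apply: measurable_funM.
Qed.

Lemma cmeasD F G : cmeas F -> cmeas G -> cmeas (fun t => F t + G t).
Proof.
move=> [fr fi] [gr gi]; split.
  apply: (eq_measurable_fun (fun t => complex.Re (F t) + complex.Re (G t))).
    by move=> t _; rewrite cReD.
  exact: measurable_funD.
apply: (eq_measurable_fun (fun t => complex.Im (F t) + complex.Im (G t))).
  by move=> t _; rewrite cImD.
exact: measurable_funD.
Qed.

Lemma cmeas_cst (c : R[i]) : cmeas (fun=> c).
Proof. by split; exact: measurable_cst. Qed.

Lemma cmeasX F n : cmeas F -> cmeas (fun t => F t ^+ n).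
Proof.
move=> mF; elim: n => [|n IH].
  rewrite (_ : (fun t => F t ^+ 0) = fun=> 1); first exact: cmeas_cst.
  by apply/funext => t; rewrite expr0.
rewrite (_ : (fun t => F t ^+ n.+1) = fun t => F t * F t ^+ n); first exact: cmeasM.
by apply/funext => t; rewrite exprS.
Qed.

Lemma measurable_modc_fun F : cmeas F -> measurable_fun D (fun t => modc (F t)).
Proof.
move=> [fr fi].
apply: (eq_measurable_fun (fun t =>
    (complex.Re (F t) ^+ 2 + complex.Im (F t) ^+ 2) `^ 2^-1)).
  by move=> t _; rewrite modcE powR12_sqrt// addr_ge0// sqr_ge0.
apply: (measurableT_comp (measurable_powR 2^-1)).
by apply: measurable_funD; apply: measurable_funX.
Qed.

Lemma ccont_cmeas (f : R[i] -> R[i]) :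
  (forall t : R, 0 <= t < 1 -> ccont f t%:C%C) -> cmeas (fun t => f t%:C%C).
Proof.
move=> fc.
have part (F : R[i] -> R) : (forall x y, `|F x - F y| <= modc (x - y)) ->
    measurable_fun D (fun t => F (f t%:C%C)).
  move=> HF; apply: subspace_continuous_measurable_fun => //.
  apply: continuous_in_subspaceT => t; rewrite inE /= in_itv/= => t01.
  have E : (fun t : R => F (f t%:C%C)) = (fun t : R => F (f (0 + t%:C%C * 1))).
    by apply/funext => x; rewrite add0r mulr1.
  rewrite E; apply: (@line_continuous _ F f) => //.
  by rewrite add0r mulr1; exact: fc.
split; apply: part => x y.
  by rewrite -cReN -cReD Re_le_modc.
by rewrite -cImN -cImD Im_le_modc.
Qed.

Lemma cintegrable_Re F : cintegrable F ->
  mu.-integrable D (EFin \o (fun t => complex.Re (F t))).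
Proof.
move=> [[fr fi] fin]; apply/integrableP; split; first exact/measurable_EFinP.
apply: le_lt_trans fin; apply: ge0_le_integral_any => //= t _.
  by rewrite lee_fin modc_ge0.
by rewrite lee_fin Re_le_modc.
Qed.

Lemma cintegrable_Im F : cintegrable F ->
  mu.-integrable D (EFin \o (fun t => complex.Im (F t))).
Proof.
move=> [[fr fi] fin]; apply/integrableP; split; first exact/measurable_EFinP.
apply: le_lt_trans fin; apply: ge0_le_integral_any => //= t _.
  by rewrite lee_fin modc_ge0.
by rewrite lee_fin Im_le_modc.
Qed.

Lemma cintegrableM F G (M : R) : cintegrable F -> cmeas G ->
  (forall t, 0 <= t < 1 -> modc (G t) <= M) -> cintegrable (fun t => F t * G t).
Proof.
move=> [mF fin] mG GM; split; first exact: cmeasM.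
have M0 : 0 <= M by apply: (le_trans (modc_ge0 _) (GM 0 _)); rewrite lexx ltr01.
have mm : measurable_fun D (fun t => (modc (F t))%:E).
  by apply/measurable_EFinP; exact: measurable_modc_fun.
apply: (@le_lt_trans _ _ (\int[mu]_(t in D) (M%:E * (modc (F t))%:E))%E).
  apply: ge0_le_integral_any => // t Dt.
  - by rewrite lee_fin modc_ge0.
  - by rewrite -EFinM lee_fin mulr_ge0// modc_ge0.
  - rewrite -EFinM lee_fin modcM mulrC ler_wpM2r ?modc_ge0// GM//.
have m0 t : D t -> (0 <= (modc (F t))%:E)%E by rewrite lee_fin modc_ge0.
have M1 : (0 <= M%:E)%E by rewrite lee_fin.
by rewrite ge0_integralZl// lte_mul_pinfty.
Qed.

Lemma cintegrableZ F (c : R[i]) : cintegrable F -> cintegrable (fun t => F t * c).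
Proof. by move=> iF; apply: (cintegrableM (M := modc c)) => //; exact: cmeas_cst. Qed.

Lemma cintD F G : cintegrable F -> cintegrable G ->
  cint (fun t => F t + G t) = cint F + cint G.
Proof.
move=> iF iG; apply: complexP => /=.
  rewrite -RintegralD//; [|exact: cintegrable_Re..].
  by apply: eq_Rintegral => t _; rewrite cReD.
rewrite -RintegralD//; [|exact: cintegrable_Im..].
by apply: eq_Rintegral => t _; rewrite cImD.
Qed.

Lemma cintZ F (c : R[i]) : cintegrable F -> cint (fun t => F t * c) = cint F * c.
Proof.
move=> iF; have rF := cintegrable_Re iF; have iiF := cintegrable_Im iF.
have Z (k : R) (u : R -> R) : mu.-integrable D (EFin \o u) ->
    mu.-integrable D (EFin \o (fun t => u t * k)).
  move=> iu; have := integrableZr mD k iu.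
  by apply: eq_integrable => // t _ /=; rewrite EFinM.
case: c => a b; apply: complexP => /=.
  rewrite -RintegralZr// -RintegralZr// -RintegralB//; [|exact: Z..].
  by apply: eq_Rintegral => t _; case: (F t).
rewrite -RintegralZr// -RintegralZr// -RintegralD//; [|exact: Z..].
by apply: eq_Rintegral => t _; case: (F t).
Qed.

Lemma eq_cint F G : (forall t, 0 <= t < 1 -> F t = G t) -> cint F = cint G.
Proof.
move=> FG; rewrite /cint; congr (_ +i* _)%C; apply: eq_Rintegral => t;
  by rewrite inE/= in_itv/= => /FG ->.
Qed.

(** The two components are bounded separately, whence the factor 2. *)
Lemma modc_cint_le F (B : R) : cintegrable F ->
  (\int[mu]_(t in D) (modc (F t))%:E <= B%:E)%E -> modc (cint F) <= 2 * B.
Proof.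
move=> iF FB; rewrite (le_trans (modc_le_ReIm _))//= mulr_natl mulr2n.
have part (u : R -> R) : mu.-integrable D (EFin \o u) ->
    (forall t, `|u t| <= modc (F t)) -> `|\int[mu]_(t in D) u t| <= B.
  move=> iu uF; apply: (le_trans (le_normr_Rintegral mD iu)).
  rewrite -lee_fin /Rintegral fineK; last first.
    have := integrable_norm iu; exact: integrable_fin_num.
  apply: le_trans FB; apply: ge0_le_integral_any => //= t _.
    by rewrite lee_fin modc_ge0.
  by rewrite lee_fin.
apply: lerD; apply: part.
- exact: cintegrable_Re.
- by move=> t; exact: Re_le_modc.
- exact: cintegrable_Im.
- by move=> t; exact: Im_le_modc.
Qed.

End ComplexIntegral.

(** * Analyticity of the image *)

Section IopAnalytic.
Context {R : realType}.
Variable mu : {measure set (measurableTypeR R) -> \bar R}.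
Local Notation dyad := (@dyad R).
Local Notation D := (`[0%R, 1%R[%classic : set (measurableTypeR R)).
Implicit Types (h : R[i] -> R[i]) (z a : R[i]).

Lemma ccont_inv (f : R[i] -> R[i]) z : f z != 0 -> ccont f z ->
  ccont (fun w => (f w)^-1) z.
Proof.
move=> fz0 fc e e0.
have m0 : 0 < modc (f z) by rewrite modc_gt0.
have [|d d0 Hd] := fc (Num.min (modc (f z) / 2) (e * modc (f z) ^+ 2 / 2)).
  by rewrite lt_min !divr_gt0// mulr_gt0// exprn_gt0.
exists d => // w /Hd; rewrite lt_min => /andP[h1 h2].
have h3 := modcB_ge (f z) (f w); rewrite modcB in h3.
have w0 : 0 < modc (f w) by lra.
have fw0 : f w != 0 by rewrite -modc_gt0.
have -> : (f w)^-1 - (f z)^-1 = (f z - f w) / (f w * f z) by field; rewrite fw0 fz0.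
rewrite modcM modcV modcM modcB ltr_pdivrMr ?mulr_gt0//.
apply: (lt_le_trans h2).
have : modc (f z) / 2 <= modc (f w) by lra.
move=> /(ler_wpM2r (ltW m0))/(ler_wpM2l (ltW e0)); apply: le_trans.
by rewrite le_eqVlt; apply/orP; left; apply/eqP; ring.
Qed.

Lemma modc_tz (t : R) z : 0 <= t < 1 -> modc (t%:C%C * z) <= modc z.
Proof.
move=> /andP[t0 t1]; rewrite modcM modc_real ger0_norm// ler_piMl ?modc_ge0//.
exact: ltW.
Qed.

(** The third bound follows from the second: |1 - z| <= |1 - t z| + (1 - t) |z| <= 2 |1 - t z|. It
    keeps the kernel controlled by the distance of z to 1 uniformly in t. *)
Lemma denom_ge (t : R) z : modc z < 1 -> 0 <= t < 1 ->
  [/\ 1 - modc z <= modc (1 - t%:C%C * z), 1 - t <= modc (1 - t%:C%C * z) &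
      modc (1 - z) / 2 <= modc (1 - t%:C%C * z)].
Proof.
move=> z1 t01; have h := modcB_ge 1 (t%:C%C * z); rewrite modc1 in h.
have h1 := modc_tz z t01; have /andP[t0 t1] := t01.
have m0 := modc_ge0 z.
have h2 : modc (t%:C%C * z) <= t.
  by rewrite modcM modc_real ger0_norm// ler_piMr// ltW.
have h3 : modc (1 - z) <= modc (1 - t%:C%C * z) + (1 - t) * modc z.
  have -> : 1 - z = (1 - t%:C%C * z) + - ((1 - t%:C%C) * z) by ring.
  apply: (le_trans (modcD _ _)); rewrite lerD2l modcN modcM.
  by rewrite -(rmorph1 (real_complex R)) -rmorphB modc_real ger0_norm// subr_ge0 ltW.
have h4 : (1 - t) * modc z <= 1 - t by nra.
by split; lra.
Qed.

Lemma denom_neq0 (t : R) z : modc z < 1 -> 0 <= t < 1 -> 1 - t%:C%C * z != 0.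
Proof.
move=> z1 t01; have [h _ _] := denom_ge z1 t01.
by rewrite -modc_gt0; lra.
Qed.

Lemma cmeas_inv_denom z : modc z < 1 -> cmeas (fun t : R => (1 - t%:C%C * z)^-1).
Proof.
move=> z1; apply: (@ccont_cmeas _ (fun w => (1 - w * z)^-1)) => t t01.
apply: ccont_inv; first exact: denom_neq0.
have -> : (fun w => 1 - w * z) = (fun w => 1 + - z * w).
  by apply/funext => w; rewrite mulNr mulrC.
apply: (@ccont_affine _ id) => e e0.
by exists e => // w.
Qed.

Lemma cmeas_id : cmeas (fun t : R => t%:C%C).
Proof.
by apply: (@ccont_cmeas _ id) => t _ e e0; exists e.
Qed.

Lemma I_kernel_cintegrable h z : modc z < 1 ->
  cintegrable mu (fun t => h t%:C%C) -> cintegrable mu (I_kernel h z).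
Proof.
move=> z1 ih; apply: (cintegrableM (M := (1 - modc z)^-1)) => //.
  exact: cmeas_inv_denom.
move=> t t01; rewrite modcV; have [h1 _ _] := denom_ge z1 t01.
by rewrite lef_pV2 ?posrE ?subr_gt0//; apply: lt_le_trans h1; rewrite subr_gt0.
Qed.

Lemma I_op_cint h z : I_op mu h z = cint mu (I_kernel h z).
Proof. by []. Qed.

Lemma I_opB f g z : modc z < 1 ->
  cintegrable mu (fun t => f t%:C%C) -> cintegrable mu (fun t => g t%:C%C) ->
  I_op mu f z - I_op mu g z = I_op mu (fun w => f w - g w) z.
Proof.
move=> z1 If Ig; rewrite !I_op_cint -mulrN1.
have jf := I_kernel_cintegrable z1 If; have jg := I_kernel_cintegrable z1 Ig.
rewrite -cintZ// -cintD//; last exact: cintegrableZ.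
by apply: eq_cint => t _; rewrite /I_kernel; ring.
Qed.

(** Expand 1 / (1 - t z) about a as a geometric series of ratio om(t) = t (z - a) / (1 - t a), of
    modulus at most 1/2 when |z - a| < (1 - |a|)/2. After n terms the remainder is exactly the
    integral of the kernel times om^n, so no interchange of sum and integral occurs. *)
Lemma I_op_analytic h : cintegrable mu (fun t => h t%:C%C) ->
  analytic_on_disc (I_op mu h).
Proof.
move=> ih a; rewrite /unit_disc/= => a1.
pose d := (1 - modc a) / 2; have d0 : 0 < d by rewrite divr_gt0// subr_gt0.
pose c n := cint mu (fun t => h t%:C%C * (t%:C%C ^+ n * (1 - t%:C%C * a)^-1 ^+ n.+1)).
apply/analytic_atP; exists c, d; split => // z zd.
have z1 : modc z < 1.
  have -> : z = (z - a) + a by rewrite subrK.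
  by apply: (le_lt_trans (modcD _ _)); rewrite /d in zd; lra.
have iz := I_kernel_cintegrable z1 ih.
pose om (t : R) := t%:C%C * (z - a) * (1 - t%:C%C * a)^-1.
have mom : cmeas om.
  apply: cmeasM; last exact: cmeas_inv_denom.
  by apply: cmeasM; [exact: cmeas_id|exact: cmeas_cst].
have om2 t : 0 <= t < 1 -> modc (om t) <= 2^-1.
  move=> t01; have [h1 _ _] := denom_ge a1 t01.
  rewrite modcM modcV ler_pdivrMr; last by apply: lt_le_trans h1; rewrite subr_gt0.
  have := modc_tz (z - a) t01; rewrite /d in zd; lra.
have iomn n : cintegrable mu (fun t => I_kernel h z t * om t ^+ n).
  apply: (cintegrableM (M := 2^-1 ^+ n)) => //; first exact: cmeasX.
  by move=> t t01; rewrite modcX lerXn2r ?nnegrE ?modc_ge0 ?om2.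
have icn n : cintegrable mu (fun t => h t%:C%C * (t%:C%C ^+ n * (1 - t%:C%C * a)^-1 ^+ n.+1)).
  apply: (cintegrableM (M := (1 - modc a)^-1 ^+ n.+1)) => //.
    by apply: cmeasM; apply: cmeasX; [exact: cmeas_id|exact: cmeas_inv_denom].
  move=> t t01; have [h1 _ _] := denom_ge a1 t01.
  have /andP[t0 t1] := t01.
  rewrite modcM !modcX modcV modc_real ger0_norm//.
  have p0 : 0 < modc (1 - t%:C%C * a) by apply: lt_le_trans h1; rewrite subr_gt0.
  apply: (@le_trans _ _ ((modc (1 - t%:C%C * a))^-1 ^+ n.+1)).
    by rewrite ler_piMl ?exprn_ge0 ?invr_ge0 ?modc_ge0// exprn_ile1// ltW.
  rewrite lerXn2r ?nnegrE ?invr_ge0 ?subr_ge0 ?(ltW a1) ?modc_ge0//.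
  by rewrite lef_pV2 ?posrE ?subr_gt0.
have tail n : I_op mu h z - \sum_(0 <= k < n) c k * (z - a) ^+ k =
    cint mu (fun t => I_kernel h z t * om t ^+ n).
  elim: n => [|n IH].
    rewrite big_nil subr0 I_op_cint; apply: eq_cint => t _.
    by rewrite expr0 mulr1.
  rewrite big_nat_recr//= opprD addrA IH /c -mulrN -cintZ// -cintD//; last first.
    exact: cintegrableZ.
  apply: eq_cint => t t01.
  have n1 := denom_neq0 z1 t01; have n2 := denom_neq0 a1 t01.
  rewrite /I_kernel /om !exprS !exprMn !exprVn.
  have n3 : (1 - t%:C%C * a) ^+ n != 0 by rewrite expf_neq0.
  set H := h t%:C%C; set T := t%:C%C in n1 n2 n3 *.
  set X := T ^+ n; set Y := (1 - T * a) ^+ n in n3 *; set Z := (z - a) ^+ n.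
  clearbody H X Y Z T.
  by field; rewrite n1 n2 n3.
pose B := fine (\int[mu]_(t in D) (modc (I_kernel h z t))%:E)%E.
have Bfin : (\int[mu]_(t in D) (modc (I_kernel h z t))%:E)%E = B%:E.
  rewrite /B fineK// ge0_fin_numE; first by case: iz.
  by apply: integral_ge0 => t _; rewrite lee_fin modc_ge0.
have B0 : 0 <= B.
  by rewrite -lee_fin -Bfin; apply: integral_ge0 => t _; rewrite lee_fin modc_ge0.
apply/has_csumP => e e0.
have B1 : 0 < 2 * B + 1 by lra.
have [N HN] := dyad_cvg0 (divr_gt0 e0 B1).
exists N => n /(dyad_le (R := R)) nN.
rewrite modcB tail.
have : modc (cint mu (fun t => I_kernel h z t * om t ^+ n)) <= 2 * (dyad n * B).
  apply: modc_cint_le => //; rewrite EFinM -Bfin.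
  have mk : measurable_fun D (fun t => (modc (I_kernel h z t))%:E).
    by apply/measurable_EFinP; apply: measurable_modc_fun; case: iz.
  have k0 t : D t -> (0 <= (modc (I_kernel h z t))%:E)%E by rewrite lee_fin modc_ge0.
  have dn0 : (0 <= (dyad n)%:E)%E by rewrite lee_fin ltW// dyad_gt0.
  rewrite -ge0_integralZl//.
  apply: ge0_le_integral_any => // t Dt.
  - by rewrite lee_fin modc_ge0.
  - by rewrite mule_ge0 ?k0.
  - rewrite -EFinM lee_fin modcM modcX mulrC ler_wpM2r ?modc_ge0//.
    by rewrite lerXn2r ?nnegrE ?modc_ge0 ?om2.
move=> /le_lt_trans; apply.
rewrite ltr_pdivlMr// in HN.
have := dyad_gt0 n (R := R); have := dyad_gt0 N (R := R); nra.
Qed.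

End IopAnalytic.

(** * The dyadic operator bound *)

Section Kernel.
Context {R : realType}.
Local Notation dyad := (@dyad R).

(** |j - k| in truncated subtraction: at most one summand is nonzero. *)
Definition natdist (j k : nat) : nat := ((k - j) + (j - k))%N.

Lemma natdistC j k : natdist j k = natdist k j.
Proof. by rewrite /natdist addnC. Qed.

Lemma sum_natdist_le (c : R) k N : 0 <= c -> c < 1 ->
  \sum_(0 <= j < N) c ^+ natdist j k <= 2 * (1 - c)^-1.
Proof.
move=> c0 c1.
apply: (@le_trans _ _ (\sum_(0 <= j < k.+1 + N) c ^+ natdist j k)).
  rewrite [leRHS](big_cat_nat _ (n := N))//=; last by rewrite leq_addl.
  by rewrite lerDl; apply: sumr_ge0 => j _; rewrite exprn_ge0.
rewrite (big_cat_nat _ (n := k.+1))//=; last by rewrite leq_addr.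
rewrite mulr_natl mulr2n; apply: lerD.
  rewrite (eq_big_nat _ _ (F2 := fun j => c ^+ (k - j))); first exact: sum_geometric_rev_le.
  by move=> j /andP[_]; rewrite ltnS => jk; rewrite /natdist (eqP jk) addn0.
rewrite (addnC k.+1 N) -[X in \sum_(X <= _ < _) _]add0n big_addn addnK.
apply: (@le_trans _ _ (\sum_(0 <= i < N) c ^+ i)); last exact: sum_geometric_le.
apply: ler_sum => i _.
apply: ler_wiXn2l; rewrite ?(ltW c1)//.
by rewrite /natdist (leq_trans _ (leq_addl _ _))// -addSnnS addnK leqnSn.
Qed.

Lemma powRXn (x s : R) n : 0 <= x -> (x ^+ n) `^ s = (x `^ s) ^+ n.
Proof.
move=> x0; elim: n => [|n IH]; first by rewrite !expr0 powR1.
by rewrite !exprS powRM ?exprn_ge0// IH.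
Qed.

Section Decay.
Variables (al : R).
Hypothesis al01 : 0 < al < 1.

(** The two decay rates off the diagonal. For j <= k the quotient is 1 and d_k^al = 2^(-al (k - j))
    d_j^al; for j > k it is d_j / d_k, and (d_j / d_k) d_k^al = 2^(-(1 - al) (j - k)) d_j^al. Both
    rates are below 1 exactly when 0 < al < 1. *)
Definition kernel_ratio : R := Num.max (2 `^ (- al)) (2 `^ (- (1 - al))).

Lemma kernel_ratio01 : 0 < kernel_ratio < 1.
Proof.
have /andP[a0 a1] := al01.
have lt1 (s : R) : 0 < s -> 2 `^ (- s) < 1.
  move=> s0; rewrite powRN invf_lt1 ?powR_gt0//.
  have : (1 : R) `^ s < 2 `^ s by apply: gt0_ltr_powR; rewrite ?nnegrE ?ltr1n.
  by rewrite powR1.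
by rewrite /kernel_ratio lt_max powR_gt0//= gt_max !lt1// subr_gt0.
Qed.

Lemma powR2XN (s : R) n : (2 ^+ n) `^ (- s) = (2 `^ (- s)) ^+ n.
Proof. exact: powRXn. Qed.

Lemma kernel_decay j k :
  dyad j / Num.max (dyad j) (dyad k) * dyad k `^ al <=
  kernel_ratio ^+ natdist j k * dyad j `^ al.
Proof.
have dj := @dyad_gt0 R j; have dk := @dyad_gt0 R k.
have [jk|kj] := leqP j k.
  rewrite (max_idPl (dyad_le jk)) divff ?gt_eqF// mul1r.
  have -> : natdist j k = (k - j)%N by rewrite /natdist (eqP jk) addn0.
  rewrite (dyadB jk) powRM ?exprn_ge0 ?(ltW dk)// mulrCA ler_peMr ?powR_ge0//.
  have -> : (2 ^+ (k - j)) `^ al = ((2 `^ (- al)) ^+ (k - j))^-1 :> R.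
    by rewrite -powR2XN powRN invrK.
  rewrite ler_pdivlMr ?exprn_gt0 ?powR_gt0// mul1r.
  apply: lerXn2r; rewrite ?nnegrE; first exact: powR_ge0.
    by have /andP[/ltW] := kernel_ratio01.
  by rewrite /kernel_ratio le_max lexx.
have jk := ltnW kj.
rewrite (max_idPr (dyad_le jk)).
have -> : natdist j k = (j - k)%N by rewrite /natdist (eqP jk).
rewrite (dyadB jk) powRM ?exprn_ge0 ?(ltW dj)//.
have e2 : 0 < 2 ^+ (j - k) :> R by rewrite exprn_gt0.
have -> : dyad j / (dyad j * 2 ^+ (j - k)) * (dyad j `^ al * (2 ^+ (j - k)) `^ al) =
   (2 ^+ (j - k)) `^ (- (1 - al)) * dyad j `^ al.
  rewrite opprB powRB; last by apply/implyP => _; rewrite gt_eqF.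
  rewrite powRr1 ?(ltW e2)//; move: e2; move: (2 ^+ (j - k)) (_ `^ al) (_ `^ al) => E X Y E0.
  by field; rewrite !gt_eqF.
rewrite powR2XN; apply: ler_wpM2r; first exact: powR_ge0.
apply: lerXn2r; rewrite ?nnegrE; first exact: powR_ge0.
  by have /andP[/ltW] := kernel_ratio01.
by rewrite /kernel_ratio le_max lexx orbT.
Qed.

Variable q : R.
Hypothesis q0 : 0 < q.
(** The square root of the decay is spent on summable weights; the other root, raised to the power
    q, becomes the ratio of the remaining kernel. *)
Let kap : R := kernel_ratio `^ 2^-1.
Definition kernel_lam : R := kap `^ q.
Definition kernel_cst : R := (2 * (1 - kap)^-1) `^ q.

Let kap01 : 0 < kap < 1.
Proof.
have /andP[a0 a1] := kernel_ratio01; rewrite /kap powR_gt0//=.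
have : kernel_ratio `^ 2^-1 < 1 `^ 2^-1.
  by apply: gt0_ltr_powR; rewrite ?nnegrE// ltW.
by rewrite powR1.
Qed.

Lemma kernel_lam01 : 0 < kernel_lam < 1.
Proof.
have /andP[a0 a1] := kap01; rewrite /kernel_lam powR_gt0//=.
have : kap `^ q < 1 `^ q by apply: gt0_ltr_powR; rewrite ?nnegrE// ltW.
by rewrite powR1.
Qed.

Lemma kernel_cst_ge0 : 0 <= kernel_cst.
Proof. exact: powR_ge0. Qed.

Lemma kernel_sum_le (x : nat -> R) k N : (forall j, 0 <= x j) ->
  (\sum_(0 <= j < N) kernel_ratio ^+ natdist j k * x j) `^ q <=
  kernel_cst * \sum_(0 <= j < N) kernel_lam ^+ natdist j k * x j `^ q.
Proof.
move=> x0; have /andP[a0 a1] := kap01; have /andP[/ltW b0 _] := kernel_ratio01.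
have w0 j : 0 <= kap ^+ natdist j k by rewrite exprn_ge0// ltW.
have kE n : kernel_ratio ^+ n = kap ^+ n * kap ^+ n.
  rewrite -exprMn; congr (_ ^+ n); rewrite -expr2 -powR_mulrn ?powR_ge0//.
  by rewrite -powRrM mulVf// powRr1.
under eq_bigr do rewrite kE -mulrA.
apply: (le_trans (powR_sum_le _ q0 w0 (fun j => mulr_ge0 (w0 j) (x0 j)))).
apply: ler_pM.
- exact: powR_ge0.
- by apply: sumr_ge0 => *; exact: powR_ge0.
- apply: ge0_ler_powR; rewrite ?nnegrE ?(ltW q0)//; first exact: sumr_ge0.
    by rewrite mulr_ge0// invr_ge0 subr_ge0 ltW.
  by apply: sum_natdist_le => //; rewrite ltW.
apply: ler_sum => j _; rewrite powRM// /kernel_lam.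
rewrite le_eqVlt; apply/orP; left; apply/eqP; congr (_ * _).
exact: powRXn (ltW a0).
Qed.

End Decay.

Lemma nneseries_natdist_le (c : R) (w : nat -> R) : 0 <= c -> c < 1 ->
  (forall j, 0 <= w j) ->
  (\sum_(k <oo) \sum_(j <oo) (c ^+ natdist j k * w j)%:E <=
   (2 * (1 - c)^-1)%:E * \sum_(j <oo) (w j)%:E)%E.
Proof.
move=> c0 c1 w0; have t0 j k : (0 <= (c ^+ natdist j k * w j)%:E)%E.
  by rewrite lee_fin mulr_ge0// exprn_ge0.
rewrite nneseries_interchange//.
rewrite -nneseriesZl; last by move=> j _; rewrite lee_fin.
apply: lee_nneseries => [j _ _|j _]; first exact: nneseries_ge0.
apply: nneseries_le_ub => // N; rewrite sumEFin -EFinM lee_fin -mulr_suml.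
rewrite ler_wpM2r//; under eq_bigr do rewrite natdistC.
exact: sum_natdist_le.
Qed.

End Kernel.

(** * The operator on dyadically majorized functions *)

Section OperatorBound.
Context {R : realType}.
Local Notation dyad := (@dyad R).

(** The Carleson ratio at 1 - d_j as a real number; [fine] is faithful when mu is finite. *)
Definition carleson_eps (mu : set (measurableTypeR R) -> \bar R) (j : nat) : R :=
  fine (mu `[1 - dyad j, 1[%classic) / dyad j.

Lemma carleson_eps_ge0 (mu : {measure set (measurableTypeR R) -> \bar R}) j :
  0 <= carleson_eps mu j.
Proof. by apply: divr_ge0; [exact: fine_ge0|exact/ltW/dyad_gt0]. Qed.

Definition dyadic_bound (h : R[i] -> R[i]) (u : nat -> R) : Prop :=
  forall j (t : R), 1 - dyad j <= t < 1 - dyad j.+1 -> modc (h t%:C%C) <= u j.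

(** h is merely measurable along the radius with a majorant u: besides elements of AT, the bound
    serves for constants, for the ultralimit and for differences with it. C is chosen before mu, so
    that it also applies uniformly to Dirac masses. *)
Lemma I_op_bound (p q : R) : 1 < p -> 1 < q -> p^-1 + q^-1 < 1 ->
  exists2 C : R, 0 < C &
  forall (mu : {finite_measure set (measurableTypeR R) -> \bar R}) h u,
    (forall j, 0 <= u j) -> cmeas (fun t => h t%:C%C) -> dyadic_bound h u ->
    (\sum_(j <oo) ((carleson_eps mu j * (dyad j `^ (p^-1 + q^-1) * u j)) `^ q)%:E < +oo)%E ->
    [/\ forall z, modc z < 1 -> I_converges mu h z,
        cintegrable mu (fun t => h t%:C%C) &
        (AT_pow p q (I_op mu h) <= C%:E *
      \sum_(j <oo) ((carleson_eps mu j * (dyad j `^ (p^-1 + q^-1) * u j)) `^ q)%:E)%E].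
Proof.
move=> p1 q1 pq; set al := p^-1 + q^-1.
have p0 : 0 < p by rewrite (lt_trans ltr01).
have q0 : 0 < q by rewrite (lt_trans ltr01).
have al01 : 0 < al < 1 by rewrite pq addr_gt0 ?invr_gt0.
have [CU CU0 HU] := AT_upper p1 q1.
pose lam := kernel_lam al q; pose Ck := kernel_cst al q.
have /andP[lam0 lam1] := kernel_lam01 al01 q0.
have Ck0 : 0 <= Ck by exact: kernel_cst_ge0.
(* 4 = 2 * 2: one factor from the lower bound on the denominator, one from splitting the integral
   into components. *)
pose C1 := 4 `^ q * Ck; have C10 : 0 <= C1 by rewrite mulr_ge0// powR_ge0.
have l10 : 0 <= 2 * (1 - lam)^-1 by rewrite mulr_ge0// invr_ge0 subr_ge0 ltW.
exists (CU * (C1 * (2 * (1 - lam)^-1)) + 1).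
  by rewrite ltr_wpDl// mulr_ge0 ?(ltW CU0)// mulr_ge0.
move=> mu h u u0 mh hu Wfin.
have d0 := @dyad_gt0 R.
pose eps := carleson_eps mu; have e0 j : 0 <= eps j by exact: carleson_eps_ge0.
pose x j := eps j * (dyad j `^ al * u j).
have x0 j : 0 <= x j by apply: mulr_ge0 => //; apply: mulr_ge0 => //; exact: powR_ge0.
pose w j := x j `^ q; have w0 j : 0 <= w j by exact: powR_ge0.
have lw0 j k : 0 <= lam ^+ natdist j k * w j by rewrite mulr_ge0// exprn_ge0// ltW.
have SW k : (\sum_(j <oo) (lam ^+ natdist j k * w j)%:E < +oo)%E.
  apply: le_lt_trans Wfin; apply: lee_nneseries => [j _ _|j _]; rewrite lee_fin//.
  by rewrite ler_piMl// exprn_ile1// ltW.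
have Sge k : (0 <= \sum_(j <oo) (lam ^+ natdist j k * w j)%:E)%E.
  by apply: nneseries_ge0 => j _ _; rewrite lee_fin.
pose S k := fine (\sum_(j <oo) (lam ^+ natdist j k * w j)%:E)%E.
have SE k : (\sum_(j <oo) (lam ^+ natdist j k * w j)%:E)%E = (S k)%:E.
  by rewrite /S fineK// ge0_fin_numE.
have S0 k : 0 <= S k by rewrite -lee_fin -SE.
pose B k := 2 * (dyad k `^ (- al) * (Ck * S k) `^ q^-1).
have B0 k : 0 <= B k by apply: mulr_ge0 => //; apply: mulr_ge0; exact: powR_ge0.
pose I j : set (measurableTypeR R) := `[1 - dyad j, 1 - dyad j.+1[%classic.
have mI j : measurable (I j) by exact: measurable_itv.
have muI j : (mu (I j) <= (eps j * dyad j)%:E)%E.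
  rewrite /eps /carleson_eps divfK ?gt_eqF// fineK; last first.
    by apply: fin_num_measure; exact: measurable_itv.
  apply: le_measure; [exact: mem_set (mI j)|apply: mem_set; exact: measurable_itv|].
  move=> t; rewrite /I /= !in_itv/= => /andP[-> /= t1].
  by apply: (lt_trans t1); rewrite gtrBl.
have bound k z : modc z < 1 -> dyad k < modc (1 - z) <= 2 * dyad k ->
    (\int[mu]_(t in `[0%R, 1%R[) (modc (I_kernel h z t))%:E <= (B k)%:E)%E.
  move=> z1 /andP[k1 k2].
  pose c j := 2 * u j / Num.max (dyad j) (dyad k).
  have mx j : 0 < Num.max (dyad j) (dyad k) by rewrite lt_max d0.
  have c0 j : 0 <= c j by rewrite divr_ge0 ?mulr_ge0// ltW.
  have mi j : measurable_fun setT (fun t : measurableTypeR R => (\1_(I j) t : R)%:E).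
    by apply/measurable_EFinP; exact: measurable_indic.
  have ci0 j t : (0 <= (c j)%:E * (\1_(I j) t : R)%:E)%E by rewrite mule_ge0// lee_fin.
  apply: (@le_trans _ _ (\int[mu]_t \sum_(j <oo) ((c j)%:E * (\1_(I j) t : R)%:E))%E).
    apply: ge0_le_integral_any => //.
    - by move=> t _; rewrite lee_fin modc_ge0.
    - by move=> t _; exact: nneseries_ge0.
    move=> t; rewrite /= in_itv/= => t01; have /andP[t0 t1] := t01.
    have s0 : 0 < 1 - t by rewrite subr_gt0.
    have s1 : 1 - t <= 1 by rewrite gerBl.
    have [j /andP[j1 j2]] := dyadic_scale s0 s1; rewrite !mul1r in j1 j2.
    have tj : 1 - dyad j <= t < 1 - dyad j.+1 by apply/andP; split; lra.
    apply: le_trans (nneseries_ge_term j _) => //.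
    rewrite indicE mem_set; last by rewrite /I /= in_itv.
    rewrite mule1 lee_fin /c modcM modcV.
    have [_ h2 h3] := denom_ge z1 t01.
    (* 1 - t > d_j / 2 because t lies in cell j, and |1 - t z| >= |1 - z| / 2 > d_k / 2. *)
    have hm : Num.max (dyad j) (dyad k) / 2 <= modc (1 - t%:C%C * z).
      have [_|_] := leP (dyad j) (dyad k); first by lra.
      by rewrite -dyadS ltW// (lt_le_trans j1).
    have m2 : 0 < Num.max (dyad j) (dyad k) / 2 by rewrite divr_gt0.
    have -> : 2 * u j / Num.max (dyad j) (dyad k) = u j * (Num.max (dyad j) (dyad k) / 2)^-1.
      by rewrite invf_div; ring.
    apply: ler_pM; rewrite ?modc_ge0 ?invr_ge0 ?modc_ge0//; first exact: hu.
    by rewrite lef_pV2 ?posrE// (lt_le_trans m2).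
  have mci j : measurable_fun setT (fun t : measurableTypeR R =>
      ((c j)%:E * (\1_(I j) t : R)%:E)%E).
    by apply: emeasurable_funM => //; exact: measurable_cst.
  have /= -> := integral_nneseries mu measurableT mci (fun j t _ => ci0 j t).
  have term j : (\int[mu]_t ((c j)%:E * (\1_(I j) t : R)%:E) <=
      (2 * (dyad k `^ (- al)) * (kernel_ratio al ^+ natdist j k * x j))%:E)%E.
    have cE : (0 <= (c j)%:E)%E by rewrite lee_fin.
    rewrite ge0_integralZl//.
    rewrite integral_indic ?setIT//.
    apply: le_trans (lee_wpmul2l cE (muI j)) _.
    rewrite -EFinM lee_fin.
    have := kernel_decay al01 j k.
    have dka : 0 < dyad k `^ al by rewrite powR_gt0.
    have ue : 0 <= 2 * u j * eps j / dyad k `^ al.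
      apply: mulr_ge0; last by rewrite invr_ge0 powR_ge0.
      by apply: mulr_ge0 => //; exact: mulr_ge0.
    move=> /(ler_wpM2l ue); rewrite powRN /c /x.
    have := mx j; move: (Num.max _ _) => M M0.
    move: (dyad k `^ al) dka (dyad j `^ al) (kernel_ratio al ^+ _) => D D0 J Q.
    have -> : 2 * u j * eps j / D * (dyad j / M * D) = 2 * u j / M * (eps j * dyad j).
      by field; rewrite !gt_eqF.
    have -> // : 2 * u j * eps j / D * (Q * J) = 2 / D * (Q * (eps j * (J * u j))).
    by ring.
  apply: (@le_trans _ _ (\sum_(j <oo) (2 * (dyad k `^ (- al)) *
      (kernel_ratio al ^+ natdist j k * x j))%:E)%E).
    apply: lee_nneseries => [j _ _|j _]; last exact: term.
    by apply: integral_ge0 => t _; exact: ci0.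
  have /andP[/ltW kr0 _] := kernel_ratio01 al01.
  have kx0 j : 0 <= kernel_ratio al ^+ natdist j k * x j by rewrite mulr_ge0// exprn_ge0.
  have dk2 : 0 <= 2 * dyad k `^ (- al) by rewrite mulr_ge0// powR_ge0.
  apply: nneseries_le_ub => [j|N]; first by rewrite lee_fin mulr_ge0.
  rewrite sumEFin lee_fin -mulr_sumr /B mulrA ler_wpM2l//.
  have s0 : 0 <= \sum_(0 <= j < N) kernel_ratio al ^+ natdist j k * x j by exact: sumr_ge0.
  rewrite -[leLHS]powRr1// -[1](mulfV (lt0r_neq0 q0)) powRrM.
  apply: ge0_ler_powR; rewrite ?nnegrE ?powR_ge0 ?invr_ge0 ?(ltW q0)//.
    by rewrite mulr_ge0.
  apply: (le_trans (kernel_sum_le al01 q0 k N x0)); rewrite ler_wpM2l//.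
  rewrite -lee_fin -SE -sumEFin; apply: nneseries_lim_ge => j _ _.
  by rewrite lee_fin lw0.
have scale z : modc z < 1 -> exists k, dyad k < modc (1 - z) <= 2 * dyad k.
  move=> z1; have z0 : 0 < modc (1 - z).
    by have := modcB_ge 1 z; rewrite modc1; lra.
  have z2 : modc (1 - z) <= 2.
    by have := modcD 1 (- z); rewrite modcN modc1; lra.
  have [k /andP[k1 k2]] := dyadic_scale z0 z2; exists k.
  by rewrite dyadS mulrCA mulfV ?mulr1// in k1; rewrite k1.
have conv z : modc z < 1 -> I_converges mu h z.
  move=> z1; have [k kz] := scale z z1.
  by apply: le_lt_trans (bound k z z1 kz) _; rewrite ltry.
have ih : cintegrable mu (fun t => h t%:C%C).
  (* At z = 0 the kernel is h itself, so absolute convergence there is integrability of h. *)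
  split => //; have := conv 0; rewrite modc0 ltr01 => /(_ isT).
  by rewrite /I_converges /I_kernel; under eq_integral do rewrite mulr0 subr0 divr1.
split => //.
have AE k : (dyad k `^ al * (2 * B k)) `^ q = C1 * S k.
  have -> : dyad k `^ al * (2 * B k) = 4 * (Ck * S k) `^ q^-1.
    rewrite /B powRN; have := powR_gt0 al (d0 k); move: (_ `^ al) => D D0.
    by field; rewrite gt_eqF.
  rewrite powRM ?powR_ge0// -powRrM mulVf ?gt_eqF// powRr1 ?mulr_ge0//.
  by rewrite mulrA.
apply: (le_trans (HU (I_op mu h) (fun k => 2 * B k) _ _)).
- by move=> k; rewrite mulr_ge0.
- move=> k z z1 kz; rewrite I_op_cint; apply: modc_cint_le; first exact: I_kernel_cintegrable.
  exact: bound kz.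
under eq_eseriesr do rewrite AE.
have -> : (\sum_(k <oo) (C1 * S k)%:E = C1%:E * \sum_(k <oo) (S k)%:E)%E.
  by rewrite -nneseriesZl//; by move=> k _; rewrite lee_fin.
under eq_eseriesr do rewrite -SE.
have h1 := nneseries_natdist_le (ltW lam0) lam1 w0.
have WE : (0 <= \sum_(j <oo) (w j)%:E)%E by apply: nneseries_ge0 => j _ _; rewrite lee_fin.
apply: (@le_trans _ _ ((CU * (C1 * (2 * (1 - lam)^-1)))%:E * \sum_(j <oo) (w j)%:E)%E).
  have E3 (X : \bar R) : ((CU * (C1 * (2 * (1 - lam)^-1)))%:E * X =
      CU%:E * (C1%:E * ((2 * (1 - lam)^-1)%:E * X)))%E.
    by rewrite !EFinM -!muleA.
  rewrite E3; apply: lee_wpmul2l; first by rewrite lee_fin ltW.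
  by apply: lee_wpmul2l; rewrite ?lee_fin.
apply: lee_wpmul2r => //.
by rewrite lee_fin lerDl.
Qed.

End OperatorBound.

(** * Carleson measures and boundedness *)

Lemma le_powR_inv {R : realType} (r x y : R) : 0 < r -> 0 <= x ->
  x `^ r <= y -> x <= y `^ r^-1.
Proof.
move=> r0 x0 xy.
have -> : x = (x `^ r) `^ r^-1 by rewrite -powRrM mulfV ?gt_eqF// powRr1.
apply: ge0_ler_powR => //; first by rewrite invr_ge0 ltW.
- by rewrite nnegrE powR_ge0.
- by rewrite nnegrE (le_trans _ xy)// powR_ge0.
Qed.

(** * The AT norm and its dyadic majorants *)

Section ATFacts.
Context {R : realType}.
Local Notation dyad := (@dyad R).
Variables (p q : R).
Hypotheses (p1 : 1 < p) (q1 : 1 < q).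
Let al : R := p^-1 + q^-1.

Let q0 : 0 < q. Proof. exact: lt_trans ltr01 q1. Qed.

Lemma AT_normE (f : R[i] -> R[i]) : AT_norm p q f = poweR (AT_pow p q f) q^-1.
Proof. by []. Qed.

Lemma AT_powE f : AT_pow p q f = poweR (AT_norm p q f) q.
Proof. by rewrite AT_normE -poweRrM mulVf ?gt_eqF// poweRe1// AT_pow_ge0. Qed.

Lemma AT_norm_ge0 f : (0 <= AT_norm p q f)%E.
Proof. exact: poweR_ge0. Qed.

Lemma AT_norm_lty f : (AT_norm p q f < +oo)%E <-> (AT_pow p q f < +oo)%E.
Proof.
split; first by rewrite AT_powE; exact: poweR_lty.
by rewrite AT_normE; exact: poweR_lty.
Qed.

Lemma AT_pow_ext (f g : R[i] -> R[i]) : (forall z, modc z < 1 -> f z = g z) ->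
  AT_pow p q f = AT_pow p q g.
Proof.
move=> fg; rewrite /AT_pow /arc_integral; apply: eq_integral => t _.
suff E : area_integral (Gamma_half (expi t)) (fun z => modc (f z) `^ p / (1 - modc z ^+ 2)) =
    area_integral (Gamma_half (expi t)) (fun z => modc (g z) `^ p / (1 - modc z ^+ 2)).
  by rewrite E.
rewrite /area_integral; congr (_ * _)%E; apply: eq_integral => w; rewrite inE/= => /Gamma_half_disc.
by rewrite modc_expi => /(_ erefl)/fg ->.
Qed.

Lemma AT_norm_ext (f g : R[i] -> R[i]) : (forall z, modc z < 1 -> f z = g z) ->
  AT_norm p q f = AT_norm p q g.
Proof. by move=> fg; rewrite !AT_normE (AT_pow_ext fg). Qed.

Lemma AT_norm_le_pow f (K : R) : 0 <= K ->
  (AT_norm p q f <= K%:E)%E -> (AT_pow p q f <= (K `^ q)%:E)%E.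
Proof.
by move=> K0 h; rewrite AT_powE -poweR_EFin; apply: le_poweR => //; exact: AT_norm_ge0.
Qed.

Lemma analytic_ccont (f : R[i] -> R[i]) (z : R[i]) : analytic_on_disc f -> modc z < 1 -> ccont f z.
Proof.
move=> /analytic_C1[f' H] z1; have [h _] := H z z1; exact: cderiv_ccont h.
Qed.

Lemma modc_real_lt1 (t : R) : 0 <= t < 1 -> modc t%:C%C < 1.
Proof. by move=> /andP[t0 t1]; rewrite modc_real ger0_norm. Qed.

Lemma analytic_cmeas (f : R[i] -> R[i]) : analytic_on_disc f -> cmeas (fun t : R => f t%:C%C).
Proof.
by move=> fa; apply: ccont_cmeas => t /modc_real_lt1; exact: analytic_ccont.
Qed.

Lemma dyadic_core_real j (t : R) : 1 - dyad j <= t < 1 - dyad j.+1 ->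
  dyadic_core j t%:C%C.
Proof.
rewrite dyadS => /andP[t1 t2]; have d0 := @dyad_gt0 R j.
split => /=; first by rewrite normr0 divr_ge0// ltW.
by apply/andP; split; lra.
Qed.

Lemma dyadic_core_left j : dyadic_core j (1 - dyad j)%:C%C.
Proof.
apply: dyadic_core_real; rewrite lexx dyadS/=.
by have := @dyad_gt0 R j; lra.
Qed.

(** A finite norm makes the bounds b_k of [AT_lower] finite, and u_k solves (d_k^al u_k)^q = b_k. It
    majorizes f on complex neighbourhoods of the cells, as the Cauchy estimates require, not just on
    the radius. *)
Lemma AT_sequence : exists2 C : R, 0 < C & forall f, analytic_on_disc f ->
  (AT_pow p q f < +oo)%E -> exists u : nat -> R,
    [/\ forall k, 0 <= u k, forall k z, dyadic_core k z -> modc (f z) <= u k &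
      (\sum_(k <oo) ((dyad k `^ al * u k) `^ q)%:E <= C%:E * AT_pow p q f)%E].
Proof.
have [C C0 H] := AT_lower p1 q1; exists C => // f fa ffin.
have [b [b0 bz bs]] := H f fa.
have d0 := @dyad_gt0 R; have da k : 0 < dyad k `^ al by rewrite powR_gt0.
have bfin k : b k \is a fin_num.
  rewrite ge0_fin_numE//; apply: le_lt_trans (nneseries_ge_term k b0) _.
  by apply: le_lt_trans bs _; rewrite lte_mul_pinfty// lee_fin ltW.
exists (fun k => fine (b k) `^ q^-1 / dyad k `^ al); split.
- by move=> k; rewrite divr_ge0 ?powR_ge0.
- move=> k z zk; rewrite ler_pdivlMr// mulrC.
  have := bz k z zk; rewrite -(fineK (bfin k)) lee_fin -/al => h.
  have m0 : 0 <= dyad k `^ al * modc (f z) by rewrite mulr_ge0 ?powR_ge0 ?modc_ge0.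
  exact: le_powR_inv.
- apply: le_trans bs; apply: lee_nneseries => [k _ _|k _]; first by rewrite lee_fin powR_ge0.
  rewrite mulrC divfK ?gt_eqF// -powRrM mulVf ?gt_eqF// powRr1 ?fine_ge0//.
  by rewrite fineK.
Qed.

Lemma weighted_sum_le (e u : nat -> R) (M : R) :
  (forall j, 0 <= e j <= M) -> (forall j, 0 <= u j) ->
  (\sum_(j <oo) ((e j * (dyad j `^ al * u j)) `^ q)%:E <=
   (M `^ q)%:E * \sum_(j <oo) ((dyad j `^ al * u j) `^ q)%:E)%E.
Proof.
move=> eM u0; have M0 : 0 <= M by have /andP[h1 h2] := eM 0%N; exact: le_trans h1 h2.
have x0 j : 0 <= dyad j `^ al * u j by rewrite mulr_ge0 ?powR_ge0.
rewrite -nneseriesZl; last by move=> j _; rewrite lee_fin powR_ge0.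
apply: lee_nneseries => [j _ _|j _]; first by rewrite lee_fin powR_ge0.
have /andP[e0 e1] := eM j.
rewrite -EFinM lee_fin powRM// ler_wpM2r ?powR_ge0//.
by apply: ge0_ler_powR; rewrite ?nnegrE ?(ltW q0).
Qed.

End ATFacts.

(** * Bounded operators and test functions *)

Section Boundedness.
Context {R : realType}.
Local Notation dyad := (@dyad R).
Variables (p q : R).
Hypotheses (p1 : 1 < p) (q1 : 1 < q) (pq : p^-1 + q^-1 < 1).
Let al : R := p^-1 + q^-1.
Variable mu : {finite_measure set (measurableTypeR R) -> \bar R}.
Local Notation eps := (carleson_eps mu).

Let q0 : 0 < q. Proof. exact: lt_trans ltr01 q1. Qed.

Lemma carleson_epsE j : mu `[1 - dyad j, 1[%classic = (eps j * dyad j)%:E.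
Proof.
have d0 := @dyad_gt0 R j.
rewrite /carleson_eps divfK ?gt_eqF// fineK//.
by apply: fin_num_measure; exact: measurable_itv.
Qed.

Lemma carleson_ratio_dyad j : carleson_ratio mu (1 - dyad j) = (eps j)%:E.
Proof.
have d0 := @dyad_gt0 R j.
transitivity ((eps j * dyad j)%:E * ((1 - (1 - dyad j))^-1)%:E)%E.
  congr (_ * _)%E; exact: carleson_epsE.
by rewrite subKr -EFinM mulfK// gt_eqF.
Qed.

(** Moving from t to the left end of its cell increases the measure and at most doubles 1 - t. *)
Lemma carleson_ratio_le j (t : R) : 1 - dyad j <= t < 1 - dyad j.+1 ->
  (carleson_ratio mu t <= (2 * eps j)%:E)%E.
Proof.
move=> /andP[t1 t2]; have d0 := @dyad_gt0 R j; rewrite dyadS in t2.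
have e0 := carleson_eps_ge0 mu j.
have s0 : 0 < 1 - t by lra.
rewrite /carleson_ratio.
apply: (@le_trans _ _ ((eps j * dyad j)%:E * ((1 - t)^-1)%:E)%E).
  apply: lee_wpmul2r; first by rewrite lee_fin invr_ge0 ltW.
  rewrite -carleson_epsE; apply: le_measure.
  - by apply: mem_set; exact: measurable_itv.
  - by apply: mem_set; exact: measurable_itv.
  - by move=> x; rewrite /= !in_itv/= => /andP[x1 ->]; rewrite (le_trans t1).
rewrite -EFinM lee_fin ler_pdivrMr//.
have : 0 <= eps j * (2 * (1 - t) - dyad j) by rewrite mulr_ge0//; lra.
by lra.
Qed.

Lemma dyadic_cell (t : R) : 0 <= t < 1 ->
  exists j, 1 - dyad j <= t < 1 - dyad j.+1.
Proof.
move=> /andP[t0 t1].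
have s0 : 0 < 1 - t by rewrite subr_gt0.
have s1 : 1 - t <= 1 by rewrite gerBl.
have [j /andP[j1 j2]] := dyadic_scale s0 s1; rewrite !mul1r in j1 j2.
by exists j; apply/andP; split; lra.
Qed.

Lemma is_1CMP : is_1CM mu <-> exists M, forall j, eps j <= M.
Proof.
split.
  rewrite /is_1CM; set s := ereal_sup _ => sfin.
  have le_s j : ((eps j)%:E <= s)%E.
    rewrite -carleson_ratio_dyad; apply: ereal_sup_ubound; exists (1 - dyad j) => //.
    by rewrite /= in_itv/= subr_ge0 dyad_le1 ltrBlDr ltrDl dyad_gt0.
  have sf : s \is a fin_num.
    rewrite ge0_fin_numE//; apply: le_trans (le_s 0%N).
    by rewrite lee_fin carleson_eps_ge0.
  by exists (fine s) => j; rewrite -lee_fin fineK.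
move=> [M HM]; apply: (@le_lt_trans _ _ (2 * M)%:E); last by rewrite ltry.
apply: ge_ereal_sup => _ [t t01 <-]; rewrite /= in_itv/= in t01.
have [j jt] := dyadic_cell t01.
by apply: (le_trans (carleson_ratio_le jt)); rewrite lee_fin ler_wpM2l.
Qed.

Lemma I_op_AT (M : R) : (forall j, eps j <= M) ->
  exists2 K : R, 0 <= K & forall f, AT p q f ->
    [/\ forall z, modc z < 1 -> I_converges mu f z,
        cintegrable mu (fun t => f t%:C%C), AT p q (I_op mu f) &
        (AT_pow p q (I_op mu f) <= K%:E * AT_pow p q f)%E].
Proof.
move=> eM; have [C C0 HC] := I_op_bound p1 q1 pq; have [B B0 HB] := AT_sequence p1 q1.
have eM' j : 0 <= eps j <= M by rewrite carleson_eps_ge0 eM.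
exists (C * (M `^ q * B)); first by rewrite !mulr_ge0 ?powR_ge0 ?(ltW C0) ?(ltW B0).
move=> f [fa fn]; have ffin := (AT_norm_lty p q1 f).1 fn.
have [u [u0 uf us]] := HB f fa ffin.
have h1 := weighted_sum_le p q1 eM' u0.
have h2 : (\sum_(j <oo) ((eps j * (dyad j `^ (p^-1 + q^-1) * u j)) `^ q)%:E <=
    (M `^ q * B)%:E * AT_pow p q f)%E.
  apply: (le_trans h1); rewrite EFinM -muleA.
  by apply: lee_wpmul2l => //; rewrite lee_fin powR_ge0.
have Bf : ((M `^ q * B)%:E * AT_pow p q f < +oo)%E.
  by apply: lte_mul_pinfty; rewrite ?lee_fin ?mulr_ge0 ?powR_ge0 ?(ltW B0).
have hu : dyadic_bound f u by move=> j t /dyadic_core_real; exact: uf.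
have [cv ci Ib] := HC mu f u u0 (analytic_cmeas fa) hu (le_lt_trans h2 Bf).
have le : (AT_pow p q (I_op mu f) <= (C * (M `^ q * B))%:E * AT_pow p q f)%E.
  apply: (le_trans Ib); rewrite (EFinM C) -muleA.
  by apply: lee_wpmul2l => //; rewrite lee_fin ltW.
split; [exact: cv|exact: ci| |exact: le].
split; first exact: I_op_analytic.
apply/(AT_norm_lty p q1); apply: (le_lt_trans le).
apply: lte_mul_pinfty; last exact: ffin.
- by rewrite lee_fin !mulr_ge0 ?powR_ge0 ?(ltW B0) ?(ltW C0).
- by [].
Qed.

Lemma CM_bounded : is_1CM mu -> I_bounded mu p q.
Proof.
move=> /is_1CMP[M /I_op_AT[K K0 HK]]; split.
  by move=> f /HK[].
exists (K `^ q^-1) => f /HK[_ _ _ h].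
rewrite !AT_normE -poweR_EFin -poweRM ?lee_fin ?AT_pow_ge0//.
by apply: le_poweR; rewrite ?invr_gt0 ?AT_pow_ge0.
Qed.

Lemma well_defined_cintegrable (f : R[i] -> R[i]) : I_well_defined mu p q -> AT p q f ->
  cintegrable mu (fun t => f t%:C%C).
Proof.
move=> wd ATf; have [cv _] := wd f ATf; have [fa _] := ATf.
split; first exact: analytic_cmeas.
have := cv 0; rewrite /unit_disc/= modc0 ltr01 => /(_ isT).
by rewrite /I_converges /I_kernel; under eq_integral do rewrite mulr0 subr0 divr1.
Qed.

(* The test function d_n^{1 - al} / (1 - (1 - d_n) z) is the image of a
   constant under the operator of a Dirac mass, so its norm is controlled by
   the upper bound already proved. *)
Definition test_fun (n : nat) : R[i] -> R[i] :=
  I_op (dirac (1 - dyad n : measurableTypeR R)) (fun=> (dyad n `^ (1 - al))%:C%C).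

Lemma test_point n : 0 <= 1 - dyad n < 1.
Proof. by rewrite subr_ge0 dyad_le1 ltrBlDr ltrDl dyad_gt0. Qed.

Lemma test_funE n (z : R[i]) : modc z < 1 ->
  test_fun n z = (dyad n `^ (1 - al))%:C%C / (1 - (1 - dyad n)%:C%C * z).
Proof.
move=> z1; rewrite /test_fun I_op_cint.
set a : measurableTypeR R := 1 - dyad n.
set F := I_kernel _ z.
have aD : (`[0%R, 1%R[%classic : set (measurableTypeR R)) a.
  by rewrite /= in_itv/= test_point.
have [mr mi] : cmeas F by apply: cmeasM; [exact: cmeas_cst|exact: cmeas_inv_denom].
have E (g : R -> R) : measurable_fun (`[0%R, 1%R[%classic : set (measurableTypeR R)) g ->
    (\int[dirac a]_(t in `[0%R, 1%R[) g t)%R = g a.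
  move=> mg; rewrite /Rintegral integral_dirac//; last exact/measurable_EFinP.
  by rewrite diracE mem_set// mul1e.
by apply: complexP => /=; rewrite E.
Qed.

(** For the Dirac mass at 1 - d_n, eps_j is 1 / d_j when j <= n and 0 afterwards. With the constant
    majorant d_n^(1 - al) the j-th term is 2^(-(1 - al) q (n - j)), so the sum is bounded by a
    geometric series independent of n. *)
Lemma test_fun_AT : exists K : R, forall n,
  AT p q (test_fun n) /\ (AT_pow p q (test_fun n) <= K%:E)%E.
Proof.
have [C C0 HC] := I_op_bound p1 q1 pq.
have d0 := @dyad_gt0 R.
pose s := (1 - al) * q; have s0 : 0 < s by rewrite mulr_gt0// subr_gt0.
pose c : R := 2 `^ (- s).
have c0 : 0 <= c by exact: powR_ge0.
have c1 : c < 1.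
  rewrite /c powRN invf_lt1 ?powR_gt0//.
  have : (1 : R) `^ s < 2 `^ s by apply: gt0_ltr_powR; rewrite ?nnegrE ?ltr1n.
  by rewrite powR1.
exists (C * (1 - c)^-1) => n.
set a : measurableTypeR R := 1 - dyad n.
pose v := dyad n `^ (1 - al).
have v0 : 0 <= v by exact: powR_ge0.
have W : (\sum_(j <oo) ((carleson_eps (dirac a) j *
    (dyad j `^ (p^-1 + q^-1) * v)) `^ q)%:E <= ((1 - c)^-1)%:E)%E.
  have term j : (carleson_eps (dirac a) j * (dyad j `^ (p^-1 + q^-1) * v)) `^ q =
      (j <= n)%N%:R * c ^+ (n - j).
    rewrite /carleson_eps diracE -/al.
    have [jn|nj] := leqP j n; last first.
      rewrite memNset ?mul0r ?powR0 ?gt_eqF//=.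
      rewrite in_itv/= => /andP[h _]; move: h; rewrite /a lerD2l lerN2 => h.
      have := dyad_le (R := R) nj; rewrite dyadS; have := d0 n; lra.
    rewrite mem_set/=; last first.
      rewrite in_itv/= /a lerD2l lerN2 (dyad_le jn)/=.
      by have /andP[_] := test_point n.
    rewrite !mul1r /v (dyadB jn); set E : R := 2 ^+ (n - j).
    have E0 : 0 < E by rewrite exprn_gt0.
    have dn := d0 n.
    have -> : (dyad n * E)^-1 * ((dyad n * E) `^ al * dyad n `^ (1 - al)) =
        E `^ (- (1 - al)).
      have pB (x y : R) : 0 < y -> y `^ (al - x) = y `^ al / y `^ x.
        by move=> y0; rewrite powRB//; apply/implyP => _; rewrite gt_eqF.
      have pB' (y : R) : 0 < y -> y `^ (1 - al) = y / y `^ al.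
        move=> y0; rewrite powRB ?powRr1 ?(ltW y0)//.
        by apply/implyP => _; rewrite gt_eqF.
      rewrite opprB (pB _ _ E0) powRr1 ?(ltW E0)// (pB' _ dn) powRM ?(ltW dn) ?(ltW E0)//.
      have := powR_gt0 al dn; move: (dyad n `^ al) (E `^ al) => X Y X0.
      by field; rewrite !gt_eqF.
    by rewrite -powRrM mulNr -/s /E powR2XN.
  apply: nneseries_le_ub => [j|N]; first by rewrite lee_fin powR_ge0.
  under eq_bigr do rewrite term.
  rewrite sumEFin lee_fin; apply: le_trans (sum_geometric_rev_le n c0 c1).
  apply: (@le_trans _ _ (\sum_(0 <= j < n.+1 + N) (j <= n)%N%:R * c ^+ (n - j))).
    rewrite [leRHS](big_cat_nat _ (n := N))//=; last by rewrite leq_addl.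
    by rewrite lerDl; apply: sumr_ge0 => j _; rewrite mulr_ge0// exprn_ge0.
  rewrite (big_cat_nat _ (n := n.+1))//=; last by rewrite leq_addr.
  rewrite [X in _ + X]big_nat [X in _ + X]big1 ?addr0.
    rewrite le_eqVlt; apply/orP; left; apply/eqP; apply: eq_big_nat => j /andP[_].
    by rewrite ltnS => ->; rewrite mul1r.
  by move=> j /andP[nj _]; rewrite leqNgt nj mul0r.
have hb : dyadic_bound (fun=> v%:C%C) (fun=> v).
  by move=> j t _; rewrite modc_real ger0_norm.
have [cv ci Ib] := HC (dirac a) (fun=> v%:C%C) (fun=> v) (fun=> v0) (cmeas_cst _) hb
   (le_lt_trans W (ltry _)).
have le : (AT_pow p q (test_fun n) <= (C * (1 - c)^-1)%:E)%E.
  apply: (le_trans Ib); rewrite EFinM; apply: lee_wpmul2l => //.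
  by rewrite lee_fin ltW.
split; last exact: le.
split; first exact: I_op_analytic.
by apply/(AT_norm_lty p q1); apply: (le_lt_trans le); exact: ltry.
Qed.

(** At the real point a = 1 - d_n the integrand is the nonnegative number v / (1 - a t)^2. For t >=
    a, 1 - a t <= 1 - a^2 <= 2 d_n, so the integral over [a, 1) is at least v eps_n / (4 d_n), and
    d_n^al v = d_n. *)
Lemma test_fun_lower n : cintegrable mu (fun t => test_fun n t%:C%C) ->
  eps n / 4 <= dyad n `^ al * modc (I_op mu (test_fun n) (1 - dyad n)%:C%C).
Proof.
move=> ci; have dn := @dyad_gt0 R n.
have [a0 a1] := andP (test_point n).
set a := 1 - dyad n in a0 a1 *.
have ac : modc a%:C%C < 1 by rewrite modc_real ger0_norm.
pose v := dyad n `^ (1 - al).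
have kE t : 0 <= t < 1 -> I_kernel (test_fun n) a%:C%C t = (v / (1 - a * t) ^+ 2)%:C%C.
  move=> t01; rewrite /I_kernel test_funE ?modc_real_lt1// -/a -/v.
  rewrite -!rmorphM -(rmorph1 (real_complex R)) -!rmorphB -!fmorphV -!rmorphM.
  by congr (_%:C%C); rewrite (mulrC t a) -mulrA -invfM expr2.
have ik := I_kernel_cintegrable ac ci.
have ir := cintegrable_Re ik.
have v0 : 0 < v by rewrite powR_gt0.
suff H : v * (eps n / 4) / dyad n <= complex.Re (I_op mu (test_fun n) a%:C%C).
  have h2 := le_trans H (le_trans (ler_norm _) (Re_le_modc _)).
  apply: le_trans (ler_wpM2l (powR_ge0 _ al) h2).
  rewrite le_eqVlt; apply/orP; left; apply/eqP.
  have -> : dyad n `^ al * (v * (eps n / 4) / dyad n) =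
    (dyad n `^ al * v) / dyad n * (eps n / 4) by ring.
  rewrite /v -powRD; last by apply/implyP => _; rewrite gt_eqF.
  by rewrite addrC subrK powRr1 ?(ltW dn)// divff ?mul1r// gt_eqF.
have -> : complex.Re (I_op mu (test_fun n) a%:C%C) =
    (\int[mu]_(t in `[0%R, 1%R[) complex.Re (I_kernel (test_fun n) a%:C%C t))%R by [].
rewrite -lee_fin [leRHS](fineK (integrable_fin_num _ ir))//.
apply: (@le_trans _ _ (\int[mu]_(t in `[a, 1%R[) (v / (4 * dyad n ^+ 2))%:E)%E).
  rewrite integral_cst; last exact: measurable_itv.
  apply: (@le_trans _ _ ((v / (4 * dyad n ^+ 2))%:E * (eps n * dyad n)%:E)%E); last first.
    by rewrite le_eqVlt; apply/orP; left; apply/eqP; congr (_ * _)%E; rewrite -carleson_epsE.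
  rewrite -EFinM lee_fin le_eqVlt; apply/orP; left; apply/eqP.
  by field; rewrite gt_eqF.
apply: ge0_le_integral_any.
- by move=> t; rewrite /= !in_itv/= => /andP[ta ->]; rewrite (le_trans a0).
- by move=> t _; rewrite lee_fin divr_ge0 ?(ltW v0)// mulr_ge0// exprn_ge0// ltW.
- move=> t tD; suff : (0 <= (complex.Re (I_kernel (test_fun n) a%:C%C t))%:E)%E by [].
  rewrite kE; last by move: tD; rewrite /= in_itv.
  by rewrite lee_fin divr_ge0 ?(ltW v0)// sqr_ge0.
move=> t ta1; have /andP[ta t1] : a <= t < 1 by move: ta1; rewrite /= in_itv.
suff : ((v / (4 * dyad n ^+ 2))%:E <= (complex.Re (I_kernel (test_fun n) a%:C%C t))%:E)%E by [].
rewrite kE ?t1 ?(le_trans a0 ta)// lee_fin ler_wpM2l ?(ltW v0)//.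
have at1 : 0 < 1 - a * t by rewrite /a in a0 a1 *; nra.
rewrite lef_pV2 ?posrE ?exprn_gt0// ?mulr_gt0 ?exprn_gt0//.
have : 1 - a * t <= 2 * dyad n by rewrite /a in ta a0 a1 *; nra.
by rewrite /a in at1 *; nra.
Qed.

Lemma bounded_CM : I_bounded mu p q -> is_1CM mu.
Proof.
move=> [wd [Cb HCb]]; apply/is_1CMP.
have [K HK] := test_fun_AT; have [B B0 HB] := AT_sequence p1 q1.
(* The constant in [I_bounded] carries no sign condition; its positive part serves as well. *)
pose Cb' := Num.max Cb 0.
have Cb0 : 0 <= Cb' by rewrite le_max lexx orbT.
have K0 : 0 <= K.
  by rewrite -lee_fin; apply: le_trans (HK 0%N).2; exact: AT_pow_ge0.
exists (4 * (B * (Cb' * K `^ q^-1) `^ q) `^ q^-1) => n.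
have [ATn Kn] := HK n.
have [_ [Ian Ifn]] := wd _ ATn.
have ci := well_defined_cintegrable wd ATn.
have low := test_fun_lower ci.
have le : (AT_pow p q (I_op mu (test_fun n)) <= ((Cb' * K `^ q^-1) `^ q)%:E)%E.
  apply: AT_norm_le_pow => //; first by rewrite mulr_ge0// powR_ge0.
  apply: (le_trans (HCb _ ATn)); rewrite EFinM.
  apply: (@le_trans _ _ (Cb'%:E * AT_norm p q (test_fun n))%E).
    apply: lee_wpmul2r; first exact: AT_norm_ge0.
    by rewrite lee_fin /Cb' le_max lexx.
  apply: lee_wpmul2l => //; rewrite AT_normE -poweR_EFin.
  by apply: le_poweR; rewrite ?invr_gt0 ?AT_pow_ge0.
have [u [u0 uf us]] := HB _ Ian ((AT_norm_lty p q1 _).1 Ifn).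
have h1 := uf n _ (dyadic_core_left n).
have h2 : eps n / 4 <= dyad n `^ al * u n.
  by apply: (le_trans low); rewrite ler_wpM2l ?powR_ge0.
have h3 : (((dyad n `^ al * u n) `^ q)%:E <= (B * (Cb' * K `^ q^-1) `^ q)%:E)%E.
  have nn j : (0 <= ((dyad j `^ al * u j) `^ q)%:E)%E by rewrite lee_fin powR_ge0.
  apply: le_trans (nneseries_ge_term n nn) _.
  apply: (le_trans us); rewrite EFinM; apply: lee_wpmul2l => //.
  by rewrite lee_fin ltW.
rewrite lee_fin in h3.
have x0 : 0 <= dyad n `^ al * u n by rewrite mulr_ge0 ?powR_ge0.
have h4 : dyad n `^ al * u n <= (B * (Cb' * K `^ q^-1) `^ q) `^ q^-1.
  exact: le_powR_inv.
by have := le_trans h2 h4; rewrite ler_pdivrMr// mulrC.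
Qed.

End Boundedness.

(** * Compactness *)

Section Ultralimits.
Context {R : realType}.
Local Notation dyad := (@dyad R).

Lemma dyadic_core_disc k (z : R[i]) : dyadic_core k z -> modc z < 1.
Proof.
move=> [zi /andP[z1 z2]]; apply: le_lt_trans (modc_le_ReIm z) _.
have d0 := @dyad_gt0 R k; have d1 := @dyad_le1 R k.
have : `|complex.Re z| <= 1 - dyad k / 2 + dyad k / 64.
  by rewrite ler_norml z2 andbT; lra.
by move: zi; lra.
Qed.

Lemma dyadic_core_ball j (t : R) (z : R[i]) : 1 - dyad j <= t < 1 - dyad j.+1 ->
  modc (z - t%:C%C) < dyad j / 64 -> dyadic_core j z.
Proof.
rewrite dyadS => /andP[t1 t2] zt; have d0 := @dyad_gt0 R j.
have := le_lt_trans (Im_le_modc _) zt; have := le_lt_trans (Re_le_modc _) zt.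
rewrite cReD cImD cReN cImN /= oppr0 addr0 ltr_norml => /andP[r1 r2] /ltW zi.
by split => //; apply/andP; split; lra.
Qed.

Lemma dyadic_cell_lt K (t : R) : 0 <= t < 1 - dyad K -> exists2 j, (j < K)%N &
  1 - dyad j <= t < 1 - dyad j.+1.
Proof.
move=> /andP[t0 tK]; have dK := @dyad_gt0 R K.
have [|j jt] := @dyadic_cell R t; first by rewrite t0; lra.
exists j => //; rewrite ltnNge; apply/negP => /(@dyad_le R).
by have /andP[? _] := jt; lra.
Qed.

(** Around each point of [0, 1 - d_K) the disc of radius d_K/64 stays in a core of index below K, so
    the Cauchy estimate bounds the derivative along the segment. *)
Lemma core_lipschitz (f : R[i] -> R[i]) K (W x y : R) : analytic_on_disc f ->
  (forall j z, (j < K)%N -> dyadic_core j z -> modc (f z) <= W) ->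
  0 <= x -> x <= y -> y < 1 - dyad K ->
  modc (f y%:C%C - f x%:C%C) <= 2 * (16 * W / (dyad K / 64)) * (y - x).
Proof.
move=> /analytic_C1[f' Hf] fW x0 xy yK; have dK := @dyad_gt0 R K.
apply: (@real_segment_lipschitz _ _ f') => // t /andP[xt ty].
have [|j jK jt] := @dyadic_cell_lt K t.
  by rewrite (le_trans x0 xt) (le_lt_trans ty yK).
have core z : modc (z - t%:C%C) < dyad K / 64 -> dyadic_core j z.
  move=> zt; apply: (dyadic_core_ball jt); apply: (lt_le_trans zt).
  by rewrite ler_wpM2r// dyad_le// ltnW.
have S0 : 0 < dyad K / 64 by rewrite divr_gt0.
have disc z : modc (z - t%:C%C) < dyad K / 64 -> modc z < 1.
  by move=> /core/dyadic_core_disc.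
split; first by apply: (Hf _ _).1; apply: disc; rewrite subrr modc0.
apply: (@cauchy_derivative_bound _ f) => // z zt; first exact: Hf (disc _ zt).
exact: fW jK (core _ zt).
Qed.

(** A cluster point exists by compactness. For an ultrafilter it is a limit: otherwise the
    complement of some neighbourhood would be large, contradicting clustering. *)
Lemma bounded_ultralimit (U : set_system nat) (r : nat -> R) (B : R) :
  UltraFilter U -> (forall n, `|r n| <= B) ->
  exists l, forall e : R, 0 < e -> U [set n | `|r n - l| <= e].
Proof.
move=> UU rB.
have rU : (r @ U) `[- B, B]%classic.
  by apply: (@filterE _ U) => n; rewrite /= in_itv/= -ler_norml.
have [l [_ lcl]] := @segment_compact R (- B) B (r @ U) _ rU.
exists l => e e0.
have [//|nU] := in_ultra_setVsetC [set n | `|r n - l| <= e] UU.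
have [x []] := lcl [set x | ~ `|x - l| <= e] (ball l e) nU (nbhsx_ballx _ _ e0).
by rewrite /ball/= distrC => h /ltW.
Qed.

Lemma bounded_complex_ultralimit (U : set_system nat) (w : nat -> R[i]) (B : R) :
  UltraFilter U -> (forall n, modc (w n) <= B) ->
  exists l, forall e : R, 0 < e -> U [set n | modc (w n - l) <= e].
Proof.
move=> UU wB.
have [a Ha] : exists a, forall e : R, 0 < e -> U [set n | `|complex.Re (w n) - a| <= e].
  by apply: (@bounded_ultralimit U _ B) => n; exact: le_trans (Re_le_modc _) (wB n).
have [b Hb] : exists b, forall e : R, 0 < e -> U [set n | `|complex.Im (w n) - b| <= e].
  by apply: (@bounded_ultralimit U _ B) => n; exact: le_trans (Im_le_modc _) (wB n).
exists (a +i* b)%C => e e0; have e2 : 0 < e / 2 by rewrite divr_gt0.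
apply: filterS2 (Ha _ e2) (Hb _ e2) => n /= h1 h2.
apply: le_trans (modc_le_ReIm _) _.
by rewrite cReD cImD cReN cImN /= [leRHS]splitr lerD.
Qed.

(* Normal families on the radius: a sequence bounded on the dyadic pieces of a
   neighbourhood of [0, 1) is equi-Lipschitz on each [0, 1 - d_K), so its
   pointwise ultralimit is locally uniform. *)
Lemma locally_uniform_ultralimit (U : set_system nat) (f : nat -> R[i] -> R[i])
    (W : nat -> R) : UltraFilter U -> (forall n, analytic_on_disc (f n)) ->
  (forall n K j z, (j < K)%N -> dyadic_core j z -> modc (f n z) <= W K) ->
  exists phi : R -> R[i],
    (forall K (e : R), 0 < e ->
       U [set n | forall t : R, 0 <= t < 1 - dyad K -> modc (f n t%:C%C - phi t) <= e]) /\
    (forall t : R, 0 <= t < 1 -> ccont (fun z => phi `|complex.Re z|) t%:C%C).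
Proof.
move=> UU fa fW.
have W0 K : 0 <= W K.+1.
  apply: le_trans (modc_ge0 (f 0%N (1 - dyad 0)%:C%C)) _.
  exact: fW (ltn0Sn K) (dyadic_core_left 0).
have lim (t : R) : exists l, 0 <= t < 1 ->
    forall e : R, 0 < e -> U [set n | modc (f n t%:C%C - l) <= e].
  have [t01|] := pselect (0 <= t < 1); last by exists 0.
  have [j jt] := dyadic_cell t01.
  have [n|l Hl] := @bounded_complex_ultralimit U (fun n => f n t%:C%C) (W j.+1) UU.
    exact: fW (ltnSn j) (dyadic_core_real jt).
  by exists l.
have [phi Hphi] := choice lim; exists phi.
pose L K : R := 2 * (16 * W K / (dyad K / 64)).
have L0 K : 0 <= L K.+1.
  by rewrite mulr_ge0// divr_ge0 ?mulr_ge0// ltW// dyad_gt0.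
have lip n K x y : 0 <= x -> x <= y -> y < 1 - dyad K ->
    modc (f n y%:C%C - f n x%:C%C) <= L K * (y - x).
  by move=> x0 xy yK; apply: core_lipschitz => // j z; exact: fW.
have lt1 K (t : R) : t < 1 - dyad K -> t < 1.
  by move=> /lt_trans; apply; rewrite ltrBlDr ltrDl dyad_gt0.
have plip K x y : 0 <= x -> x <= y -> y < 1 - dyad K ->
    modc (phi y - phi x) <= L K * (y - x).
  move=> x0 xy yK; apply/ler_addgt0Pr => e e0.
  have e2 : 0 < e / 2 by rewrite divr_gt0.
  have y01 : 0 <= y < 1 by rewrite (le_trans x0 xy) (lt1 _ _ yK).
  have x01 : 0 <= x < 1 by rewrite x0 (le_lt_trans xy)// (lt1 _ _ yK).
  have [n [/= h1 h2]] := filter_ex (filterI (Hphi y y01 _ e2) (Hphi x x01 _ e2)).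
  have -> : phi y - phi x = (f n y%:C%C - f n x%:C%C) +
      (- (f n y%:C%C - phi y) + (f n x%:C%C - phi x)) by ring.
  apply: le_trans (modcD _ _) _; apply: lerD; first exact: lip.
  by apply: le_trans (modcD _ _) _; rewrite modcN [leRHS]splitr lerD.
have pliP K x y : 0 <= x < 1 - dyad K -> 0 <= y < 1 - dyad K ->
    modc (phi y - phi x) <= L K * `|y - x|.
  move=> /andP[x0 x1] /andP[y0 y1]; have [xy|/ltW yx] := leP x y.
    by rewrite ger0_norm ?subr_ge0//; exact: plip.
  by rewrite modcB distrC ger0_norm ?subr_ge0//; exact: plip.
split.
  move=> K e e0.
  case: K => [|K].
    apply: filterE => n t /=; rewrite dyad0 subrr => /andP[a b].
    by have := le_lt_trans a b; rewrite ltxx.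
  (* A grid of mesh h with L h <= e/3: finitely many pointwise limits hold simultaneously on a set
     of U, and the Lipschitz bounds for f_n and phi account for the remaining two thirds of e. *)
  pose c := 3 * (L K.+1 + 1); have c0 : 0 < c by rewrite mulr_gt0// ltr_wpDl.
  pose N := Num.truncn (c / e).
  have cN : c / e < N.+1%:R by have /andP[] := truncn_itv (ltW (divr_gt0 c0 e0)).
  pose h : R := N.+1%:R^-1.
  have h0 : 0 < h by rewrite invr_gt0.
  have Lh : L K.+1 * h <= e / 3.
    have h1 : c * h <= e.
      by rewrite ler_pdivrMr// mulrC -ler_pdivrMr// ltW.
    have : 0 <= L K.+1 + 1 by rewrite ltW// ltr_wpDl.
    by move: h1 h0; rewrite /c; nra.
  have e3 : 0 < e / 3 by rewrite divr_gt0.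
  have grid (i : 'I_N.+1) : U [set n | modc (f n (i%:R * h)%:C%C - phi (i%:R * h)) <= e / 3].
    apply: Hphi => //; rewrite mulr_ge0 ?(ltW h0)//=.
    by rewrite ltr_pdivrMr// mul1r ltr_nat.
  have gridU : U [set n | forall i : 'I_N.+1,
      modc (f n (i%:R * h)%:C%C - phi (i%:R * h)) <= e / 3].
    exact: filter_forall grid.
  apply: filterS gridU => n Hn t tK.
  have /andP[t0 t1] := tK.
  have th0 : 0 <= t / h by rewrite divr_ge0// ltW.
  pose i := Num.truncn (t / h).
  have /andP[i1 i2] := truncn_itv th0; rewrite -/i in i1 i2.
  rewrite ler_pdivlMr// in i1; rewrite ltr_pdivrMr// in i2.
  have iN : (i < N.+1)%N.
    rewrite -(ltr_nat R); apply: le_lt_trans (_ : t / h < _).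
      by rewrite ler_pdivlMr.
    by rewrite /h invrK -[ltRHS]mul1r ltr_pM2r// (lt1 _ _ t1).
  have ih0 : 0 <= i%:R * h by rewrite mulr_ge0// ltW.
  have dlt : L K.+1 * (t - i%:R * h) <= e / 3.
    apply: le_trans Lh; apply: ler_wpM2l => //.
    by rewrite -natr1 mulrDl mul1r in i2; lra.
  have -> : f n t%:C%C - phi t = (f n t%:C%C - f n (i%:R * h)%:C%C) +
     ((f n (i%:R * h)%:C%C - phi (i%:R * h)) - (phi t - phi (i%:R * h))) by ring.
  apply: le_trans (modcD _ _) _.
  apply: le_trans (lerD (le_trans (lip n K.+1 _ _ ih0 i1 t1) dlt) (modcD _ _)) _.
  rewrite modcN.
  have h1 := Hn (Ordinal iN); rewrite /= in h1.
  have h2 := le_trans (plip _ _ _ ih0 i1 t1) dlt.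
  by have := lerD h1 h2; lra.
move=> t /andP[t0 t1] e e0.
have t1' : 0 < 1 - t by rewrite subr_gt0.
have [K0 HK0] := @dyad_cvg0 R _ t1'.
(* A positive index is arranged because [L0] gives the sign of the Lipschitz constant at positive
   indices. *)
have {HK0} [K HK] : exists K, dyad K.+1 < 1 - t.
  exists K0; apply: le_lt_trans HK0; exact: dyad_le.
have L1 : 0 < L K.+1 + 1 by rewrite ltr_wpDl.
exists (Num.min (1 - t - dyad K.+1) (e / (L K.+1 + 1))).
  by rewrite lt_min subr_gt0 HK divr_gt0.
move=> z; rewrite lt_min => /andP[z1 z2].
have tE : `|complex.Re (t%:C%C : R[i])| = t by rewrite /= ger0_norm.
have d : `| `|complex.Re z| - t| <= modc (z - t%:C%C).
  rewrite -{1}tE; apply: le_trans (ler_dist_dist _ _) _.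
  by rewrite -cReN -cReD Re_le_modc.
rewrite tE; apply: (@le_lt_trans _ _ (L K.+1 * `| `|complex.Re z| - t|)).
  apply: pliP; first by rewrite t0; move: HK; lra.
  rewrite normr_ge0/=; have := ler_norm (`|complex.Re z| - t); lra.
rewrite ltr_pdivlMr// in z2.
have := modc_ge0 (z - t%:C%C); have := L0 K.
have : 0 <= `| `|complex.Re z| - t| by [].
by move: z2 d; nra.
Qed.

End Ultralimits.

(** * Vanishing and summable sequences *)

Section VanishingSequences.
Context {R : realType}.

Lemma ge0_cvge0P (T : Type) (F : set_system T) (FF : Filter F) (f : T -> \bar R) :
  (forall x, (0 <= f x)%E) ->
  f x @[x --> F] --> 0%E <->
  forall e : R, 0 < e -> \forall x \near F, (f x <= e%:E)%E.
Proof.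
move=> f0; split.
  move=> /fine_cvgP[ffin /cvgrPdist_le fc] e e0.
  apply: filterS2 ffin (fc e e0) => x xf.
  by rewrite /= sub0r normrN ger0_norm ?fine_ge0// -lee_fin fineK.
move=> H; apply/fine_cvgP; split.
  apply: filterS (H 1 ltr01) => x x1.
  by rewrite ge0_fin_numE//; apply: (le_lt_trans x1); rewrite ltry.
apply/cvgrPdist_le => e e0; apply: filterS (H e e0) => x xe.
rewrite /= sub0r normrN ger0_norm ?fine_ge0// -lee_fin fineK//.
by rewrite ge0_fin_numE//; apply: (le_lt_trans xe); rewrite ltry.
Qed.

Lemma powR_add_le (r a b : R) : 0 < r -> 0 <= a -> 0 <= b ->
  (a + b) `^ r <= 2 `^ r * (a `^ r + b `^ r).
Proof.
move=> r0; wlog ab : a b / a <= b => [H a0 b0|a0 b0].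
  have [ab|/ltW ba] := leP a b; first exact: H.
  by rewrite addrC [_ `^ r + _]addrC; exact: H.
have h : (a + b) `^ r <= (2 * b) `^ r.
  apply: ge0_ler_powR; rewrite ?nnegrE ?(ltW r0) ?addr_ge0 ?mulr_ge0//.
  by lra.
apply: (le_trans h); rewrite powRM// ler_wpM2l ?powR_ge0//.
by rewrite lerDr powR_ge0.
Qed.

Lemma partial_sum_le_nneseries (x : nat -> R) (S : R) : (forall j, 0 <= x j) ->
  (\sum_(j <oo) (x j)%:E <= S%:E)%E -> forall N, \sum_(0 <= j < N) x j <= S.
Proof.
move=> x0 xS N; rewrite -lee_fin; apply: le_trans xS.
have := @nneseries_lim_ge R (fun j => (x j)%:E) xpredT 0 N.
rewrite sumEFin; apply => j _ _; by rewrite lee_fin.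
Qed.

Lemma summable_vanishing (x : nat -> R) : (forall j, 0 <= x j) ->
  (\sum_(j <oo) (x j)%:E < +oo)%E ->
  forall e, 0 < e -> exists N, forall n, (N <= n)%N -> x n <= e.
Proof.
move=> x0 xfin e e0.
have x0' j : xpredT j -> (0 <= (x j)%:E)%E by rewrite lee_fin.
have := nneseries_tail_cvg xfin x0'.
have T0 N : (0 <= \sum_(N <= k <oo) (x k)%:E)%E.
  by apply: nneseries_ge0 => j _ _; rewrite lee_fin.
move=> /(ge0_cvge0P _ T0)/(_ e e0)[N _ HN]; exists N => n Nn; rewrite -lee_fin.
apply: le_trans (HN n Nn).
have := @nneseries_lim_ge R (fun j => (x j)%:E) xpredT n n.+1.
by rewrite big_nat1; apply => j _ _; rewrite lee_fin.
Qed.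

Lemma sum_head_le (K N : nat) (P : R) : 0 <= P ->
  \sum_(0 <= j < N) (j < K)%N%:R * P <= K%:R * P.
Proof.
move=> P0; rewrite -mulr_suml ler_wpM2r//.
suff -> : \sum_(0 <= j < N) (j < K)%N%:R = (minn N K)%:R :> R.
  by rewrite ler_nat geq_minr.
elim: N => [|N IH]; first by rewrite big_geq// min0n.
rewrite big_nat_recr//= IH -natrD; congr (_%:R).
have [h|] := boolP (N < K)%N; first by rewrite (minn_idPl (ltnW h)) (minn_idPl h) addn1.
by rewrite -leqNgt => h; rewrite (minn_idPr h) (minn_idPr (leqW h)) addn0.
Qed.

End VanishingSequences.

(** * Vanishing Carleson measures and compact operators *)

Section Compactness.
Context {R : realType}.
Local Notation dyad := (@dyad R).
Variables (p q : R).
Hypotheses (p1 : 1 < p) (q1 : 1 < q) (pq : p^-1 + q^-1 < 1).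
Let al : R := p^-1 + q^-1.
Variable mu : {finite_measure set (measurableTypeR R) -> \bar R}.
Local Notation eps := (carleson_eps mu).

Let q0 : 0 < q. Proof. exact: lt_trans ltr01 q1. Qed.
Let al0 : 0 < al.
Proof. by rewrite addr_gt0 ?invr_gt0 ?(lt_trans ltr01 p1) ?(lt_trans ltr01 q1). Qed.

Definition carleson_vanishing : Prop :=
  forall e : R, 0 < e -> exists N, forall n, (N <= n)%N -> eps n <= e.

Lemma carleson_ratio_ge0 (t : R) : t < 1 -> (0 <= carleson_ratio mu t)%E.
Proof. by move=> t1; rewrite mule_ge0// lee_fin invr_ge0 subr_ge0 ltW. Qed.

Lemma is_1VCMP : is_1VCM mu <-> carleson_vanishing.
Proof.
(* Setting the value 0 for t >= 1 makes nonnegativity everywhere immediate, as [ge0_cvge0P] asks;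
   the left limit at 1 does not see the change. *)
pose f t := if t < 1 :> R then carleson_ratio mu t else 0%E.
have f0 t : (0 <= f t)%E by rewrite /f; case: ifPn => // /carleson_ratio_ge0.
have fE : is_1VCM mu <-> f t @[t --> (1 : R)^'-] --> 0%E.
  have E : \forall t \near (1 : R)^'-, carleson_ratio mu t = f t.
    near=> t; rewrite /f ifT//; near: t; exact: nbhs_left_lt.
  by split; apply: cvg_trans; apply: near_eq_cvg => //; apply: filterS E => t ->.
apply: (iff_trans fE); apply: (iff_trans (ge0_cvge0P _ f0)); split.
  move=> H e /H[d /= d0 Hd]; have [N dN] := dyad_cvg0 d0; exists N => n Nn.
  have dn := @dyad_gt0 R n.
  have l1 : 1 - dyad n < 1 by rewrite ltrBlDr ltrDl.
  have := Hd (1 - dyad n); rewrite /= subKr gtr0_norm// => /(_ _ l1).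
  rewrite /f l1 carleson_ratio_dyad lee_fin; apply.
  by apply: le_lt_trans dN; exact: dyad_le.
move=> H e e0; have [N HN] := H (e / 2) (divr_gt0 e0 (ltr0Sn R 1)).
have dN := @dyad_gt0 R N.
near=> t.
have t1 : t < 1 by near: t; exact: nbhs_left_lt.
have tN : 1 - dyad N < t by near: t; apply: nbhs_left_gt; rewrite ltrBlDr ltrDl.
rewrite /f t1.
have [|j jt] := @dyadic_cell R t.
  by rewrite t1 andbT (le_trans _ (ltW tN))// subr_ge0 dyad_le1.
apply: le_trans (carleson_ratio_le mu jt) _; rewrite lee_fin mulrC -ler_pdivlMr//.
apply: HN; rewrite -ltnS ltnNge; apply/negP => /(@dyad_le R) h.
by have /andP[_] := jt; lra.
Unshelve. all: by end_near. Qed.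

Lemma carleson_vanishing_bounded : carleson_vanishing -> exists M, forall j, eps j <= M.
Proof.
move=> /(_ 1 ltr01)[N HN].
exists (1 + \sum_(0 <= j < N) eps j) => j.
have s0 : 0 <= \sum_(0 <= j < N) eps j.
  by apply: sumr_ge0 => i _; exact: carleson_eps_ge0.
have [jN|/HN h] := ltnP j N; last by rewrite (le_trans h)// lerDl.
rewrite big_mkord (bigD1 (Ordinal jN))//= addrCA lerDl addr_ge0//.
by apply: sumr_ge0 => i _; exact: carleson_eps_ge0.
Qed.

Lemma AT_pointwise : exists2 B : R, 0 < B & forall (f : R[i] -> R[i]) (e : R),
  analytic_on_disc f -> 0 <= e -> (AT_norm p q f <= e%:E)%E ->
  forall n z, dyadic_core n z -> dyad n `^ al * modc (f z) <= B * e.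
Proof.
have [B B0 HB] := AT_sequence p1 q1; exists (B `^ q^-1); first exact: powR_gt0.
move=> f e fa e0 fe n z nz; have fe' := AT_norm_le_pow q1 e0 fe.
have [u [u0 uf us]] := HB f fa (le_lt_trans fe' (ltry _)).
have nn j : (0 <= ((dyad j `^ al * u j) `^ q)%:E)%E by rewrite lee_fin powR_ge0.
have h : (((dyad n `^ al * u n) `^ q)%:E <= (B * e `^ q)%:E)%E.
  apply: le_trans (nneseries_ge_term n nn) _; apply: (le_trans us).
  by rewrite EFinM; apply: lee_wpmul2l => //; rewrite lee_fin ltW.
rewrite lee_fin in h.
have x0 : 0 <= dyad n `^ al * u n by rewrite mulr_ge0 ?powR_ge0.
apply: (@le_trans _ _ (dyad n `^ al * u n)); first by rewrite ler_wpM2l ?powR_ge0 ?uf.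
apply: (le_trans (le_powR_inv q0 x0 h)).
by rewrite powRM ?(ltW B0) ?powR_ge0// -powRrM mulfV ?gt_eqF// powRr1.
Qed.

Lemma AT_pointwise_vanishing (f : R[i] -> R[i]) : AT p q f ->
  forall e : R, 0 < e -> exists N, forall n z, (N <= n)%N -> dyadic_core n z ->
    dyad n `^ al * modc (f z) <= e.
Proof.
have [B B0 HB] := AT_sequence p1 q1; move=> [fa ff] e e0.
have ffin := (AT_norm_lty p q1 f).1 ff.
have [u [u0 uf us]] := HB f fa ffin.
have nn j : 0 <= (dyad j `^ al * u j) `^ q by rewrite powR_ge0.
have sfin : (\sum_(j <oo) ((dyad j `^ al * u j) `^ q)%:E < +oo)%E.
  apply: (le_lt_trans us); apply: lte_mul_pinfty => //.
  by rewrite lee_fin ltW.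
have [N HN] := summable_vanishing nn sfin (powR_gt0 q e0).
exists N => n z Nn nz.
apply: (@le_trans _ _ (dyad n `^ al * u n)); first by rewrite ler_wpM2l ?powR_ge0 ?uf.
have x0 : 0 <= dyad n `^ al * u n by rewrite mulr_ge0 ?powR_ge0.
apply: (le_trans (le_powR_inv q0 x0 (HN n Nn))).
by rewrite -powRrM mulfV ?gt_eqF// powRr1 ?(ltW e0).
Qed.

Lemma analytic_sub (f g : R[i] -> R[i]) : analytic_on_disc f -> analytic_on_disc g ->
  analytic_on_disc (fun z => f z - g z).
Proof.
move=> fa ga a a1; apply/analytic_atP.
have /analytic_atP[c [d [d0 Hc]]] := fa a a1.
have /analytic_atP[c' [d' [d'0 Hc']]] := ga a a1.
exists (fun n => c n + -1 * c' n), (Num.min d d'); split; first by rewrite lt_min d0.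
move=> z; rewrite lt_min => /andP[/Hc h /Hc' h'].
have := has_csumD h (has_csumZ (-1) h'); rewrite mulN1r.
by congr has_csum; apply/funext => n; rewrite mulrDl mulrA.
Qed.

Lemma compact_VCM : I_compact mu p q -> is_1VCM mu.
Proof.
move=> [wd cpt]; apply/is_1VCMP; apply: contrapT.
move=> /existsNP[e /not_implyP[e0 /forallNP He]].
have /choice[m Hm] : forall i, exists n, (i <= n)%N /\ e < eps n.
  move=> i; have /existsNP[n /not_implyP[h1 /negP]] := He i.
  by rewrite -ltNge => h2; exists n.
have [K HK] := test_fun_AT p1 q1 pq.
have K0 : 0 <= K.
  by rewrite -lee_fin; apply: le_trans (HK 0%N).2; exact: AT_pow_ge0.
have [|k [g [kmono ATg]]] := cpt (fun i => test_fun p q (m i)) (fun i => (HK (m i)).1).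
  exists (K `^ q^-1) => i; rewrite AT_normE -poweR_EFin.
  by apply: le_poweR; rewrite ?invr_gt0 ?AT_pow_ge0 ?(HK _).2.
move=> /ge0_cvge0P H; have {}H := H (fun n => AT_norm_ge0 p q _).
have [B B0 HB] := AT_pointwise.
(* At the chosen n the image would have weighted size at least eps_n / 4 > e/4, while the limit g
   and the difference from it contribute at most e/16 each. *)
have e16 : 0 < e / 16 by rewrite divr_gt0.
have [N1 _ HN1] := H (e / 16 / B) (divr_gt0 e16 B0).
have [N2 HN2] := AT_pointwise_vanishing ATg e16.
(* Both m and the strictly increasing k dominate the identity, so n lies beyond the threshold for g
   as well. *)
pose i := maxn N1 N2; pose n := m (k i).
have ki : (i <= k i)%N.
  elim: (i) => // j IH; apply: leq_ltn_trans IH _; exact: kmono.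
have iN : (N2 <= n)%N.
  apply: leq_trans (Hm (k i)).1; apply: leq_trans ki; exact: leq_maxr.
have [ATn _] := HK n.
have [_ [Ian _]] := wd _ ATn.
have low := test_fun_lower (well_defined_cintegrable wd ATn).
have core := @dyadic_core_left R n.
have h1 := HN2 n _ iN core.
have eB : 0 <= e / 16 / B by rewrite ltW// divr_gt0.
have h2 := HB _ _ (analytic_sub Ian ATg.1) eB (HN1 i (leq_maxl _ _)) n _ core.
rewrite [B * _]mulrC divfK ?gt_eqF// in h2.
have h3 := modcB_ge (I_op mu (test_fun p q n) (1 - dyad n)%:C%C) (g (1 - dyad n)%:C%C).
have h4 := ler_wpM2l (powR_ge0 (dyad n) al) h3; rewrite mulrBr in h4.
have h5 := (Hm (k i)).2; rewrite -/n in h5.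
by move: low h1 h2 h4 h5 e0; rewrite -/al; lra.
Qed.

(* Where the measure is small the Carleson weights absorb the size of h; on
   the remaining part [0, 1 - d_K) of the radius h itself is small. *)
Lemma small_I_op (S e : R) : carleson_vanishing -> 0 <= S -> 0 < e ->
  exists K, exists2 tau : R, 0 < tau & forall (h : R[i] -> R[i]) (b : nat -> R),
    (forall j, 0 <= b j) -> cmeas (fun t : R => h t%:C%C) -> dyadic_bound h b ->
    (forall N, \sum_(0 <= j < N) (dyad j `^ al * b j) `^ q <= S) ->
    (forall t : R, 0 <= t < 1 - dyad K -> modc (h t%:C%C) <= tau) ->
    (AT_pow p q (I_op mu h) <= e%:E)%E.
Proof.
move=> Hv S0 e0; have [C C0 HC] := I_op_bound p1 q1 pq.
have [M HM] := carleson_vanishing_bounded Hv.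
have M0 : 0 <= M by apply: le_trans (HM 0%N); exact: carleson_eps_ge0.
have qK (x : R) : 0 <= x -> (x `^ q^-1) `^ q = x.
  by move=> x0; rewrite -powRrM mulVf ?gt_eqF// powRr1.
(* e / C is split in halves. Beyond K, eps_j^q <= D and D S is at most one half; the K head terms
   are each at most P, chosen below so that K P is at most the other. The added ones keep the
   denominators positive. *)
pose D := e / (2 * C * (S + 1)).
have D0 : 0 < D by rewrite divr_gt0// !mulr_gt0// ltr_wpDl.
have [K HK] := Hv (D `^ q^-1) (powR_gt0 _ D0).
pose P : R := e / (2 * C * (K%:R + 1)).
have P0 : 0 < P by rewrite divr_gt0// !mulr_gt0// ltr_wpDl.
have M1 : 0 < M + 1 by rewrite ltr_wpDl.
pose tau := P `^ q^-1 / (M + 1).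
have tau0 : 0 < tau by rewrite divr_gt0// powR_gt0.
exists K, tau => // h b b0 mh hb bS hK.
(* A new majorant of the same h: the uniform smallness on [0, 1 - d_K) replaces b on the head. *)
pose c j := if (j < K)%N then tau else b j.
have c0 j : 0 <= c j by rewrite /c; case: ifP => // _; exact: ltW.
have hc : dyadic_bound h c.
  move=> j t jt; rewrite /c; case: ifP => jK; last exact: hb.
  apply: hK; have /andP[t1 t2] := jt; apply/andP; split.
    by apply: le_trans t1; rewrite subr_ge0 dyad_le1.
  by apply: (lt_le_trans t2); rewrite lerD2l lerN2 dyad_le.
have dal j : 0 <= dyad j `^ al <= 1.
  rewrite powR_ge0/=; have -> : (1 : R) = 1 `^ al by rewrite powR1.
  apply: ge0_ler_powR; rewrite ?nnegrE ?(ltW al0) ?dyad_le1//.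
  by rewrite ltW// dyad_gt0.
have term j : (eps j * (dyad j `^ al * c j)) `^ q <=
    (j < K)%N%:R * P + D * (dyad j `^ al * b j) `^ q.
  have ej := carleson_eps_ge0 mu j; have /andP[d0 d1] := dal j.
  rewrite /c; case: (ltnP j K) => jK.
    rewrite mul1r.
    suff h1 : (eps j * (dyad j `^ al * tau)) `^ q <= P.
      by apply: (le_trans h1); rewrite lerDl mulr_ge0 ?powR_ge0// ltW.
    rewrite -[leRHS]qK ?(ltW P0)//.
    apply: ge0_ler_powR; rewrite ?nnegrE ?powR_ge0 ?(ltW q0)//.
      by apply: mulr_ge0 => //; apply: mulr_ge0 => //; exact: ltW.
    have -> : P `^ q^-1 = (M + 1) * tau by rewrite mulrC divfK ?gt_eqF.
    apply: ler_pM => //; first by rewrite mulr_ge0// ltW.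
      by apply: le_trans (HM j) _; rewrite lerDl.
    by rewrite ler_piMl// ltW.
  rewrite mul0r add0r powRM//; last by rewrite mulr_ge0.
  rewrite ler_wpM2r ?powR_ge0// -[leRHS]qK ?(ltW D0)//.
  by apply: ge0_ler_powR; rewrite ?nnegrE ?powR_ge0 ?(ltW q0) ?HK.
have eC0 : 0 <= e / C by rewrite divr_ge0// ltW.
have W : (\sum_(j <oo) ((eps j * (dyad j `^ (p^-1 + q^-1) * c j)) `^ q)%:E <= (e / C)%:E)%E.
  apply: nneseries_le_ub => [j|N]; first by rewrite lee_fin powR_ge0.
  rewrite sumEFin lee_fin.
  apply: (le_trans (ler_sum _ (fun j _ => term j))).
  rewrite big_split/= -mulr_sumr.
  apply: (le_trans (lerD (sum_head_le K N (ltW P0)) (ler_wpM2l (ltW D0) (bS N)))).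
  have h1 : K%:R * P <= e / C / 2.
    rewrite /P; have K1 : 0 < K%:R + 1 :> R by rewrite ltr_wpDl.
    rewrite mulrA ler_pdivrMr ?mulr_gt0//.
    have -> : e / C / 2 * (2 * C * (K%:R + 1)) = (K%:R + 1) * e by field; rewrite gt_eqF.
    by rewrite ler_wpM2r ?(ltW e0)// lerDl.
  have h2 : D * S <= e / C / 2.
    rewrite /D; have S1 : 0 < S + 1 by rewrite ltr_wpDl.
    rewrite mulrC mulrA ler_pdivrMr ?mulr_gt0//.
    have -> : e / C / 2 * (2 * C * (S + 1)) = (S + 1) * e by field; rewrite gt_eqF.
    by rewrite ler_wpM2r ?(ltW e0)// lerDl.
  by rewrite [leRHS]splitr lerD.
have [_ _ Ib] := HC mu h c c0 mh hc (le_lt_trans W (ltry _)).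
apply: (le_trans Ib); apply: (@le_trans _ _ (C%:E * (e / C)%:E)%E).
  by apply: lee_wpmul2l => //; rewrite lee_fin ltW.
by rewrite -EFinM lee_fin mulrC divfK// gt_eqF.
Qed.

Lemma strict_subsequence (P : nat -> nat -> Prop) :
  (forall j m, exists2 n, (m < n)%N & P j n) ->
  exists k : nat -> nat, {homo k : m n / (m < n)%N} /\ forall j, P j (k j).
Proof.
move=> H; have {}H (jm : nat * nat) : exists n, (jm.2 < n)%N /\ P jm.1 n.
  by have [n h1 h2] := H jm.1 jm.2; exists n.
have [s Hs] := choice H.
pose k := fix k j := if j is j'.+1 then s (j, k j') else s (0%N, 0%N).
exists k; split; last by case=> [|j]; exact: (Hs (_, _)).2.
apply: homo_ltn => [|j]; first exact: ltn_trans.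
exact: (Hs (j.+1, k j)).1.
Qed.

(** Both the functions on the radius and their majorants u_n have ultralimits. The limit majorant v
    inherits summability through finite partial sums, so the image of the limit lies in AT; the
    differences have weighted sums bounded independently of n and are uniformly small on [0, 1 -
    d_K) for n in a set of U, which is what [small_I_op] asks. *)
Lemma bounded_ultralimit_image (U : set_system nat) (f : nat -> R[i] -> R[i]) (A : R) :
  carleson_vanishing -> UltraFilter U -> (forall n, AT p q (f n)) -> 0 <= A ->
  (forall n, (AT_norm p q (f n) <= A%:E)%E) ->
  exists2 g, AT p q g & forall e : R, 0 < e ->
    U [set n | (AT_norm p q (fun z => (I_op mu (f n) z - g z)%R) <= e%:E)%E].
Proof.
move=> Hv UU ATf A0 fA.
have [B B0 HB] := AT_sequence p1 q1.
pose S := B * A `^ q.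
have S0 : 0 <= S by rewrite mulr_ge0 ?powR_ge0// ltW.
have /choice[u Hu] : forall n, exists u : nat -> R,
    [/\ forall k, 0 <= u k, forall k z, dyadic_core k z -> modc (f n z) <= u k &
      (\sum_(k <oo) ((dyad k `^ al * u k) `^ q)%:E <= S%:E)%E].
  move=> n; have [fa ff] := ATf n.
  have fp := AT_norm_le_pow q1 A0 (fA n).
  have [u [u0 uf us]] := HB _ fa (le_lt_trans fp (ltry _)).
  exists u; split => //; apply: (le_trans us); rewrite EFinM.
  by apply: lee_wpmul2l => //; rewrite lee_fin ltW.
have u0 n j : 0 <= u n j by have [h _ _] := Hu n; exact: h.
have uf n j z : dyadic_core j z -> modc (f n z) <= u n j.
  by have [_ h _] := Hu n; exact: h.
have x0 (v : nat -> R) : (forall j, 0 <= v j) -> forall j, 0 <= dyad j `^ al * v j.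
  by move=> v0 j; rewrite mulr_ge0 ?powR_ge0.
have us n N : \sum_(0 <= j < N) (dyad j `^ al * u n j) `^ q <= S.
  have [_ _ h] := Hu n.
  by apply: partial_sum_le_nneseries N; [move=> j; exact: powR_ge0|exact: h].
(* Each single term of the sum gives d_j^al u_j <= S^(1/q), and d_K <= d_j for j < K. *)
pose W K := S `^ q^-1 / dyad K `^ al.
have da k : 0 < dyad k `^ al by rewrite powR_gt0// dyad_gt0.
have uW n j : u n j <= W j.
  rewrite ler_pdivlMr// mulrC; apply: le_powR_inv => //; first exact: x0.
  apply: le_trans (us n j.+1); rewrite big_nat_recr//= lerDr.
  by apply: sumr_ge0 => i _; exact: powR_ge0.
have fW n K j z : (j < K)%N -> dyadic_core j z -> modc (f n z) <= W K.
  move=> jK /(uf n) h; apply: (le_trans h); apply: (le_trans (uW n j)).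
  rewrite ler_wpM2l ?powR_ge0// lef_pV2 ?posrE//.
  apply: ge0_ler_powR; rewrite ?nnegrE ?(ltW al0)//.
  - exact: ltW (dyad_gt0 _).
  - exact: ltW (dyad_gt0 _).
  - exact: dyad_le (ltnW jK).
have [phi [phiU phic]] := locally_uniform_ultralimit UU (fun n => (ATf n).1) fW.
have /choice[v Hv'] : forall j, exists l, forall e : R, 0 < e -> U [set n | `|u n j - l| <= e].
  move=> j; apply: (@bounded_ultralimit R U _ (W j)) => n.
  by rewrite ger0_norm.
have v0 j : 0 <= v j.
  apply/ler_addgt0Pr => e e0; have [n /= h] := filter_ex (Hv' j e e0).
  by move: h; rewrite ler_norml => /andP[_ h]; have := u0 n j; lra.
(* Composing with |Re z| is a way to feed phi to [I_op], which reads only its values on [0, 1); h is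
   not claimed to be analytic. *)
pose h (z : R[i]) := phi `|complex.Re z|.
have hE (t : R) : 0 <= t -> h t%:C%C = phi t by move=> t0; rewrite /h /= ger0_norm.
have mh : cmeas (fun t : R => h t%:C%C) by apply: ccont_cmeas.
have hv : dyadic_bound h v.
  move=> j t jt; have /andP[t1 t2] := jt.
  have t0 : 0 <= t by apply: le_trans t1; rewrite subr_ge0 dyad_le1.
  rewrite hE//; apply/ler_addgt0Pr => e e0; have e2 : 0 < e / 2 by rewrite divr_gt0.
  have [n [/= h1 h2]] := filter_ex (filterI (phiU j.+1 _ e2) (Hv' j _ e2)).
  have := h1 t; rewrite t0 t2 => /(_ isT) h3.
  have h4 := uf n j _ (dyadic_core_real jt).
  have h5 := modcB_ge (phi t) (f n t%:C%C); rewrite modcB in h5.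
  by move: h2; rewrite ler_norml => /andP[h6 h7]; lra.
have vS N : \sum_(0 <= j < N) (dyad j `^ al * v j) `^ q <= 2 `^ q * (S + 1).
  (* With t^q = 1 / (N + 1) the N errors made in replacing v_j by u_n j add up to at most 1, which
     is the 1 in S + 1. *)
  pose t : R := (N.+1%:R^-1) `^ q^-1.
  have N0 : 0 < N.+1%:R^-1 :> R by rewrite invr_gt0.
  have t0 : 0 < t by rewrite powR_gt0.
  have UN : U [set n | forall j : 'I_N, `|u n j - v j| <= t].
    by apply: (@filter_forall _ _ (fun j : 'I_N => [set n | `|u n j - v j| <= t])) => j; exact: Hv'.
  have [n /= Hn] := filter_ex UN.
  have le1 j : (j < N)%N -> (dyad j `^ al * v j) `^ q <=
      2 `^ q * ((dyad j `^ al * u n j) `^ q + N.+1%:R^-1).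
    move=> jN; have := Hn (Ordinal jN); rewrite /= ler_norml => /andP[h1 h2].
    have -> : N.+1%:R^-1 = t `^ q :> R.
      by rewrite /t -powRrM mulVf ?gt_eqF// powRr1// ltW.
    apply: le_trans (powR_add_le q0 (x0 _ (u0 n) j) (ltW t0)).
    apply: ge0_ler_powR; rewrite ?nnegrE ?(ltW q0) ?addr_ge0 ?x0 ?(ltW t0)//.
    have d1 : dyad j `^ al <= 1.
      have -> : (1 : R) = 1 `^ al by rewrite powR1.
      apply: ge0_ler_powR; rewrite ?nnegrE ?(ltW al0) ?dyad_le1//.
      exact: ltW (dyad_gt0 _).
    by have := da j; nra.
  apply: (@le_trans _ _ (\sum_(0 <= j < N) 2 `^ q * ((dyad j `^ al * u n j) `^ q + N.+1%:R^-1))).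
    by rewrite !big_mkord; apply: ler_sum => j _; exact: le1.
  rewrite -mulr_sumr ler_wpM2l ?powR_ge0// big_split/= lerD//.
  rewrite sumr_const_nat subn0 -[_ *+ N]mulr_natl ler_pdivrMr// mul1r ler_nat.
  exact: leqnSn.
have [M HM] := carleson_vanishing_bounded Hv.
have eM j : 0 <= eps j <= M by rewrite carleson_eps_ge0 HM.
have [C C0 HC] := I_op_bound p1 q1 pq.
have Wv : (\sum_(j <oo) ((eps j * (dyad j `^ al * v j)) `^ q)%:E < +oo)%E.
  apply: le_lt_trans (weighted_sum_le p q1 eM v0) _; apply: lte_mul_pinfty => //.
    by rewrite lee_fin powR_ge0.
  apply: le_lt_trans (ltry (2 `^ q * (S + 1))).
  apply: nneseries_le_ub => [j|N]; first by rewrite lee_fin powR_ge0.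
  by rewrite sumEFin lee_fin; exact: vS.
have [_ ih Ib] := HC mu h v v0 mh hv Wv.
have ATg : AT p q (I_op mu h).
  split; first exact: I_op_analytic.
  apply/(AT_norm_lty p q1); apply: (le_lt_trans Ib).
  by apply: lte_mul_pinfty => //; rewrite lee_fin ltW.
exists (I_op mu h) => // e e0.
(* The bound for the majorants u_n + v of the differences, from (a + b)^q <= 2^q (a^q + b^q) and the
   partial sums of u_n and v. *)
pose S2 := 2 `^ q * (S + 2 `^ q * (S + 1)).
have S20 : 0 <= S2 by rewrite mulr_ge0 ?powR_ge0// addr_ge0// mulr_ge0 ?powR_ge0// addr_ge0.
have [K [tau tau0 Hs]] := small_I_op Hv S20 (powR_gt0 q e0).
have [K' K'0 HK'] := I_op_AT p1 q1 pq HM.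
apply: filterS (phiU K tau tau0) => n /= Hn.
have [_ ifn _ _] := HK' _ (ATf n).
rewrite (AT_norm_ext p q (g := I_op mu (fun w => f n w - h w))); last first.
  by move=> z z1; exact: I_opB.
have mfh : cmeas (fun t : R => f n t%:C%C - h t%:C%C).
  have := cmeasD ifn.1 (cmeasM (cmeas_cst (-1)) mh).
  by congr cmeas; apply/funext => t; rewrite mulN1r.
have b0 j : 0 <= u n j + v j by rewrite addr_ge0.
have hb : dyadic_bound (fun w => f n w - h w) (fun j => u n j + v j).
  move=> j t jt; apply: le_trans (modcD _ _) _; rewrite modcN lerD//; last exact: hv.
  exact: uf (dyadic_core_real jt).
have bS N : \sum_(0 <= j < N) (dyad j `^ al * (u n j + v j)) `^ q <= S2.
  apply: (@le_trans _ _ (\sum_(0 <= j < N) 2 `^ q *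
      ((dyad j `^ al * u n j) `^ q + (dyad j `^ al * v j) `^ q))).
    apply: ler_sum => j _; rewrite mulrDr; apply: powR_add_le => //; exact: x0.
  by rewrite -mulr_sumr ler_wpM2l ?powR_ge0// big_split/= lerD.
have hK (t : R) : 0 <= t < 1 - dyad K -> modc (f n t%:C%C - h t%:C%C) <= tau.
  by move=> /[dup] tK /andP[t0 _]; rewrite hE//; exact: Hn.
have := Hs _ _ b0 mfh hb bS hK => le.
rewrite AT_normE -[e%:E]poweRe1 ?lee_fin ?(ltW e0)//.
have -> : (e%:E = poweR (e `^ q)%:E q^-1)%E.
  by rewrite poweR_EFin -powRrM mulfV ?gt_eqF// powRr1// ltW.
rewrite poweRe1 ?poweR_ge0//.
by apply: le_poweR; rewrite ?invr_gt0 ?AT_pow_ge0.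
Qed.

Lemma VCM_compact : is_1VCM mu -> I_compact mu p q.
Proof.
move=> /is_1VCMP Hv; have [M HM] := carleson_vanishing_bounded Hv.
have [K K0 HK] := I_op_AT p1 q1 pq HM.
split; first by move=> f /HK[].
move=> f ATf [A fA].
(* U contains every tail of the integers, so each of its sets is infinite; this lets the extracted
   indices be strictly increasing. *)
have [U [UU infU]] := ultraFilterLemma (eventually_filter).
have [||g ATg HU] := bounded_ultralimit_image (A := Num.max A 0) Hv UU ATf.
- by rewrite le_max lexx orbT.
- by move=> n; apply: (le_trans (fA n)); rewrite lee_fin le_max lexx.
have [|k [kmono Hk]] := @strict_subsequence (fun j n =>
    (AT_norm p q (fun z => (I_op mu (f n) z - g z)%R) <= (j.+1%:R^-1)%:E)%E).
  move=> j m; have j0 : 0 < j.+1%:R^-1 :> R by rewrite invr_gt0.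
  have mU : U [set n | (m < n)%N] by apply: infU; exists m.+1.
  by have [n [/= h1 h2]] := filter_ex (filterI mU (HU _ j0)); exists n.
exists k, g; split => //.
apply/ge0_cvge0P => [n|e e0]; first exact: AT_norm_ge0.
exists (Num.truncn e^-1) => // n /= hn; apply: (le_trans (Hk n)).
rewrite lee_fin -[leRHS]invrK lef_pV2 ?posrE ?invr_gt0//.
apply: ltW; apply: (lt_le_trans (_ : _ < (Num.truncn e^-1).+1%:R)).
  by have /andP[] := truncn_itv (ltW (etrans (invr_gt0 e) e0)).
by rewrite ler_nat.
Qed.

End Compactness.

(* A finite positive Borel measure on [0, 1) is a finite Borel measure on the
   line that does not charge the complement of [0, 1). *)
Theorem theorem1p5 (R : realType) (p q : R)
    (p_gt1 : 1 < p) (q_gt1 : 1 < q) (pq : p^-1 + q^-1 < 1)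
    (mu : {finite_measure set (measurableTypeR R) -> \bar R})
    (mu_supp : mu (~` `[0, 1[%classic) = 0%E) :
  (I_bounded mu p q <-> is_1CM mu) /\
  (I_compact mu p q <-> is_1VCM mu).
Proof.
split; split.
- exact: bounded_CM.
- exact: CM_bounded.
- exact: compact_VCM.
- exact: VCM_compact.
Qed.
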